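(* Let $V\in L^\infty(\mathbb{R}^3,\mathbb{C}^{4\times 4})$ be compactly supported (not necessarily Hermitian-valued) and let $H=\mathbf{D}+V$. Let $T$ be the time-reversal operator $T\psi=-i\gamma_5\alpha_2\overline{\psi}$ on $L^2(\mathbb{R}^3,\mathbb{C}^4)$, where $\gamma_5=-i\alpha_1\alpha_2\alpha_3$, and assume that $TV=V^*T$. Then every resonance $(\lambda,\kappa)$ of $H$ such that $\kappa\notin i(-\infty,0]$ has even multiplicity.
   Context: Notation: $L^2=L^2(\mathbb{R}^3,\mathbb{C}^4)$, $H^1=H^1(\mathbb{R}^3,\mathbb{C}^4)$. $\beta,\alpha_1,\alpha_2,\alpha_3\in\mathbb{C}^{4\times4}$ are the Dirac matrices (standard representation: $\beta=\mathrm{diag}(I_2,-I_2)$, $\alpha_j=\begin{pmatrix}0&\sigma_j\\ \sigma_j&0\end{pmatrix}$ with $\sigma_j$ the Pauli matrices) and $\alpha\cdot v=\sum_{j=1}^3\alpha_jv_j$. The free Dirac operator $\mathbf{D}=\beta-i\alpha\cdot\nabla$ is self-adjoint in $L^2$ with domain $H^1$ and spectrum $(-\infty,-1]\cup[1,+\infty)$. The operator $H=\mathbf{D}+V$ has domain $H^1$. The operator $T$ is anti-linear, anti-unitary and satisfies $T^2=-1$; in $TV=V^*T$, $V$ and its pointwise adjoint $V^*$ act as multiplication operators. Resonances: let $\mathcal{M}=\{(z,\omega)\in\mathbb{C}^2:\ \omega^2=z^2-1\}$ (a Riemann surface). It is known that there is a (unique) finite meromorphic function $\mathcal{R}$ (meromorphic,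 with finite-rank coefficients in the principal parts of its Laurent expansions) from $\mathcal{M}$ to $\mathcal{L}(L^2_{\mathrm{comp}},H^1_{\mathrm{loc}})$ such that if $(z,\omega)\in\mathcal{M}$ is not a pole of $\mathcal{R}$ and $\operatorname{Im}\omega>0$, then $z\notin\operatorname{Sp}(H)$ and $\mathcal{R}(z,\omega)=(H-z)^{-1}$ on $L^2_{\mathrm{comp}}$. A resonance of $H$ is a pole $(\lambda,\kappa)\in\mathcal{M}$ of $\mathcal{R}$; when $\kappa\neq0$ its multiplicity is the rank of the residue of $\mathcal{R}$ at $(\lambda,\kappa)$ in any local chart near $(\lambda,\kappa)$ (for instance using $z$ as local coordinate). *)

(* Defs.v *)
From HB Require Import structures.
From mathcomp Require Import all_boot all_order all_algebra.
From mathcomp Require Import all_classical all_reals all_analysis.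
From mathcomp Require Import complex.
Set Implicit Arguments.
Unset Strict Implicit.
Unset Printing Implicit Defensive.
Import Order.TTheory GRing.Theory Num.Theory.
Import numFieldNormedType.Exports.
Local Open Scope classical_set_scope.
Local Open Scope ring_scope.
Local Open Scope complex_scope.

(** Elements of L^2, H^1, L^2_comp and H^1_loc are represented by functions
    R^3 -> C^4 taken up to equality almost everywhere; operators between these
    spaces act on representatives and are compared almost everywhere. *)

Definition R3 (R : realType) : Type :=
  (measurableTypeR R * measurableTypeR R * measurableTypeR R)%type.
Definition spinor (R : realType) : Type := R3 R -> 'cV[R[i]]_(2 + 2).
Definition operator (R : realType) : Type := spinor R -> spinor R.

Section Dirac_resonances.
Variable R : realType.
Local Notation C := R[i].
(* Inside the section these are notations, so that the canonical structures
   on products, functions and matrices are found. *)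
Local Notation R3 :=
  (measurableTypeR R * measurableTypeR R * measurableTypeR R)%type.
Local Notation spinor := (R3 -> 'cV[C]_(2 + 2)).
Local Notation operator := (spinor -> spinor).

Definition leb3 : {measure set R3 -> \bar R} :=
  ((@lebesgue_measure R \x @lebesgue_measure R) \x @lebesgue_measure R)%E.

(** * Dirac matrices, standard representation *)

Definition sigma (j : 'I_3) : 'M[C]_(1 + 1) :=
  if j == 0 then block_mx 0 1%:M 1%:M 0
  else if j == 1 then block_mx 0 ((- 'i)%:M) ('i)%:M 0
  else block_mx 1%:M 0 0 ((- 1)%:M).

Definition alpha (j : 'I_3) : 'M[C]_(2 + 2) :=
  block_mx 0 (sigma j : 'M[C]_2) (sigma j : 'M[C]_2) 0.

Definition beta : 'M[C]_(2 + 2) := block_mx 1%:M 0 0 (- 1%:M).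

Definition gamma5 : 'M[C]_(2 + 2) :=
  (- 'i) *: (alpha 0 *m alpha 1 *m alpha 2%:R).

(** * Lebesgue and Sobolev spaces *)

Definition cmeasurable (f : R3 -> C) :=
  measurable_fun setT (fun x => complex.Re (f x)) /\
  measurable_fun setT (fun x => complex.Im (f x)).

Definition cintegral (f : R3 -> C) : C :=
  Rintegral leb3 setT (fun x => complex.Re (f x)) +i*
  Rintegral leb3 setT (fun x => complex.Im (f x)).

Definition vnorm (v : 'cV[C]_(2 + 2)) : R :=
  Num.sqrt (\sum_i (complex.Re (v i 0) ^+ 2 + complex.Im (v i 0) ^+ 2)).

Definition L2norm (u : spinor) : \bar R :=
  Lnorm leb3 2%:E (fun x => (vnorm (u x))%:E).

Definition L2 : set spinor :=
  [set u : spinor | (forall i, cmeasurable (fun x => u x i 0)) /\ (L2norm u < +oo)%E].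

Definition e3 (j : 'I_3) : R3 := ((j == 0)%:R, (j == 1)%:R, (j == 2%:R)%:R).

Definition partial (j : 'I_3) (phi : R3 -> R) : R3 -> R :=
  fun x => 'D_(e3 j) phi x.

(* real-valued C_c^oo(R^3) *)
Definition test_function (phi : R3 -> R) :=
  (forall (s : seq 'I_3) (x : R3), differentiable (foldr partial phi s) x) /\
  (exists rho : R, forall x : R3, rho < `|x| -> phi x = 0).

Definition is_weak_partial (j : 'I_3) (u g : spinor) :=
  forall phi, test_function phi -> forall i,
    cintegral (fun x => u x i 0 * (partial j phi x)%:C) =
    - cintegral (fun x => g x i 0 * (phi x)%:C).

(* the L^2 weak derivative (unique almost everywhere); 0 if there is none *)
Definition weak_partial (j : 'I_3) (u : spinor) : spinor :=
  xget 0 [set g : spinor | L2 g /\ is_weak_partial j u g].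

Definition H1 : set spinor :=
  [set u : spinor | L2 u /\ forall j, exists2 g, L2 g & is_weak_partial j u g].

(* meaningful on H1 *)
Definition H1norm (u : spinor) : \bar R :=
  ((L2norm u ^+ 2 + \sum_(j < 3) L2norm (weak_partial j u) ^+ 2) `^ 2^-1)%E.

Definition supported_in_ball (rho : R) (u : spinor) :=
  \forall x \ae leb3, rho < `|x| -> u x = 0.

Definition L2comp : set spinor :=
  [set u : spinor | L2 u /\ exists rho, supported_in_ball rho u].

Definition cutoff (chi : R3 -> R) (u : spinor) : spinor :=
  fun x => (chi x)%:C *: u x.

Definition H1loc : set spinor :=
  [set u : spinor | forall chi, test_function chi -> H1 (cutoff chi u)].

(** * The operator H = D + V and its resolvent *)

Definition Dirac (u : spinor) : spinor := fun x =>
  beta *m u x - 'i *: \sum_j (alpha j *m weak_partial j u x).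

Definition mulop (V : R3 -> 'M[C]_(2 + 2)) (u : spinor) : spinor :=
  fun x => V x *m u x.

Definition DiracV (V : R3 -> 'M[C]_(2 + 2)) (u : spinor) : spinor :=
  Dirac u + mulop V u.

Definition Linfty (V : R3 -> 'M[C]_(2 + 2)) :=
  (forall i j, cmeasurable (fun x => V x i j)) /\
  (exists M : R, \forall x \ae leb3, forall i j, `|V x i j| <= M%:C).

Definition compactly_supported (V : R3 -> 'M[C]_(2 + 2)) :=
  exists rho : R, \forall x \ae leb3, rho < `|x| -> V x = 0.

Definition adjoint (V : R3 -> 'M[C]_(2 + 2)) : R3 -> 'M[C]_(2 + 2) :=
  fun x => (map_mx conjc (V x))^T.

Definition time_reversal (psi : spinor) : spinor :=
  fun x => (- 'i) *: (gamma5 *m alpha 1 *m map_mx conjc (psi x)).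

Definition bounded_on_L2 (S : operator) :=
  (forall (a : C) f g, L2 f -> L2 g ->
     S (a *: f + g) = a *: S f + S g %[ae leb3]) /\
  (exists M : R, forall f, L2 f -> (L2norm (S f) <= M%:E * L2norm f)%E).

(* S = (H - z)^-1, with H of domain H1 *)
Definition is_resolvent (V : R3 -> 'M[C]_(2 + 2)) (z : C) (S : operator) :=
  [/\ bounded_on_L2 S,
      forall f, L2 f ->
        H1 (S f) /\ DiracV V (S f) - z *: S f = f %[ae leb3] &
      forall u, H1 u -> S (DiracV V u - z *: u) = u %[ae leb3]].

Definition spectrum (V : R3 -> 'M[C]_(2 + 2)) : set C :=
  [set z | ~ exists S, is_resolvent V z S].

(** * The space L(L^2_comp, H^1_loc) *)

(* the norm of chi A restricted to L^2 functions supported in a ball; these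
   seminorms define the topology of L(L^2_comp, H^1_loc) *)
Definition opnorm (chi : R3 -> R) (rho : R) (A : operator) : \bar R :=
  ereal_sup [set H1norm (cutoff chi (A f)) | f in
    [set f : spinor | [/\ L2 f, supported_in_ball rho f & (L2norm f <= 1)%E]]].

Definition is_op (A : operator) :=
  [/\ forall (a : C) f g, L2comp f -> L2comp g ->
        A (a *: f + g) = a *: A f + A g %[ae leb3],
      forall f, L2comp f -> H1loc (A f),
      forall f g, L2comp f -> L2comp g ->
        f = g %[ae leb3] -> A f = A g %[ae leb3] &
      forall chi rho, test_function chi -> (opnorm chi rho A < +oo)%E].

Definition op_eq (A B : operator) :=
  forall f, L2comp f -> A f = B f %[ae leb3].

Definition has_rank (A : operator) (m : nat) :=
  exists f : 'I_m -> spinor,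
  [/\ forall k, L2comp (f k),
      forall c : 'I_m -> C,
        \sum_k c k *: A (f k) = (0 : spinor) %[ae leb3] -> forall k, c k = 0 &
      forall g, L2comp g -> exists c : 'I_m -> C,
        A g = \sum_k c k *: A (f k) %[ae leb3]].

(** * Meromorphic functions on M = {w^2 = z^2 - 1} *)

Definition riemann_surface : set (C * C) := [set p | p.2 ^+ 2 = p.1 ^+ 2 - 1].

(* A local coordinate of M near p0 and vanishing at p0: z - z0, except at the
   branch points of z (where w = 0), at which it is w. *)
Definition local_coord (p0 p : C * C) : C :=
  if p0.2 == 0 then p.2 else p.1 - p0.1.

(* sum_(n >= - N) A_n t^n is the Laurent expansion of F at p0, where t is the
   local coordinate above; the two distance conditions keep p on the sheet of
   p0 when r is small. *)
Definition is_laurent (F : C * C -> operator) (p0 : C * C) (A : int -> operator) :=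
  (forall n, is_op (A n)) /\
  exists (N : nat) (r : R),
  [/\ 0 < r,
      forall n : int, n < - N%:Z -> op_eq (A n) 0 &
      forall p, riemann_surface p -> p <> p0 ->
        `|p.1 - p0.1| < r%:C -> `|p.2 - p0.2| < r%:C ->
        is_op (F p) /\
        forall chi rho, test_function chi ->
          opnorm chi rho (F p - \sum_(k < K)
              local_coord p0 p ^ (k%:Z - N%:Z) *: A (k%:Z - N%:Z))
            @[K --> \oo] --> 0%E].

Definition is_pole (F : C * C -> operator) (p : C * C) :=
  exists2 A, is_laurent F p A & exists2 n : int, n < 0 & ~ op_eq (A n) 0.

(* The value of F at a pole is irrelevant. *)
Definition finitely_meromorphic (F : C * C -> operator) :=
  forall p, riemann_surface p -> exists A,
  [/\ is_laurent F p A,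
      forall n : int, n < 0 -> exists m, has_rank (A n) m &
      ~ is_pole F p -> op_eq (F p) (A 0)].

(** * Resonances *)

Definition resolvent_continuation (V : R3 -> 'M[C]_(2 + 2))
    (F : C * C -> operator) :=
  finitely_meromorphic F /\
  forall z w, riemann_surface (z, w) -> ~ is_pole F (z, w) ->
    0 < complex.Im w ->
    ~ spectrum V z /\
    forall S, is_resolvent V z S -> op_eq (F (z, w)) S.

Definition is_resonance (F : C * C -> operator) (p : C * C) :=
  riemann_surface p /\ is_pole F p.

(* To be used when p.2 != 0: local_coord p is then z - p.1, and A (-1) is the
   residue of F at p in the chart z. *)
Definition multiplicity (F : C * C -> operator) (p : C * C) (m : nat) :=
  exists2 A, is_laurent F p A & has_rank (A (-1)) m.

End Dirac_resonances.

(* Main.v *)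
From HB Require Import structures.
Require Import Defs.
From mathcomp Require Import all_boot all_order all_algebra.
From mathcomp Require Import all_classical all_reals all_analysis.
From mathcomp Require Import measurable_realfun complex ring lra.
Set Implicit Arguments.
Unset Strict Implicit.
Unset Printing Implicit Defensive.
Import Order.TTheory GRing.Theory Num.Theory.
Import numFieldNormedType.Exports.
Local Open Scope classical_set_scope.
Local Open Scope ring_scope.

(* Write T psi = J conj(psi) with the constant matrix J = -i gamma_5 alpha_2, and
   K = J^*, which is antisymmetric. The algebraic relations between K, beta and
   the alpha_j, together with TV = V^* T, make the operator H symmetric for the
   bilinear form B(f, h) = int f^T K h, which is antisymmetric; so
   B(f, (H - z)^-1 g) = - B(g, (H - z)^-1 f). On the Riemann surface,
   parametrized by s = z + w in C^*, the function
   phi(s) = B(f, R(s) g) + B(g, R(s) f) therefore vanishes where Im w > 0, that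
   is Im s > 0, away from poles; by analytic continuation along the half-line
   s_0 + i[0, +oo), which avoids 0 exactly when kappa is not in i(-oo, 0], all
   its Laurent coefficients at the resonance vanish. Hence B(f, A g) = - B(g, A f)
   for the residue A, and the matrix B(f_k, A f_l), where the A f_l form a basis
   of the range of A, is antisymmetric and invertible: its size is even. *)

(** The delicate point is the symmetry of H on H^1: weak derivatives are tested only against smooth
    compactly supported functions, whereas the form must be integrated by parts between two elements
    of H^1. Instead of a density argument, consider k(h) = <a'(. + h), b> + <a(. + h), b'>. Its
    integral against an even bump vanishes, because both derivatives can be moved onto the bump; it
    is continuous at 0, because translations are continuous in L^2; hence k(0) = 0. Invariance of
    Lebesgue measure on R^3 and explicit bumps are built for this. As R(s) g lies only in H^1_loc,
    the form is paired with truncations, and the work on the Riemann surface concerns scalar Laurent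
    series. No contour integral occurs: a coefficient is controlled by the growth of the sum near
    the centre. This single principle gives removability of singularities, hence isolation of poles,
    and also the identity theorem, hence continuation. The return from scalars to operators rests on
    nondegeneracy: pairing u with K conj(u) gives the squared L^2 norm of u. *)

Lemma lebesgue_measure_shift (R : realType) (h : R) (A : set (measurableTypeR R)) :
  measurable A ->
  pushforward lebesgue_measure (fun x : measurableTypeR R => x + h : measurableTypeR R) A
    = lebesgue_measure A.
Proof.
move=> mA; apply/esym.
have mf : measurable_fun setT (fun x : measurableTypeR R => x + h : measurableTypeR R).
  exact: measurable_funD.
apply: (@lebesgue_measure_unique R
  (pushforward lebesgue_measure (fun x : measurableTypeR R => x + h : measurableTypeR R))) => //.
move=> _ [[a b]] _ <- /=.
have -> : pushforward lebesgue_measure (fun x : measurableTypeR R => x + h : measurableTypeR R) `]a, b]%classic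
   = lebesgue_measure (`]a - h, b - h]%classic : set R).
  congr (lebesgue_measure _); apply/seteqP; split => x /=;
  by rewrite !in_itv/= ltrBlDr lerBrDr.
rewrite !lebesgue_measure_itv/= !lte_fin ltrD2r -!EFinB.
by congr (if _ then _ else _); congr (_%:E); ring.
Qed.

(** * Product measures: sigma-finiteness and invariance *)

Section product_sigma_finite.
Local Open Scope ereal_scope.
Context d1 d2 (T1 : measurableType d1) (T2 : measurableType d2) (R : realType).
Variable m1 : {sigma_finite_measure set T1 -> \bar R}.
Variable m2 : {sigma_finite_measure set T2 -> \bar R}.

(** R^3 is an iterated product: uniqueness of the outer product measure and Fubini's theorem need
    the inner product to be sigma-finite. Nondecreasing exhaustions let a single index serve both
    factors. *)
Lemma product_measure_sigma_finite : sigma_finite setT (m1 \x m2).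
Proof.
have [F [FT ndF Foo]] := (sigma_finiteP _ _).1 (sigma_finiteT m1).
have [G [GT ndG Goo]] := (sigma_finiteP _ _).1 (sigma_finiteT m2).
exists (fun n => F n `*` G n).
  apply/seteqP; split => // -[x y] _.
  have [n _ Fx] : (\bigcup_n F n) x by rewrite -FT.
  have [k _ Gy] : (\bigcup_n G n) y by rewrite -GT.
  exists (n + k)%N => //; split.
    by have /subsetPset := ndF _ _ (leq_addr k n); exact.
  by have /subsetPset := ndG _ _ (leq_addl n k); exact.
move=> n; have [mF ltF] := Foo n; have [mG ltG] := Goo n.
split; first exact: measurableX.
by rewrite product_measure1E// lte_mul_pinfty// ge0_fin_numE.
Qed.
End product_sigma_finite.

Section preserving.
Local Open Scope ereal_scope.
Context d1 d2 (T1 : measurableType d1) (T2 : measurableType d2) (R : realType).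
Variable m1 : {sigma_finite_measure set T1 -> \bar R}.
Variable m2 : {sigma_finite_measure set T2 -> \bar R}.
Variables (p1 : T1 -> T1) (p2 : T2 -> T2).
Hypothesis mp1 : measurable_fun setT p1.
Hypothesis mp2 : measurable_fun setT p2.
Hypothesis pres1 : forall A, measurable A -> pushforward m1 p1 A = m1 A.
Hypothesis pres2 : forall A, measurable A -> pushforward m2 p2 A = m2 A.

Definition prod_map (x : T1 * T2) := (p1 x.1, p2 x.2).

Lemma measurable_prod_map : measurable_fun setT prod_map.
Proof.
apply: measurable_fun_pair.
- by apply: (measurableT_comp mp1); exact: measurable_fst.
- by apply: (measurableT_comp mp2); exact: measurable_snd.
Qed.

(** Rectangles determine the product measure, and the preimage of a rectangle is the rectangle of
    the preimages. *)
Lemma product_measure_preserving A : measurable A ->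
  pushforward (m1 \x m2) prod_map A = (m1 \x m2) A.
Proof.
move=> mA; apply/esym.
have mm := measurable_prod_map.
apply: (@product_measure_unique _ _ _ _ _ m1 m2 (pushforward (m1 \x m2) prod_map)) => //.
move=> B C mB mC; rewrite /pushforward.
rewrite [LHS](_ : _ = (m1 \x m2) ((p1 @^-1` B) `*` (p2 @^-1` C)))//.
rewrite product_measure1E.
- by rewrite -(pres1 mB) -(pres2 mC).
- by rewrite -[p1 @^-1` B]setTI; exact: mp1.
- by rewrite -[p2 @^-1` C]setTI; exact: mp2.
Qed.
End preserving.

(** * Lebesgue measure on R^3 *)

Section leb3_invariance.
Variable R : realType.
Local Notation R3 :=
  (measurableTypeR R * measurableTypeR R * measurableTypeR R)%type.

Definition leb2 : set (measurableTypeR R * measurableTypeR R) -> \bar R :=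
  (@lebesgue_measure R \x @lebesgue_measure R)%E.
HB.instance Definition _ := Measure.on leb2.
Lemma leb2_sigma_finite : sigma_finite setT leb2.
Proof. exact: product_measure_sigma_finite. Qed.
HB.instance Definition _ := @Measure_isSigmaFinite.Build _ _ _ leb2 leb2_sigma_finite.

(* Convertible to [leb3 R], with a canonical sigma-finite structure. *)
Definition mu3 : set R3 -> \bar R := (leb2 \x @lebesgue_measure R)%E.
HB.instance Definition _ := Measure.on mu3.
Lemma mu3_sigma_finite : sigma_finite setT mu3.
Proof. exact: (@product_measure_sigma_finite _ _ _ _ R leb2 (@lebesgue_measure R)). Qed.
HB.instance Definition _ := @Measure_isSigmaFinite.Build _ _ _ mu3 mu3_sigma_finite.

Lemma measurable_fun_pair3 d (T : measurableType d) (f g h : T -> R) :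
  measurable_fun setT f -> measurable_fun setT g -> measurable_fun setT h ->
  measurable_fun setT (fun x => (f x, g x, h x) : R3).
Proof.
by move=> mf mg mh; apply: measurable_fun_pair => //; exact: measurable_fun_pair.
Qed.

Lemma measurable_coord1 : measurable_fun setT (fun x : R3 => x.1.1 : R).
Proof. exact: (measurableT_comp measurable_fst measurable_fst). Qed.
Lemma measurable_coord2 : measurable_fun setT (fun x : R3 => x.1.2 : R).
Proof. exact: (measurableT_comp measurable_snd measurable_fst). Qed.
Lemma measurable_coord3 : measurable_fun setT (fun x : R3 => x.2 : R).
Proof. exact: measurable_snd. Qed.

Lemma measurable_add3 d (T : measurableType d) (f g : T -> R3) :
  measurable_fun setT f -> measurable_fun setT g ->
  measurable_fun (U := R3) setT (fun x => f x + g x).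
Proof.
move=> mf mg.
have mD (k : R3 -> R) : measurable_fun setT k ->
    measurable_fun setT (fun x => k (f x) + k (g x) : R).
  move=> mk; apply: measurable_funD.
    exact: (measurableT_comp mk mf).
  exact: (measurableT_comp mk mg).
exact: (measurable_fun_pair3 (mD _ measurable_coord1) (mD _ measurable_coord2)
         (mD _ measurable_coord3)).
Qed.

Lemma measurable_opp3 d (T : measurableType d) (f : T -> R3) :
  measurable_fun setT f -> measurable_fun (U := R3) setT (fun x => - f x).
Proof.
move=> mf.
have mN (k : R3 -> R) : measurable_fun setT k ->
    measurable_fun setT (fun x => - k (f x) : R).
  by move=> mk; apply: measurableT_comp => //; exact: (measurableT_comp mk mf).
exact: (measurable_fun_pair3 (mN _ measurable_coord1) (mN _ measurable_coord2)
         (mN _ measurable_coord3)).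
Qed.

Definition shift3 (h x : R3) : R3 := x + h.
Definition opp3 (x : R3) : R3 := - x.

Lemma measurable_shift3 (h : R3) : measurable_fun setT (shift3 h).
Proof. exact: measurable_add3. Qed.

Lemma mu3_shift (h : R3) (A : set R3) : measurable A ->
  pushforward mu3 (shift3 h) A = mu3 A.
Proof.
move=> mA.
pose f (a : R) (x : measurableTypeR R) : measurableTypeR R := x + a.
have mf a : measurable_fun setT (f a) by exact: measurable_funD.
have fE a B : measurable B -> pushforward lebesgue_measure (f a) B = lebesgue_measure B.
  exact: lebesgue_measure_shift.
have f2E B : measurable B -> pushforward leb2 (prod_map (f h.1.1) (f h.1.2)) B = leb2 B.
  exact: (@product_measure_preserving _ _ _ _ R (@lebesgue_measure R) (@lebesgue_measure R)
    _ _ (mf _) (mf _) (fE _) (fE _)).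
have mf2 : measurable_fun setT (prod_map (f h.1.1) (f h.1.2)).
  exact: measurable_prod_map.
exact: (@product_measure_preserving _ _ _ _ R leb2 (@lebesgue_measure R) _ _ mf2
  (mf h.2) f2E (fE h.2) A mA).
Qed.

Lemma mu3_opp (A : set R3) : measurable A -> pushforward mu3 opp3 A = mu3 A.
Proof.
move=> mA.
pose f (x : measurableTypeR R) : measurableTypeR R := - x.
have mf : measurable_fun setT f by exact: oppr_measurable.
have fE B : measurable B -> pushforward lebesgue_measure f B = lebesgue_measure B.
  by move=> mB; rewrite -[RHS](lebesgue_measureN mB).
have f2E B : measurable B -> pushforward leb2 (prod_map f f) B = leb2 B.
  exact: (@product_measure_preserving _ _ _ _ R (@lebesgue_measure R) (@lebesgue_measure R)
    _ _ mf mf fE fE).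
have mf2 : measurable_fun setT (prod_map f f) by exact: measurable_prod_map.
exact: (@product_measure_preserving _ _ _ _ R leb2 (@lebesgue_measure R) _ _ mf2
  mf f2E fE A mA).
Qed.

Lemma ge0_integral_shift (h : R3) (f : R3 -> \bar R) : measurable_fun setT f ->
  (forall x, 0 <= f x)%E -> (\int[mu3]_x f (x + h)%R = \int[mu3]_x f x)%E.
Proof.
move=> mf f0.
have E := @ge0_integral_pushforward _ _ R3 R3 R (shift3 h) (measurable_shift3 h) mu3 setT f
  measurableT mf (fun y _ => f0 y).
rewrite preimage_setT in E; rewrite -[LHS]E {E}.
apply/esym; apply: (eq_measure_integral (D := setT)) => [|ms A mA _].
  exact: measurable_shift3.
by have := @mu3_shift h A mA.
Qed.

Lemma ge0_integral_opp (f : R3 -> \bar R) : measurable_fun setT f ->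
  (forall x, 0 <= f x)%E -> (\int[mu3]_x f (- x)%R = \int[mu3]_x f x)%E.
Proof.
move=> mf f0.
have mo : measurable_fun setT opp3 by exact: measurable_opp3.
have E := @ge0_integral_pushforward _ _ R3 R3 R opp3 mo mu3 setT f
  measurableT mf (fun y _ => f0 y).
rewrite preimage_setT in E; rewrite -[LHS]E {E}.
apply/esym; apply: (eq_measure_integral (D := setT)) => A mA _.
by have := @mu3_opp A mA.
Qed.

Lemma integral_shift (h : R3) (f : R3 -> \bar R) : measurable_fun setT f ->
  (\int[mu3]_x f (x + h)%R = \int[mu3]_x f x)%E.
Proof.
move=> mf; rewrite [LHS]integralE [RHS]integralE; congr (_ - _)%E.
  rewrite -[RHS](@ge0_integral_shift h)//; first by under eq_integral do rewrite (funepos_comp f).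
  exact: measurable_funepos.
rewrite -[RHS](@ge0_integral_shift h)//; first by under eq_integral do rewrite (funeneg_comp f).
exact: measurable_funeneg.
Qed.
End leb3_invariance.

(** * Smooth bump functions *)

Section flat_function.
Variable R : realType.

(** The power [n] makes the family stable under differentiation: the derivative of [flat n] is a
    combination of [flat n.+1] and [flat n.+2], so that first derivatives alone give all orders. *)
Definition flat (n : nat) (s : R) : R :=
  if 0 < s then s^-1 ^+ n * expR (- s^-1) else 0.

Lemma flat_ge0 n s : 0 <= flat n s.
Proof.
rewrite /flat; case: ifPn => // s0.
by rewrite mulr_ge0 ?expR_ge0// exprn_ge0// invr_ge0 ltW.
Qed.

(** With u = 1/s, the term of order n + 2 of the exponential series gives u^n exp(-u) <= (n + 2)!
    u^(-2). A quadratic bound is enough for a zero derivative at 0. *)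
Lemma flat_le n s : flat n s <= (n.+2)`!%:R * s ^+ 2.
Proof.
rewrite /flat; case: ifPn => s0; last by rewrite mulr_ge0 ?sqr_ge0.
have u0 : 0 < s^-1 by rewrite invr_gt0.
set u := s^-1 in u0 *.
have -> : s = u^-1 by rewrite /u invrK.
rewrite expRN ler_pdivrMr ?expR_gt0//.
have := @expR_ge1Dxn R u n.+1 (ltW u0) => h.
have {}h : u ^+ n.+2 / (n.+2)`!%:R <= expR u.
  by apply: le_trans h; rewrite lerDr.
have f0 : 0 < (n.+2)`!%:R :> R by rewrite ltr0n fact_gt0.
rewrite ler_pdivrMr// in h.
have -> : u ^+ n = u^-1 ^+ 2 * u ^+ n.+2.
  by rewrite !exprS expr0; field; rewrite gt_eqF.
by rewrite [leRHS]mulrAC [leRHS]mulrC ler_wpM2l ?exprn_ge0 ?invr_ge0 ?(ltW s0)// mulrC.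
Qed.

Lemma is_derive_flat0 (f : R -> R) (C : R) :
  (forall t, `|f t| <= C * t ^+ 2) -> is_derive (0 : R) (1 : R) f (0 : R).
Proof.
move=> fC.
have f0 : f 0 = 0.
  by apply/eqP; rewrite -normr_le0 (le_trans (fC 0))// expr0n mulr0.
have C0 : 0 <= C.
  by have := fC 1; rewrite expr1n mulr1; exact: le_trans.
have H : (fun t : R => t^-1 *: (f (t *: (1 : R) + 0) - f 0)) @ 0^' --> (0 : R).
  apply/cvgr0Pnorm_lt => e e0.
  have d0 : 0 < e / (C + 1) by rewrite divr_gt0// ltr_wpDl.
  near=> t.
  have tn0 : t != 0 by near: t; exact: nbhs_dnbhs_neq.
  have td : `|t| < e / (C + 1).
    by near: t; apply: dnbhs0_lt.
  rewrite /GRing.scale/= mulr1 addr0 f0 subr0 normrM normfV.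
  rewrite mulrC ltr_pdivrMr ?normr_gt0//.
  apply: le_lt_trans (fC t) _.
  rewrite ltr_pdivlMr in td; last by rewrite ltr_wpDl.
  rewrite -[t ^+ 2]real_normK ?num_real// expr2 mulrA ltr_pM2r ?normr_gt0//.
  apply: le_lt_trans td; rewrite mulrC ler_wpM2l// lerDl ler01//.
apply: DeriveDef.
  by apply/cvg_ex; exists 0.
by apply: cvg_lim.
Unshelve. all: by end_near. Qed.

Lemma is_derive_flat n (s : R) :
  is_derive s (1 : R) (flat n) (- n%:R * flat n.+1 s + flat n.+2 s).
Proof.
have [s0|s0|->] := ltgtP s 0.
- have -> : - n%:R * flat n.+1 s + flat n.+2 s = 0.
    by rewrite /flat !ltNge (ltW s0)/= mulr0 addr0.
  apply: (@near_eq_is_derive _ _ _ (cst 0)).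
  near=> t; rewrite /flat ltNge ltW//.
  by near: t; exact: lt_nbhsl.
- have sn0 : s != 0 by rewrite gt_eqF.
  apply: (@near_eq_is_derive _ _ _ (fun t : R => t^-1 ^+ n * expR (- t^-1) : R)).
    near=> t; rewrite /flat ifT//.
    by near: t; exact: lt_nbhsr.
  have dV : is_derive s (1 : R) (fun t : R => t^-1) (- s ^- 2).
    have := @is_deriveV R id s (1 : R) (1 : R) sn0 (is_derive_id _ _).
    by rewrite /GRing.scale/= mulr1.
  have dE : is_derive s (1 : R) (fun t : R => expR (- t^-1)) (expR (- s^-1) * s ^- 2).
    have := @is_derive1_comp R expR (fun t => - t^-1) s (expR (- s^-1)) (- (- s ^- 2))
      (is_derive_expR _) (is_deriveN dV).
    by rewrite opprK.
  have dX : is_derive s (1 : R) (fun t : R => t^-1 ^+ n) (n%:R * s^-1 ^+ n.-1 * - s ^- 2).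
    have -> : (fun t : R => t^-1 ^+ n) = (fun t : R => t^-1) ^+ n.
      by apply/funext => t; rewrite fctE.
    exact: is_deriveX.
  apply: (is_derive_eq (is_deriveM dX dE)).
  rewrite /flat s0 /GRing.scale/=.
  by case: n {dX} => [|n] /=; rewrite !exprS ?expr0; field.
- have := @is_derive_flat0 (flat n) (n.+2)`!%:R.
  rewrite /flat ltxx mulr0 addr0; apply => t; rewrite ger0_norm ?flat_ge0//.
  exact: flat_le.
Unshelve. all: by end_near. Qed.
End flat_function.

Section bump.
Variable R : realType.
Local Notation R3 :=
  (measurableTypeR R * measurableTypeR R * measurableTypeR R)%type.

Definition coord (i : 'I_3) (x : R3) : R :=
  if i == 0 then x.1.1 else if i == 1 then x.1.2 else x.2.

Lemma coord_linear i : linear (coord i : R3 -> R).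
Proof. by move=> a x y; rewrite /coord; case: ifP => _; [|case: ifP => _]. Qed.

Lemma coordD i (x y : R3) : coord i (x + y) = coord i x + coord i y.
Proof. by rewrite /coord; case: (i == 0); [|case: (i == 1)]. Qed.

Lemma coord_continuous i : continuous (coord i : R3 -> R).
Proof.
move=> x; rewrite /coord.
case: (i == 0); [|case: (i == 1); last exact: cvg_snd].
  apply: (@cvg_comp _ _ _ (fst : R3 -> _) fst); [exact: cvg_fst|exact: cvg_fst].
apply: (@cvg_comp _ _ _ (fst : R3 -> _) snd); [exact: cvg_fst|exact: cvg_snd].
Qed.

Lemma is_diff_coord i (x : R3) : is_diff x (coord i : R3 -> R) (coord i : R3 -> R).
Proof.
pose lM := GRing.isLinear.Build _ _ _ _ _ (@coord_linear i).
pose l : {linear R3 -> R} := HB.pack (coord i : R3 -> R) lM.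
apply: DiffDef.
  by apply: (@linear_differentiable _ _ _ l); exact: coord_continuous.
by apply: (@diff_lin _ _ _ l); exact: coord_continuous.
Qed.

(* A class stable under partial derivatives that contains bump functions. *)
Inductive smooth : (R3 -> R) -> Prop :=
| smooth_cst c : smooth (fun=> c)
| smooth_flat n i (s c : R) : smooth (fun x => flat n (s * coord i x + c))
| smooth_add f g : smooth f -> smooth g -> smooth (fun x => f x + g x)
| smooth_mul f g : smooth f -> smooth g -> smooth (fun x => f x * g x).

(** Carrying the differential as a witness lets the sum, product and chain rules apply at each
    stage. In a fixed direction it stays in the class, so iterated partial derivatives remain
    differentiable, as [test_function] requires. *)
Lemma smooth_diff f : smooth f ->
  exists df : R3 -> R3 -> R, forall x, is_diff x f (df x) /\ forall v, smooth (df ^~ v).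
Proof.
elim=> [c|n i s c|{}f g sf [df Hf] sg [dg Hg]|{}f g sf [df Hf] sg [dg Hg]].
- exists (fun x v => 0) => x; split; last by move=> v; exact: smooth_cst.
  exact: is_diff_cst.
- exists (fun x v => (- n%:R * flat n.+1 (s * coord i x + c) + flat n.+2 (s * coord i x + c))
           * (s * coord i v)) => x; split; last first.
    move=> v; apply: smooth_mul; last exact: smooth_cst.
    apply: smooth_add; last exact: smooth_flat.
    by apply: smooth_mul; [exact: smooth_cst|exact: smooth_flat].
  have d1 : is_diff x (fun x : R3 => s * coord i x + c : R) (fun v : R3 => s * coord i v : R).
    apply: (is_diff_eq (is_diffD (is_diffZ s (is_diff_coord i x)) (is_diff_cst c x))).
    by rewrite addr0.
  have d2 := is_derive_flat n (s * coord i x + c).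
  have d3 : is_diff (s * coord i x + c) (flat n)
    (fun h : R => h * (- n%:R * flat n.+1 (s * coord i x + c) + flat n.+2 (s * coord i x + c))).
    apply: DiffDef; first exact/derivable1_diffP/ex_derive.
    rewrite diff1E; last exact/derivable1_diffP/ex_derive.
    by rewrite derive1E derive_val.
  apply: (is_diff_eq (is_diff_comp d1 d3)).
  by apply/funext => v /=; rewrite mulrC.
- exists (fun x v => df x v + dg x v) => x; have [f1 f2] := Hf x; have [g1 g2] := Hg x.
  split; last by move=> v; apply: smooth_add.
  exact: is_diffD.
- exists (fun x v => f x * dg x v + g x * df x v) => x; have [f1 f2] := Hf x; have [g1 g2] := Hg x.
  split; last by move=> v; apply: smooth_add; apply: smooth_mul.
  exact: is_diffM.
Qed.

Lemma smooth_differentiable f : smooth f -> forall x : R3, differentiable f x.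
Proof. by move=> /smooth_diff[df H] x; have [[]] := H x. Qed.

Lemma smooth_partial j f : smooth f -> smooth (partial j f).
Proof.
move=> sf; have [df H] := smooth_diff sf.
have -> : partial j f = df ^~ (e3 R j).
  apply/funext => x; rewrite /partial deriveE; last exact: smooth_differentiable.
  by have [[_ ->]] := H x.
by have [] := H 0.
Qed.

Lemma smooth_foldr_partial s f : smooth f -> smooth (foldr (@partial R) f s).
Proof. by elim: s => //= j s IH sf; apply: smooth_partial; exact: IH. Qed.

Lemma coord_le_norm i (x : R3) : `|coord i x| <= `|x|.
Proof.
rewrite /coord; case: (i == 0); [|case: (i == 1)].
- by apply: (@le_trans _ _ `|x.1|); rewrite num_le_max lexx.
- by apply: (@le_trans _ _ `|x.1|); rewrite num_le_max lexx ?orbT.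
- by rewrite num_le_max lexx orbT.
Qed.

(** Positive exactly in the slab |x_i| < a. The norm of [R3] is the maximum norm, so the product
    over the three coordinates is positive exactly on the open ball of radius a. The factors [1] and
    [-1] give the shape expected by [smooth_flat]. *)
Definition bump1 (a : R) (i : 'I_3) (x : R3) : R :=
  flat 0 (1 * coord i x + a) * flat 0 (-1 * coord i x + a).
Definition bump (a : R) (x : R3) : R := bump1 a 0 x * bump1 a 1 x * bump1 a 2%:R x.

Lemma smooth_bump a : smooth (bump a).
Proof.
have H i : smooth (bump1 a i) by apply: smooth_mul; exact: smooth_flat.
by apply: smooth_mul; [apply: smooth_mul|].
Qed.

Lemma flat_gt0 n (s : R) : 0 < s -> 0 < flat n s.
Proof. by move=> s0; rewrite /flat s0 mulr_gt0 ?expR_gt0// exprn_gt0// invr_gt0. Qed.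

Lemma bump1_gt0 a i x : `|coord i x| < a -> 0 < bump1 a i x.
Proof.
rewrite ltr_norml => /andP[h1 h2].
by rewrite mulr_gt0// flat_gt0//; lra.
Qed.

Lemma bump1_ge0 a i x : 0 <= bump1 a i x.
Proof. by rewrite mulr_ge0// flat_ge0. Qed.

Lemma bump1_eq0 a i x : a <= `|coord i x| -> bump1 a i x = 0.
Proof.
rewrite ler_normr /bump1 /flat => /orP[h|h].
  by rewrite [X in _ * X]ifF ?mulr0//; apply/negbTE; rewrite -leNgt; lra.
by rewrite ifF ?mul0r//; apply/negbTE; rewrite -leNgt; lra.
Qed.

Lemma bump_ge0 a x : 0 <= bump a x.
Proof. by apply: mulr_ge0; [apply: mulr_ge0|]; exact: bump1_ge0. Qed.

Lemma bump_gt0 a x : `|x| < a -> 0 < bump a x.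
Proof.
move=> xa; have H i : 0 < bump1 a i x.
  by apply: bump1_gt0; apply: le_lt_trans xa; exact: coord_le_norm.
by apply: mulr_gt0; [apply: mulr_gt0|].
Qed.

Lemma bump_eq0 a x : a <= `|x| -> bump a x = 0.
Proof.
move=> ax; have [/forallP H|] := boolP [forall i, `|coord i x| < a].
  move: ax; rewrite leNgt => /negP[].
  have /= H0 := H 0; have /= H1 := H 1; have /= H2 := H (2%:R).
  by rewrite !num_gt_max; apply/andP; split; [apply/andP; split|].
rewrite negb_forall; case/existsP => i; rewrite -leNgt => /bump1_eq0 i0.
have : i \in [:: 0; 1; 2%:R] by case: i {i0} => [[|[|[|]]]].
by rewrite !inE /bump => /or3P[] /eqP ie; rewrite -ie i0 ?mulr0 ?mul0r.
Qed.

Lemma bumpN a x : bump a (- x) = bump a x.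
Proof.
have cN i : coord i (- x) = - coord i x.
  by rewrite /coord; case: (i == 0); [|case: (i == 1)].
have H i : bump1 a i (- x) = bump1 a i x.
  by rewrite /bump1 cN mulrC; congr (flat _ _ * flat _ _); ring.
by rewrite /bump !H.
Qed.

(** Each of the six factors [flat 0] has an argument at least 1, hence is at least exp(-1). The
    bound does not depend on [a]. *)
Lemma bump_ge a x : `|x| <= a - 1 -> expR (- 6) <= bump a x.
Proof.
move=> xa.
have f1 (s : R) : 1 <= s -> expR (- 1) <= flat 0 s.
  move=> s1; have s0 : 0 < s by exact: lt_le_trans s1.
  by rewrite /flat s0 expr0 mul1r ler_expR lerN2 invf_le1.
have H i : expR (- 2) <= bump1 a i x.
  have : `|coord i x| <= a - 1 by apply: le_trans xa; exact: coord_le_norm.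
  rewrite ler_norml => /andP[h1 h2].
  have -> : - 2 = - 1 + - 1 :> R by ring.
  by rewrite expRD ler_pM ?expR_ge0//; apply: f1; lra.
have -> : - 6 = - 2 + - 2 + - 2 :> R by ring.
by rewrite 2!expRD !ler_pM ?mulr_ge0 ?expR_ge0//.
Qed.

Lemma smooth_bounded f : smooth f ->
  forall r, exists M, forall x : R3, `|x| <= r -> `|f x| <= M.
Proof.
elim=> [c r|n i s c r|{}f g _ Hf _ Hg r|{}f g _ Hf _ Hg r].
- by exists `|c|.
- exists ((n.+2)`!%:R * (`|s| * r + `|c|) ^+ 2) => x xr.
  rewrite ger0_norm ?flat_ge0//; apply: le_trans (flat_le _ _) _.
  rewrite ler_wpM2l// -[leLHS]real_normK ?num_real//.
  rewrite ler_pXn2r ?nnegrE//; last first.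
    by rewrite addr_ge0// mulr_ge0//; exact: le_trans xr.
  apply: le_trans (ler_normD _ _) _; rewrite lerD2r normrM ler_wpM2l//.
  exact: le_trans (coord_le_norm _ _) xr.
- have [M1 H1] := Hf r; have [M2 H2] := Hg r.
  exists (M1 + M2) => x xr; apply: le_trans (ler_normD _ _) _.
  by rewrite lerD ?H1 ?H2.
- have [M1 H1] := Hf r; have [M2 H2] := Hg r.
  by exists (M1 * M2) => x xr; rewrite normrM ler_pM ?H1 ?H2.
Qed.

Lemma measurable_flat n : measurable_fun setT (@flat R n).
Proof.
apply: continuous_measurable_fun => x; apply: differentiable_continuous.
by apply/derivable1_diffP; have [] := is_derive_flat n x.
Qed.

Lemma measurable_coord i : measurable_fun setT (coord i : R3 -> R).
Proof.
rewrite /coord; case: (i == 0); [|case: (i == 1)].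
- exact: (measurableT_comp measurable_fst measurable_fst).
- exact: (measurableT_comp measurable_snd measurable_fst).
- exact: measurable_snd.
Qed.

Lemma smooth_measurable f : smooth f -> measurable_fun setT (f : R3 -> R).
Proof.
elim=> [c|n i s c|{}f g _ Hf _ Hg|{}f g _ Hf _ Hg].
- exact: measurable_cst.
- apply: (measurableT_comp (@measurable_flat n)).
  apply: measurable_funD => //; apply: measurable_funM => //.
  exact: measurable_coord.
- exact: measurable_funD.
- exact: measurable_funM.
Qed.

Lemma smooth_shift f (y : R3) : smooth f -> smooth (fun x => f (x + y)).
Proof.
elim=> [c|n i s c|{}f g _ Hf _ Hg|{}f g _ Hf _ Hg].
- exact: smooth_cst.
- have -> : (fun x => flat n (s * coord i (x + y) + c)) =
            (fun x => flat n (s * coord i x + (s * coord i y + c))).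
    by apply/funext => x; congr flat; rewrite coordD; ring.
  exact: smooth_flat.
- exact: smooth_add.
- exact: smooth_mul.
Qed.

Lemma partial_shift j (f : R3 -> R) (y : R3) :
  partial j (fun x => f (x + y)) = (fun x => partial j f (x + y)).
Proof.
apply/funext => x; rewrite /partial /derive; congr (lim _).
suff -> : (fun h : R => h^-1 *: (((fun x0 : R3 => f (x0 + y)) \o shift x) (h *: e3 R j) - f (x + y)))
  = (fun h : R => h^-1 *: ((f \o shift (x + y)) (h *: e3 R j) - f (x + y))) by [].
by apply/funext => h /=; rewrite addrA.
Qed.

Lemma test_function_smooth f (r : R) : smooth f -> (forall x : R3, r < `|x| -> f x = 0) ->
  test_function f.
Proof.
move=> sf f0; split; last by exists r.
by move=> s x; apply: smooth_differentiable; exact: smooth_foldr_partial.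
Qed.

Lemma partial_eq0 j f (r : R) : (forall x : R3, r < `|x| -> f x = 0) ->
  forall x : R3, r < `|x| -> partial j f x = 0.
Proof.
move=> f0 x rx; rewrite /partial -(derive_cst (0 : R) x (e3 R j)).
apply: near_eq_derive.
have : {for x, continuous (fun x : R3 => `|x| : R)} by exact: norm_continuous.
move=> /(_ [set t | r < t]) H.
have {}H : \forall y \near x, r < `|y| by apply: H; exact: lt_nbhsr.
by near=> y; rewrite f0//; near: y.
Unshelve. all: by end_near. Qed.
End bump.

(** * Continuity of translations in L^2 *)

Section translation_continuity.
Variable R : realType.
Local Notation R3 :=
  (measurableTypeR R * measurableTypeR R * measurableTypeR R)%type.
Local Notation mu3 := (@mu3 R).

Lemma cvge0_lt (u : nat -> \bar R) (e : R) : u @ \oo --> 0%E -> 0 < e ->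
  exists N, forall n, (N <= n)%N -> (u n < e%:E)%E.
Proof.
move=> u0 e0; have [|N _ HN] := u0 [set y | (y < e%:E)%E].
  by apply: open_ereal_lt'; rewrite lte_fin.
by exists N => n Nn; apply: HN.
Qed.

Definition box (r : R) : set R3 :=
  (`[- r, r]%classic `*` `[- r, r]%classic) `*` `[- r, r]%classic.

Lemma mu3X (A B C : set (measurableTypeR R)) :
  measurable A -> measurable B -> measurable C ->
  mu3 ((A `*` B) `*` C) =
    (lebesgue_measure A * lebesgue_measure B * lebesgue_measure C)%E.
Proof.
move=> mA mB mC; rewrite [LHS](@product_measure1E _ _ _ _ R (@leb2 R) lebesgue_measure)//.
  by rewrite [X in (X * _)%E](@product_measure1E _ _ _ _ R lebesgue_measure lebesgue_measure).
exact: measurableX.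
Qed.

Lemma measurable_box r : measurable (box r).
Proof. by apply: measurableX; [apply: measurableX|]; exact: measurable_itv. Qed.

Lemma lebesgue_measure_segment (a b : R) : a <= b ->
  lebesgue_measure `[a, b]%classic = (b - a)%:E.
Proof.
move=> ab; rewrite lebesgue_measure_itv/= lte_fin.
by case: ltgtP ab => // -> _; rewrite subrr.
Qed.

Lemma mu3_box_lty r : (mu3 (box r) < +oo)%E.
Proof.
rewrite /box mu3X; [|exact: measurable_itv..].
rewrite !lebesgue_measure_itv/=; case: ifP => _; last by rewrite !mul0e ltry.
by rewrite -!EFinB -!EFinM ltry.
Qed.

Lemma boxP r (x : R3) : box r x <-> `|x| <= r.
Proof.
rewrite /box /= !in_itv/= -!ler_norml !num_ge_max; split.
  by move=> [[-> ->] ->].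
by move=> /andP[/andP[-> ->] ->].
Qed.

Definition symd (E : set R3) (h : R3) : set R3 :=
  (E `\` shift3 h @^-1` E) `|` (shift3 h @^-1` E `\` E).

(* Such sets form a sigma-algebra that contains the half-spaces, hence all Borel sets. *)
Definition transl_cont (E : set R3) := measurable E /\
  forall r (e : R), 0 < e -> exists2 d : R, 0 < d &
    forall h : R3, `|h| < d -> (mu3 (box r `&` symd E h) < e%:E)%E.

Lemma measurable_preshift (E : set R3) (h : R3) : measurable E -> measurable (shift3 h @^-1` E).
Proof. by move=> mE; have := measurable_shift3 h measurableT mE; rewrite setTI. Qed.

Lemma measurable_symd (E : set R3) (h : R3) : measurable E -> measurable (symd E h).
Proof.
move=> mE; have mE' := measurable_preshift h mE.
by apply: measurableU; exact: measurableD.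
Qed.

Lemma symdU (A B : set R3) h : symd (A `|` B) h `<=` symd A h `|` symd B h.
Proof.
move=> x [[[Ax|Bx] nAB]|[[Ax|Bx] nAB]].
- by left; left; split => // ?; apply: nAB; left.
- by right; left; split => // ?; apply: nAB; right.
- by left; right; split => // ?; apply: nAB; left.
- by right; right; split => // ?; apply: nAB; right.
Qed.

Lemma transl_cont0 : transl_cont set0.
Proof.
split; first exact: measurable0.
move=> r e e0; exists 1 => // h _.
by rewrite /symd !set0D !setU0 setI0 measure0 lte_fin.
Qed.

Lemma transl_contC E : transl_cont E -> transl_cont (~` E).
Proof.
move=> [mE HE]; split; first exact: measurableC.
move=> r e e0; have [d d0 Hd] := HE r e e0; exists d => // h hd.
suff -> : symd (~` E) h = symd E h by exact: Hd.
rewrite /symd setUC preimage_setC; congr (_ `|` _).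
  by rewrite setDE setCK setIC.
by rewrite setDE setCK setIC.
Qed.

Lemma transl_contU A B : transl_cont A -> transl_cont B -> transl_cont (A `|` B).
Proof.
move=> [mA HA] [mB HB]; split; first exact: measurableU.
move=> r e e0; have e20 : 0 < e / 2 by rewrite divr_gt0.
have [d1 d10 H1] := HA r _ e20; have [d2 d20 H2] := HB r _ e20.
exists (Num.min d1 d2); first by rewrite lt_min d10.
move=> h; rewrite lt_min => /andP[h1 h2].
have mb := measurable_box r.
have m1 : measurable (box r `&` symd A h) by apply: measurableI => //; exact: measurable_symd.
have m2 : measurable (box r `&` symd B h) by apply: measurableI => //; exact: measurable_symd.
apply: (@le_lt_trans _ _ (mu3 (box r `&` symd A h `|` box r `&` symd B h))).
  apply: le_measure; rewrite ?inE.
  - by apply: measurableI => //; apply: measurable_symd; exact: measurableU.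
  - exact: measurableU.
  - by move=> x [bx /symdU[]]; [left|right].
apply: le_lt_trans (measureU2 _ m1 m2) _.
have -> : e%:E = ((e / 2)%:E + (e / 2)%:E)%E by rewrite -EFinD -splitr.
by apply: lteD; [exact: H1|exact: H2].
Qed.

(** A finite partial union [G N] stands for the whole union: inside a bounded box the remainder has
    small measure by continuity from above, and its translate has the same measure by invariance. *)
Lemma transl_cont_bigcup (F : (set R3)^nat) :
  (forall n, transl_cont (F n)) -> transl_cont (\bigcup_n F n).
Proof.
move=> HF; set E := \bigcup_n F n.
have mE : measurable E by apply: bigcupT_measurable => n; have [] := HF n.
split => // r e e0; have e30 : 0 < e / 3 by rewrite divr_gt0.
pose G N := \big[setU/set0]_(n < N) F n.
have HG N : transl_cont (G N).
  rewrite /G; elim: N => [|N IH]; first by rewrite big_ord0; exact: transl_cont0.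
  by rewrite big_ord_recr/=; exact: transl_contU.
have mG N : measurable (G N) by have [] := HG N.
(* The radius [r + 1] leaves room for a shift with |h| < 1: a shifted point of [box r] is still in
   the larger box. *)
pose T N := box (r + 1) `&` (E `\` G N).
have mT N : measurable (T N).
  by apply: measurableI; [exact: measurable_box|exact: measurableD].
have Tlim : mu3 \o T @ \oo --> mu3 (\bigcap_n T n).
  apply: nonincreasing_cvg_mu => //.
  - apply: le_lt_trans (mu3_box_lty (r + 1)).
    by apply: le_measure; rewrite ?inE//; [exact: measurable_box|exact: subIsetl].
  - exact: bigcapT_measurable.
  - move=> m n mn; apply/subsetPset => x [bx [Ex nG]]; split => //; split => // Gx.
    apply: nG; move: Gx; rewrite /G -!bigcup_mkord => -[k /= km Fk].
    by exists k => //=; exact: leq_trans mn.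
have T0 : \bigcap_n T n = set0.
  apply/seteqP; split => // x Hx; have [_ [[n _ Fn] _]] := Hx 0%N I.
  have [_ [_]] := Hx n.+1 I; apply.
  by rewrite /G -bigcup_mkord; exists n => //=.
rewrite T0 measure0 in Tlim.
have [N /(_ N (leqnn N)) HN] := cvge0_lt Tlim e30.
have [_ /(_ r _ e30)[d d0 Hd]] := HG N.
exists (Num.min d 1); first by rewrite lt_min d0 ltr01.
move=> h; rewrite lt_min => /andP[hd h1].
have mD : measurable (E `\` G N) by exact: measurableD.
have m1 : measurable (box r `&` symd (G N) h).
  by apply: measurableI; [exact: measurable_box|exact: measurable_symd].
have m3 : measurable (shift3 h @^-1` T N) by exact: measurable_preshift.
apply: (@le_lt_trans _ _ (mu3 (box r `&` symd (G N) h `|` T N `|` shift3 h @^-1` T N))).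
  apply: le_measure; rewrite ?inE.
  - by apply: measurableI; [exact: measurable_box|exact: measurable_symd].
  - by apply: measurableU => //; exact: measurableU.
  move=> x [bx [[Ex nE]|[Ex nE]]].
    have [Gx|nGx] := pselect (G N x).
      left; left; split => //; left; split => // Gh; apply: nE.
      by move: Gh; rewrite /G -bigcup_mkord => -[k _ Fk]; exists k.
    left; right; split; last by split.
    by apply/boxP; move/boxP: bx => /le_trans; apply; rewrite lerDl.
  have [Gx|nGx] := pselect (G N (shift3 h x)).
    left; left; split => //; right; split => // Gh; apply: nE.
    by move: Gh; rewrite /G -bigcup_mkord => -[k _ Fk]; exists k.
  right; split; last by split.
  apply/boxP; move/boxP: bx => bx; apply: le_trans (ler_normD _ _) _.
  by rewrite lerD// ltW.
apply: (@le_lt_trans _ _ (mu3 (box r `&` symd (G N) h) + mu3 (T N) + mu3 (T N))%E).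
  apply: le_trans (measureU2 _ (measurableU _ _ m1 (mT N)) m3) _.
  rewrite [X in (_ + X <= _)%E](_ : _ = mu3 (T N)); last exact: (mu3_shift h (mT N)).
  by apply: leeD => //; exact: measureU2.
have -> : e%:E = ((e / 3)%:E + (e / 3)%:E + (e / 3)%:E)%E.
  by rewrite -!EFinD; congr (_%:E); lra.
by apply: lteD => //; apply: lteD => //; exact: Hd.
Qed.

Lemma transl_cont_sigma : sigma_algebra setT transl_cont.
Proof.
split; first exact: transl_cont0.
  by move=> A /transl_contC; rewrite setTD.
exact: transl_cont_bigcup.
Qed.

(** A shift with |h| < d changes the indicator only in the slab |x_i - c| <= d, which meets the box
    in volume at most 8 r^2 d. *)
Lemma transl_cont_halfspace i (c : R) : transl_cont [set x : R3 | c < coord i x].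
Proof.
have mE : measurable [set x : R3 | c < coord i x].
  have := @measurable_coord R i measurableT `]c, +oo[%classic (measurable_itv _).
  rewrite setTI; congr measurable.
  by apply/seteqP; split => x /=; rewrite in_itv/= andbT.
(* The [+ 1] avoids a zero denominator and makes the final inequality strict. *)
split => // r e e0; pose d := e / (8 * r ^+ 2 + 1).
have den : 0 < 8 * r ^+ 2 + 1 by rewrite ltr_wpDl// mulr_ge0// sqr_ge0.
have d0 : 0 < d by rewrite divr_gt0.
exists d => // h hd.
pose I (k : 'I_3) : set (measurableTypeR R) := if k == i then `[c - d, c + d]%classic else `[- r, r]%classic.
have mI k : measurable (I k) by rewrite /I; case: ifP => _; exact: measurable_itv.
pose m (k : 'I_3) : R := if k == i then 2 * d else 2 * `|r|.
have HI k : (lebesgue_measure (I k) <= (m k)%:E)%E.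
  rewrite /I /m; case: ifP => _.
    by rewrite lebesgue_measure_segment ?lee_fin; lra.
  rewrite lebesgue_measure_itv/=; case: ifP => _; rewrite lee_fin ?mulr_ge0//.
  by have := ler_norm r; lra.
apply: (@le_lt_trans _ _ (mu3 ((I 0 `*` I 1) `*` I 2%:R))).
  apply: le_measure; rewrite ?inE.
  - by apply: measurableI; [exact: measurable_box|exact: measurable_symd].
  - by apply: measurableX => //; exact: measurableX.
  move=> x [bx sx].
  have xi : c - d <= coord i x <= c + d.
    have hi : `|coord i h| < d by apply: le_lt_trans hd; exact: coord_le_norm.
    move: hi; rewrite ltr_norml => /andP[hi1 hi2].
    case: sx => -[] /=; rewrite /shift3 coordD => /= h1 /negP; rewrite -leNgt => h2;
    by apply/andP; split; lra.
  have H k : I k (coord k x).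
    rewrite /I; case: ifP => [/eqP ->|_] /=; first by rewrite in_itv.
    rewrite in_itv/= -ler_norml; apply: le_trans (coord_le_norm _ _) _.
    exact/boxP.
  by split; [split|]; [have := H 0|have := H 1|have := H 2%:R].
rewrite mu3X//.
apply: (@le_lt_trans _ _ ((m 0)%:E * (m 1)%:E * (m 2%:R)%:E)%E).
  by rewrite !lee_pmul ?mule_ge0 ?measure_ge0 ?HI//.
rewrite -!EFinM lte_fin.
have -> : m 0 * m 1 * m 2%:R = 8 * r ^+ 2 * d.
  have : i \in [:: 0; 1; 2%:R] by case: i {mE I mI m HI} => [[|[|[|]]]].
  rewrite -[r ^+ 2]real_normK ?num_real//.
  by rewrite !inE /m => /or3P[] /eqP -> /=; ring.
by rewrite /d mulrA ltr_pdivrMr// mulrC ltr_pM2l// ltrDl ltr01.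
Qed.

(** With [transl_cont] as sigma-algebra on R^3 the coordinates are measurable, by the case of
    half-spaces. Hence so is the identity map to R^3 with its product structure, and the preimage of
    [E] under it is [E]. *)
Lemma measurable_transl_cont E : measurable E -> transl_cont E.
Proof.
move=> mE.
pose T := g_sigma_algebraType transl_cont.
have mc i : measurable_fun setT (coord i : T -> measurableTypeR R).
  move=> _; apply: (measurability _ (RGenOInfty.measurableE R)) => //.
  move=> /= _ [_ [a ->] <-]; rewrite setTI.
  apply: sub_sigma_algebra.
  have -> : coord i @^-1` `]a, +oo[ = [set x : R3 | a < coord i x].
    by apply/seteqP; split => x /=; rewrite in_itv/= andbT.
  exact: transl_cont_halfspace.
have mid : measurable_fun setT (fun x : T => (x : R3)).
  have := measurable_fun_pair3 (mc 0) (mc 1) (mc 2%:R).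
  by congr (measurable_fun _ _); apply/funext => -[[? ?] ?].
have := mid measurableT E mE; rewrite setTI.
by have -> : @measurable _ T = transl_cont by exact: (sigma_algebra_id transl_cont_sigma).
Qed.
End translation_continuity.

(** * Continuity of translations: from sets to square-integrable functions *)

Section square_integrable.
Local Open Scope ereal_scope.
Variable R : realType.
Local Notation R3 :=
  (measurableTypeR R * measurableTypeR R * measurableTypeR R)%type.
Local Notation mu3 := (@mu3 R).

Definition sqnorm (f : R3 -> R) : \bar R := \int[mu3]_x ((f x) ^+ 2)%:E.

Lemma sqnorm_ge0 f : 0 <= sqnorm f.
Proof. by apply: integral_ge0 => x _; rewrite lee_fin sqr_ge0. Qed.

Lemma measurable_sqr (f : R3 -> R) : measurable_fun setT f ->
  measurable_fun setT (fun x => ((f x) ^+ 2)%:E).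
Proof. by move=> mf; apply/measurable_EFinP; exact: measurable_funX. Qed.

Lemma sqnorm_shift (f : R3 -> R) (h : R3) : measurable_fun setT f ->
  sqnorm (f \o shift3 h) = sqnorm f.
Proof.
move=> mf; rewrite /sqnorm -[RHS](@ge0_integral_shift R h)//.
  exact: measurable_sqr.
by move=> x; rewrite lee_fin sqr_ge0.
Qed.

Lemma sqnorm_le3 (f g k : R3 -> R) : measurable_fun setT f ->
  measurable_fun setT g -> measurable_fun setT k ->
  sqnorm (fun x => f x + g x + k x)%R <=
    3%:E * (sqnorm f + sqnorm g + sqnorm k).
Proof.
move=> mf mg mk.
pose F (l : R3 -> R) x := ((l x) ^+ 2)%:E.
have F0 l x : 0 <= F l x by rewrite lee_fin sqr_ge0.
have mF l : measurable_fun setT l -> measurable_fun setT (F l) by exact: measurable_sqr.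
have mFG : measurable_fun setT (fun x => F f x + F g x).
  by apply: emeasurable_funD; exact: mF.
have mFGK : measurable_fun setT (fun x => F f x + F g x + F k x).
  by apply: emeasurable_funD => //; exact: mF.
have FG0 x : 0 <= F f x + F g x by rewrite adde_ge0.
have FGK0 x : 0 <= F f x + F g x + F k x by rewrite !adde_ge0.
have E1 : sqnorm f + sqnorm g = \int[mu3]_x (F f x + F g x).
  by apply/esym; apply: ge0_integralD => //; exact: mF.
have E2 : \int[mu3]_x (F f x + F g x) + sqnorm k = \int[mu3]_x (F f x + F g x + F k x).
  by apply/esym; apply: ge0_integralD => //; exact: mF.
rewrite E1 E2 -ge0_integralZl//.
apply: ge0_le_integral => //.
- by move=> x _; rewrite lee_fin sqr_ge0.
- apply: (mF (fun x => f x + g x + k x)%R).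
  by apply: measurable_funD => //; exact: measurable_funD.
- exact: measurable_funeM.
- move=> x _; rewrite -!EFinD -EFinM lee_fin.
  have := sqr_ge0 (f x - g x); have := sqr_ge0 (f x - k x); have := sqr_ge0 (g x - k x).
  nra.
Qed.

Definition l2_cont (a : R3 -> R) := forall e : R, (0 < e)%R ->
  exists2 d : R, (0 < d)%R & forall h : R3, (`|h| < d)%R ->
    sqnorm (fun x => a (shift3 h x) - a x)%R < e%:E.

(** The exceptional set collects, over the values in [s], the points of the box where a level set
    and its translate disagree. *)
Lemma symd_finite (b : R3 -> R) (s : seq R) : measurable_fun setT b ->
  forall r e, (0 < e)%R -> exists2 d : R, (0 < d)%R & forall h : R3, (`|h| < d)%R ->
  exists2 U : set R3, measurable U /\ mu3 U < e%:E &
    forall x, box r x -> b x \in s -> b (shift3 h x) != b x -> U x.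
Proof.
move=> mb r; elim: s => [e e0|v s IH e e0].
  exists 1%R => // h _; exists set0; last by move=> x _; rewrite in_nil.
  by split; [exact: measurable0|rewrite measure0 lte_fin].
have e20 : (0 < e / 2)%R by rewrite divr_gt0.
have [d1 d10 H1] := IH _ e20.
have mv : measurable (b @^-1` [set v]).
  by have := mb measurableT _ (measurable_set1 v); rewrite setTI.
have [_ /(_ r _ e20)[d2 d20 H2]] := measurable_transl_cont mv.
exists (Num.min d1 d2); first by rewrite lt_min d10.
move=> h; rewrite lt_min => /andP[h1 h2].
have [U [mU Ue] HU] := H1 h h1.
have mS : measurable (box r `&` symd (b @^-1` [set v]) h).
  by apply: measurableI; [exact: measurable_box|exact: measurable_symd].
exists (U `|` box r `&` symd (b @^-1` [set v]) h).
  split; first exact: measurableU.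
  apply: le_lt_trans (measureU2 _ mU mS) _.
  have -> : e%:E = (e / 2)%:E + (e / 2)%:E by rewrite -EFinD -splitr.
  by apply: lteD => //; exact: H2.
move=> x bx; rewrite in_cons => /orP[/eqP bv|bs] bn; last by left; exact: HU.
right; split => //; left; split => //= bv'.
by move: bn; rewrite bv' bv eqxx.
Qed.

(** The increment is at most 2M in modulus, and for |h| < 1 it vanishes outside [box (r + 1)].
    Inside, it vanishes off a set of small measure by [symd_finite], so its squared norm is at most
    4 M^2 times that measure. *)
Lemma l2_cont_finite (b : R3 -> R) (s : seq R) r : measurable_fun setT b ->
  (forall x, b x \in s) -> (forall x : R3, (r < `|x|)%R -> b x = 0%R) -> l2_cont b.
Proof.
move=> mb bs b0 e e0.
pose M := (\sum_(v <- s) `|v|)%R.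
have bM x : (`|b x| <= M)%R.
  rewrite /M; have := bs x; elim: s {bs M} => // v s IH.
  rewrite in_cons big_cons => /orP[/eqP ->|/IH].
    by rewrite lerDl sumr_ge0.
  by move=> /le_trans; apply; rewrite lerDr.
have den : (0 < 4 * M ^+ 2 + 1)%R by rewrite ltr_wpDl// mulr_ge0// sqr_ge0.
pose e' := (e / (4 * M ^+ 2 + 1))%R.
have e'0 : (0 < e')%R by rewrite divr_gt0.
have [d d0 Hd] := symd_finite s mb (r + 1) e'0.
exists (Num.min d 1%R); first by rewrite lt_min d0 ltr01.
move=> h; rewrite lt_min => /andP[hd h1].
have [U [mU Ue] HU] := Hd h hd.
have mbs : measurable_fun setT (b \o shift3 h).
  by apply: measurableT_comp => //; exact: measurable_shift3.
apply: (@le_lt_trans _ _ (\int[mu3]_x ((4 * M ^+ 2) * \1_U x)%:E)).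
  apply: ge0_le_integral => //.
  - by move=> x _; rewrite lee_fin sqr_ge0.
  - apply: (@measurable_sqr (fun x => b (shift3 h x) - b x)%R).
    exact: measurable_funB.
  - by apply/measurable_EFinP; apply: measurable_funM => //; exact: measurable_indic.
  move=> x _; rewrite lee_fin.
  have [->|neq] := eqVneq (b (shift3 h x)) (b x).
    by rewrite subrr expr0n/= mulr_ge0// mulr_ge0// sqr_ge0.
  have Ux : U x.
    apply: HU => //; apply/boxP; rewrite leNgt; apply/negP => rx.
    move: neq; rewrite b0; last first.
      have : (`|x| <= `|x + h| + `|h|)%R by rewrite -{1}[x](addrK h); exact: ler_normB.
      rewrite /shift3; lra.
    by rewrite b0 ?eqxx//; lra.
  rewrite indicE mem_set// mulr1 -real_normK ?num_real//.
  have -> : (4 * M ^+ 2 = (M + M) ^+ 2)%R by ring.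
  rewrite ler_pXn2r ?nnegrE ?addr_ge0 ?(le_trans _ (bM x))//.
  by apply: le_trans (ler_normB _ _) _; rewrite lerD.
under eq_integral do rewrite EFinM.
have mU1 : measurable_fun setT (fun x : R3 => (\1_U x)%:E : \bar R).
  by apply/measurable_EFinP; exact: measurable_indic.
have M0 : 0 <= (4 * M ^+ 2)%:E by rewrite lee_fin mulr_ge0// sqr_ge0.
rewrite ge0_integralZl//.
rewrite integral_indic// setIT.
apply: (@le_lt_trans _ _ ((4 * M ^+ 2)%:E * e'%:E)).
  by rewrite lee_wpmul2l// ?ltW// lee_fin mulr_ge0// sqr_ge0.
rewrite -EFinM lte_fin /e' mulrA ltr_pdivrMr// mulrC ltr_pM2l// ltrDl.
exact: ltr01.
Qed.

Lemma l2_cont_approx (a : R3 -> R) : measurable_fun setT a ->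
  (forall e : R, (0 < e)%R -> exists2 b : R3 -> R, measurable_fun setT b /\ l2_cont b &
    sqnorm (fun x => a x - b x)%R < e%:E) -> l2_cont a.
Proof.
move=> ma H e e0.
(* One ninth: three terms, and the factor 3 of [sqnorm_le3]. *)
have e9 : (0 < e / 9)%R by rewrite divr_gt0.
have [b [mb cb] ab] := H _ e9; have [d d0 Hd] := cb _ e9.
exists d => // h hd; have {}Hd := Hd h hd.
have mas : measurable_fun setT (a \o shift3 h).
  by apply: measurableT_comp => //; exact: measurable_shift3.
have mbs : measurable_fun setT (b \o shift3 h).
  by apply: measurableT_comp => //; exact: measurable_shift3.
pose f1 x := (a (shift3 h x) - b (shift3 h x))%R.
pose f2 x := (b (shift3 h x) - b x)%R.
pose f3 x := (b x - a x)%R.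
have -> : (fun x => a (shift3 h x) - a x)%R = (fun x => f1 x + f2 x + f3 x)%R.
  by apply/funext => x; rewrite /f1 /f2 /f3; ring.
apply: (le_lt_trans (sqnorm_le3 _ _ _)); try exact: measurable_funB.
have E1 : sqnorm f1 = sqnorm (fun x => a x - b x)%R.
  by rewrite -[RHS](@sqnorm_shift _ h)//; exact: measurable_funB.
have E3 : sqnorm f3 = sqnorm (fun x => a x - b x)%R.
  by apply: eq_integral => x _; rewrite /f3 -sqrrN opprB.
have -> : e%:E = 3%:E * ((e / 9)%:E + (e / 9)%:E + (e / 9)%:E).
  by rewrite -!EFinD -EFinM; congr (_%:E); lra.
rewrite lte_pmul2l//; apply: lteD; [apply: lteD|].
- by rewrite E1.
- exact: Hd.
- by rewrite E3.
Qed.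

Definition sqint (f : R3 -> R) := measurable_fun setT f /\ sqnorm f < +oo.

Lemma l2_contD (a b : R3 -> R) : measurable_fun setT a -> measurable_fun setT b ->
  l2_cont a -> l2_cont b -> l2_cont (fun x => a x + b x)%R.
Proof.
move=> ma mb ca cb e e0; have e6 : (0 < e / 6)%R by rewrite divr_gt0.
have [d1 d10 H1] := ca _ e6; have [d2 d20 H2] := cb _ e6.
exists (Num.min d1 d2); first by rewrite lt_min d10.
move=> h; rewrite lt_min => /andP[h1 h2].
have ms (f : R3 -> R) : measurable_fun setT f ->
    measurable_fun setT (fun x => f (shift3 h x) - f x)%R.
  move=> mf; apply: measurable_funB => //.
  by apply: measurableT_comp => //; exact: measurable_shift3.
have -> : (fun x => (a (shift3 h x) + b (shift3 h x)) - (a x + b x))%R =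
    (fun x => (a (shift3 h x) - a x) + (b (shift3 h x) - b x) + 0)%R.
  by apply/funext => x; ring.
apply: le_lt_trans.
  by apply: (@sqnorm_le3 (fun x => a (shift3 h x) - a x)%R
    (fun x => b (shift3 h x) - b x)%R (fun=> 0%R)) => //; exact: ms.
have -> : sqnorm (fun=> 0%R) = 0.
  by rewrite /sqnorm; under eq_integral do rewrite expr0n/=; exact: integral0.
have -> : e%:E = 3%:E * ((e / 6)%:E + (e / 6)%:E).
  by rewrite -!EFinD -EFinM; congr (_%:E); lra.
rewrite adde0 lte_pmul2l//; apply: lteD; [exact: H1|exact: H2].
Qed.

Lemma l2_contN (a : R3 -> R) : l2_cont a -> l2_cont (fun x => - a x)%R.
Proof.
move=> ca e e0; have [d d0 Hd] := ca e e0; exists d => // h /Hd.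
congr (_ < _); apply: eq_integral => x _; congr (_%:E).
by rewrite -sqrrN; congr (_ ^+ 2)%R; ring.
Qed.

Import HBNNSimple.

(** Simple functions below [a], cut off to growing boxes, have finite range and bounded support.
    They converge to [a] in L^2 by dominated convergence, with the square of [a] as bound. *)
Lemma sqint_l2_cont_ge0 (a : R3 -> R) : sqint a -> (forall x, 0 <= a x)%R -> l2_cont a.
Proof.
move=> [ma a2] a0; apply: l2_cont_approx => // e e0.
have mEa : measurable_fun setT (EFin \o a) by exact/measurable_EFinP.
pose g := nnsfun_approx measurableT mEa.
have Ea0 x : [set: R3] x -> 0 <= (EFin \o a) x by move=> _; rewrite lee_fin.
pose b n x := (g n x * \1_(box n%:R) x)%R.
have mbox n : measurable_fun setT (\1_(@box R n%:R) : R3 -> R).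
  by apply: measurable_indic; exact: measurable_box.
have mb n : measurable_fun setT (b n) by apply: measurable_funM.
have b0 n x : (0 <= b n x)%R by rewrite mulr_ge0.
have ba n x : (b n x <= a x)%R.
  have ga : (g n x <= a x)%R.
    by rewrite -lee_fin /g nnsfun_approxE; exact: (le_approx n Ea0).
  rewrite /b indicE; case: (_ \in _); first by rewrite mulr1.
  by rewrite mulr0.
have cvgb x : b n x @[n --> \oo] --> a x.
  have cg : g n x @[n --> \oo] --> a x.
    have /fine_cvg := cvg_nnsfun_approx measurableT mEa Ea0 (x := x) I.
    exact.
  apply: cvg_trans cg; apply: near_eq_cvg.
  near=> n; rewrite /b indicE mem_set ?mulr1//; apply/boxP.
  by near: n; exact: nbhs_infty_ger.
have c2 : sqnorm (fun x => a x - b n x)%R @[n --> \oo] --> 0.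
  have -> : 0 = \int[mu3]_x (cst 0%:E x) :> \bar R by rewrite integral0.
  apply: (@dominated_cvg _ _ _ mu3 setT measurableT (fun n x => ((a x - b n x) ^+ 2)%:E)
    (cst 0%:E) (fun x => ((a x) ^+ 2)%:E)).
  - by move=> n; apply: (@measurable_sqr (fun x => a x - b n x)%R); exact: measurable_funB.
  - move=> x _; apply/fine_cvgP; split; first by apply: nearW.
    have h : (a x - b n x)%R @[n --> \oo] --> (0%R : R).
      by rewrite -(subrr (a x)); apply: cvgB => //; exact: cvg_cst.
    rewrite -(mulr0 (0%R : R)); exact: (cvgM h h).
  - by [].
  - apply/integrableP; split; first exact: measurable_sqr.
    by under eq_integral do rewrite gee0_abs ?lee_fin ?sqr_ge0//.
  - move=> n x _; rewrite gee0_abs ?lee_fin ?sqr_ge0//.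
    by rewrite ler_pXn2r ?nnegrE ?subr_ge0// gerBl.
have [N HN] := cvge0_lt c2 e0.
exists (b N); last exact: HN.
split => //.
have [s Hs] : exists s : seq R, forall x, g N x \in s.
  have /finite_seqP[s fs] := fimfunP (g N).
  exists s => x; have : range (g N) (g N x) by exists x.
  by rewrite fs.
apply: (@l2_cont_finite _ (0%R :: s) N%:R) => //.
  move=> x; rewrite /b indicE; case: (_ \in _).
    by rewrite mulr1 in_cons Hs orbT.
  by rewrite mulr0 mem_head.
move=> x Nx; rewrite /b indicE memNset ?mulr0//.
by move=> /boxP; rewrite leNgt Nx.
Unshelve. all: by end_near. Qed.

Lemma sqint_l2_cont (a : R3 -> R) : sqint a -> l2_cont a.
Proof.
move=> [ma a2].
have H (s : R) : (s ^+ 2 = 1)%R -> sqint (fun x => Num.max (s * a x) 0)%R.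
  move=> s2; have mm : measurable_fun setT (fun x => Num.max (s * a x) 0)%R.
    by apply: measurable_maxr => //; apply: measurable_funM.
  split => //; apply: le_lt_trans a2; apply: ge0_le_integral => //.
  - by move=> x _; rewrite lee_fin sqr_ge0.
  - exact: (measurable_sqr mm).
  - exact: measurable_sqr.
  move=> x _; rewrite lee_fin.
  have -> : (a x ^+ 2 = (s * a x) ^+ 2)%R by rewrite exprMn s2 mul1r.
  by case: (leP 0%R (s * a x)%R) => _ //; rewrite expr0n/= sqr_ge0.
have H1 := H 1%R (expr1n _ _).
have H2 : sqint (fun x => Num.max (- 1 * a x) 0)%R by apply: H; rewrite sqrrN expr1n.
have -> : a = (fun x => Num.max (1 * a x) 0 + - (Num.max (- 1 * a x) 0))%R.
  apply/funext => x; rewrite mul1r mulN1r.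
  by case: (leP 0%R (a x)) => h; case: (leP 0%R (- a x)%R) => h'; lra.
apply: l2_contD.
- by have [] := H1.
- by have [m _] := H2; apply: measurableT_comp.
- by apply: sqint_l2_cont_ge0 => // x; rewrite le_max lexx orbT.
- by apply: l2_contN; apply: sqint_l2_cont_ge0 => // x; rewrite le_max lexx orbT.
Qed.
End square_integrable.

(** * Integration by parts in H^1 *)

Section convolution.
Local Open Scope ereal_scope.
Variable R : realType.
Local Notation R3 :=
  (measurableTypeR R * measurableTypeR R * measurableTypeR R)%type.
Local Notation mu3 := (@mu3 R).
Local Notation intg f := (mu3.-integrable [set: R3] (fun x => (f x)%:E)).

Lemma sqint_sqr (f : R3 -> R) : sqint f -> intg (fun x => f x ^+ 2)%R.
Proof.
move=> [mf f2]; apply/integrableP; split; first exact: measurable_sqr.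
by under eq_integral do rewrite gee0_abs ?lee_fin ?sqr_ge0//.
Qed.

Lemma sqint_mul (f g : R3 -> R) : sqint f -> sqint g -> intg (fun x => f x * g x)%R.
Proof.
move=> sf sg; have [mf _] := sf; have [mg _] := sg.
apply: (@le_integrable _ _ _ mu3 setT measurableT _
  (fun x => (f x ^+ 2)%:E + (g x ^+ 2)%:E)).
- by apply/measurable_EFinP; exact: measurable_funM.
- move=> x _; rewrite -EFinD lee_fin normrM (ger0_norm (addr_ge0 (sqr_ge0 _) (sqr_ge0 _))).
  have := sqr_ge0 (`|f x| - `|g x|)%R.
  rewrite -[(f x ^+ 2)%R]real_normK ?num_real// -[(g x ^+ 2)%R]real_normK ?num_real//.
  have := normr_ge0 (f x); have := normr_ge0 (g x); nra.
- by apply: integrableD => //; exact: sqint_sqr.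
Qed.

Lemma sqint_shift (f : R3 -> R) (h : R3) : sqint f -> sqint (f \o shift3 h).
Proof.
move=> [mf f2]; split; last by rewrite sqnorm_shift.
by apply: measurableT_comp => //; exact: measurable_shift3.
Qed.

Definition ip (f g : R3 -> R) : R := (\int[mu3]_x (f x * g x))%R.

Lemma ipE f g : sqint f -> sqint g -> (ip f g)%:E = \int[mu3]_x (f x * g x)%:E.
Proof.
move=> sf sg; rewrite /ip /Rintegral fineK//.
by apply: integrable_fin_num => //; exact: sqint_mul.
Qed.

Lemma ipC f g : ip f g = ip g f.
Proof. by apply: eq_Rintegral => x _; rewrite mulrC. Qed.

(** The pointwise inequality |uv| <= l u^2 + v^2 / l, integrated. The free weight [l] stands in for
    the Cauchy-Schwarz inequality and avoids square roots; it is tuned later to make both terms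
    small. *)
Lemma integral_mul_le (f g : R3 -> R) (l : R) : sqint f -> sqint g -> (0 < l)%R ->
  \int[mu3]_x `|(f x * g x)%:E| <= l%:E * sqnorm f + (l^-1)%:E * sqnorm g.
Proof.
move=> [mf f2] [mg g2] l0.
have li : (0 < l^-1)%R by rewrite invr_gt0.
rewrite /sqnorm -!ge0_integralZl//; try exact: measurable_sqr;
  try (by move=> x _; rewrite lee_fin sqr_ge0); try by rewrite lee_fin ltW.
rewrite -ge0_integralD//; try (by move=> x _; rewrite mule_ge0// lee_fin ?sqr_ge0// ltW);
  try (by apply: measurable_funeM; exact: measurable_sqr).
apply: ge0_le_integral => //.
- by apply: measurableT_comp => //; apply/measurable_EFinP; exact: measurable_funM.
- by apply: emeasurable_funD; apply: measurable_funeM; exact: measurable_sqr.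
move=> x _; rewrite -!EFinM -EFinD lee_fin normrM.
rewrite -[(f x ^+ 2)%R]real_normK ?num_real// -[(g x ^+ 2)%R]real_normK ?num_real//.
have u0 := normr_ge0 (f x); have v0 := normr_ge0 (g x).
set u := `|f x|%R in u0 *; set v := `|g x|%R in v0 *.
have := sqr_ge0 (l * u - v)%R.
have : (l * (u * v) <= l * (l * u ^+ 2 + l^-1 * v ^+ 2))%R; last by rewrite ler_pM2l.
by rewrite mulrDr !mulrA mulfV ?gt_eqF// mul1r; have := mulr_ge0 u0 v0; nra.
Qed.

Lemma measurable_sub3 d (T : measurableType d) (f g : T -> R3) :
  measurable_fun setT f -> measurable_fun setT g ->
  measurable_fun (U := R3) setT (fun x => f x - g x)%R.
Proof. by move=> mf mg; apply: measurable_add3 => //; exact: measurable_opp3. Qed.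

Lemma integral_norm_sub (k : R3 -> R) (y : R3) : measurable_fun setT k ->
  \int[mu3]_x `|k (x - y)%R|%:E = \int[mu3]_x `|k x|%:E.
Proof.
move=> mk; rewrite -[RHS](@ge0_integral_shift R (- y)%R)//.
by apply/measurable_EFinP; exact: measurableT_comp.
Qed.

Lemma integral_norm_sub' (k : R3 -> R) (x : R3) : measurable_fun setT k ->
  \int[mu3]_y `|k (x - y)%R|%:E = \int[mu3]_x `|k x|%:E.
Proof.
move=> mk.
have mk1 : measurable_fun setT (fun y : R3 => `|k (y + x)%R|%:E).
  apply/measurable_EFinP; apply: measurableT_comp => //.
  by apply: (measurableT_comp mk); exact: measurable_add3.
rewrite -[RHS](@ge0_integral_shift R x)//; last first.
  by apply/measurable_EFinP; exact: measurableT_comp.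
rewrite -[RHS](@ge0_integral_opp R)//.
by apply: eq_integral => y _; rewrite addrC.
Qed.

Section kernel.
Variables (k f g : R3 -> R).
Hypotheses (mk : measurable_fun setT k) (k1 : \int[mu3]_x `|k x|%:E < +oo).
Hypotheses (sf : sqint f) (sg : sqint g).

Let mf : measurable_fun setT f. Proof. by have [] := sf. Qed.
Let mg : measurable_fun setT g. Proof. by have [] := sg. Qed.

Let F (p : R3 * R3) := (g p.1 * (k (p.2 - p.1) * f p.2))%R.

Let mF : measurable_fun setT F.
Proof.
apply: measurable_funM; first exact: measurableT_comp.
apply: measurable_funM; last exact: measurableT_comp.
by apply: (measurableT_comp mk); exact: measurable_sub3.
Qed.

Let fin (u : R3 -> R) : sqint u ->
  sqnorm u * \int[mu3]_x `|k x|%:E < +oo.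
Proof.
move=> [mu u2]; apply: lte_mul_pinfty => //; first exact: sqnorm_ge0.
by rewrite ge0_fin_numE// sqnorm_ge0.
Qed.

Let K := \int[mu3]_x `|k x|%:E.
Let K0 : 0 <= K. Proof. by apply: integral_ge0 => x _; rewrite lee_fin. Qed.
Let mnk (u : R3 * R3 -> R3) : measurable_fun setT u ->
  measurable_fun setT (fun p => `|k (u p)|%:E).
Proof.
move=> mu; apply/measurable_EFinP; apply: measurableT_comp => //.
exact: (measurableT_comp mk mu).
Qed.
Let mnk1 (y : R3) : measurable_fun setT (fun x : R3 => `|k (x - y)%R|%:E).
Proof.
apply/measurable_EFinP; apply: measurableT_comp => //.
by apply: (measurableT_comp mk); exact: measurable_sub3.
Qed.
Let mnk2 (x : R3) : measurable_fun setT (fun y : R3 => `|k (x - y)%R|%:E).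
Proof.
apply/measurable_EFinP; apply: measurableT_comp => //.
by apply: (measurableT_comp mk); exact: measurable_sub3.
Qed.

(** The product |g(y) k(x - y) f(x)| is at most (f(x)^2 + g(y)^2) |k(x - y)|. Each half integrates
    to a squared norm times the L^1 norm of [k], because |k(x - y)| has that same integral over
    either variable. *)
Lemma kernel_integrable : (mu3 \x mu3).-integrable setT (fun p => (F p)%:E).
Proof.
have mFE : measurable_fun setT (fun p => (F p)%:E) by exact/measurable_EFinP.
apply: (integrable12ltyP mu3 mu3 mFE).2.
pose a (p : R3 * R3) := (g p.1 ^+ 2)%:E * `|k (p.2 - p.1)%R|%:E.
pose b (p : R3 * R3) := (f p.2 ^+ 2)%:E * `|k (p.2 - p.1)%R|%:E.
have mks : measurable_fun setT (fun p : R3 * R3 => `|k (p.2 - p.1)%R|%:E).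
  by apply: mnk; exact: measurable_sub3.
have ma : measurable_fun setT a.
  apply: emeasurable_funM => //; apply/measurable_EFinP; apply: measurable_funX.
  exact: measurableT_comp.
have mb : measurable_fun setT b.
  apply: emeasurable_funM => //; apply/measurable_EFinP; apply: measurable_funX.
  exact: measurableT_comp.
have a0 p : 0 <= a p by rewrite mule_ge0 ?lee_fin ?sqr_ge0.
have b0 p : 0 <= b p by rewrite mule_ge0 ?lee_fin ?sqr_ge0.
have Ea y : \int[mu3]_x a (y, x) = (g y ^+ 2)%:E * K.
  rewrite /a /b /= ge0_integralZl//; last by rewrite lee_fin sqr_ge0.
  by rewrite integral_norm_sub.
have Eb x : \int[mu3]_y b (y, x) = (f x ^+ 2)%:E * K.
  rewrite /a /b /= ge0_integralZl//; last by rewrite lee_fin sqr_ge0.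
  by rewrite integral_norm_sub'.
have Sa : \int[mu3]_y \int[mu3]_x a (y, x) = sqnorm g * K.
  under eq_integral do rewrite Ea.
  rewrite ge0_integralZr//; first exact: measurable_sqr.
  by move=> x _; rewrite lee_fin sqr_ge0.
have Sb : \int[mu3]_y \int[mu3]_x b (y, x) = sqnorm f * K.
  (* The factor f(x)^2 does not depend on y, so the order of integration is exchanged in order to
     integrate the kernel over y first. *)
  rewrite (fubini_tonelli (m1 := mu3) (m2 := mu3) b mb b0).
  under eq_integral do rewrite Eb.
  rewrite ge0_integralZr//; first exact: measurable_sqr.
  by move=> x _; rewrite lee_fin sqr_ge0.
have mab y : measurable_fun setT (fun x => a (y, x)).
  exact: (measurableT_comp ma (pair1_measurable y)).
have mbb y : measurable_fun setT (fun x => b (y, x)).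
  exact: (measurableT_comp mb (pair1_measurable y)).
have mIa : measurable_fun setT (fun y => \int[mu3]_x a (y, x)).
  exact: (measurable_fun_fubini_tonelli_F (m2 := mu3) a).
have mIb : measurable_fun setT (fun y => \int[mu3]_x b (y, x)).
  exact: (measurable_fun_fubini_tonelli_F (m2 := mu3) b).
have mFy y : measurable_fun setT (fun x => `|(F (y, x))%:E|).
  apply: measurableT_comp => //.
  exact: (measurableT_comp mFE (pair1_measurable y)).
apply: (@le_lt_trans _ _ (\int[mu3]_y (\int[mu3]_x a (y, x) + \int[mu3]_x b (y, x)))).
  apply: ge0_le_integral; [exact: measurableT|..].
  - by move=> y _; exact: integral_ge0.
  - apply: (measurable_fun_fubini_tonelli_F (m2 := mu3) (fun p => `|(F p)%:E|)) => //.
    exact: measurableT_comp.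
  - exact: emeasurable_funD.
  move=> y _; rewrite -ge0_integralD; [|by []|by []|exact: mab|by []|exact: mbb].
  apply: ge0_le_integral; [exact: measurableT| |exact: mFy|exact: emeasurable_funD|].
    by move=> x _; exact: abse_ge0.
  move=> x _; rewrite /a /b -!EFinM -EFinD lee_fin /F /=.
  rewrite -mulrDl [(g y * _)%R]mulrCA normrM mulrC ler_wpM2r// normrM.
  rewrite -[(f x ^+ 2)%R]real_normK ?num_real// -[(g y ^+ 2)%R]real_normK ?num_real//.
  have := sqr_ge0 (`|f x| - `|g y|)%R.
  have := normr_ge0 (f x); have := normr_ge0 (g y); nra.
rewrite ge0_integralD//; try by move=> y _; exact: integral_ge0.
rewrite Sa Sb; apply: lte_add_pinfty; exact: fin.
Qed.

(** For fixed h the integral of |f(y + h) g(y)| is at most the sum of the two squared norms,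
    uniformly in h; then only |k(h)| remains to be integrated. *)
Lemma shift_kernel_integrable : (mu3 \x mu3).-integrable setT
  (fun p : R3 * R3 => (k p.1 * (f (p.2 + p.1)%R * g p.2))%:E).
Proof.
have mfs : measurable_fun setT (fun p : R3 * R3 => f (p.2 + p.1)%R).
  by apply: (measurableT_comp mf); exact: measurable_add3.
have mFE : measurable_fun setT (fun p : R3 * R3 => (k p.1 * (f (p.2 + p.1)%R * g p.2))%:E).
  apply/measurable_EFinP; apply: measurable_funM; first exact: measurableT_comp.
  apply: measurable_funM => //; exact: measurableT_comp.
apply: (integrable12ltyP mu3 mu3 mFE).2.
pose B := sqnorm f + sqnorm g.
have B0 : 0 <= B by rewrite adde_ge0// sqnorm_ge0.
have mK : measurable_fun setT (fun h : R3 => `|k h|%:E).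
  by apply/measurable_EFinP; exact: measurableT_comp.
apply: (@le_lt_trans _ _ (\int[mu3]_h (B * `|k h|%:E))).
  apply: ge0_le_integral; [exact: measurableT|..].
  - by move=> y _; exact: integral_ge0.
  - apply: (measurable_fun_fubini_tonelli_F (m2 := mu3) (abse \o
      (fun p : R3 * R3 => (k p.1 * (f (p.2 + p.1)%R * g p.2))%:E))).
      exact: measurableT_comp.
    by move=> p; exact: abse_ge0.
  - exact: measurable_funeM.
  move=> h _; rewrite muleC.
  have sfh := sqint_shift h sf.
  rewrite [leLHS](_ : _ = \int[mu3]_y (`|k h|%:E * `|((f \o shift3 h) y * g y)%:E|)); last first.
    by apply: eq_integral => y _; rewrite /= normrM EFinM.
  rewrite ge0_integralZl//; last first.
    apply: measurableT_comp => //; apply/measurable_EFinP; apply: measurable_funM => //.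
    by have [] := sfh.
  rewrite lee_wpmul2l//.
  have := integral_mul_le sfh sg (ltr01 : (0 < 1)%R).
  by rewrite invr1 !mul1e sqnorm_shift.
rewrite ge0_integralZl//.
rewrite -/K /B ge0_muleDl ?sqnorm_ge0//.
by apply: lte_add_pinfty; exact: fin.
Qed.
End kernel.
End convolution.

(** * Averages over shifts, convolutions and weak derivatives *)

Section convolution_form.
Local Open Scope ereal_scope.
Variable R : realType.
Local Notation R3 :=
  (measurableTypeR R * measurableTypeR R * measurableTypeR R)%type.
Local Notation mu3 := (@mu3 R).
Local Notation intg f := (mu3.-integrable [set: R3] (fun x => (f x)%:E)).

(** The integral of k(x - y) f(x) over x, that is, the convolution of [f] with the reflected kernel.
    In this form the translated kernel can serve directly as a test function. *)
Definition conv (k f : R3 -> R) (y : R3) : R := ip (k \o shift3 (- y)%R) f.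

Section kernel.
Variables (k f g : R3 -> R).
Hypotheses (sk : sqint k) (k1 : \int[mu3]_x `|k x|%:E < +oo).
Hypotheses (sf : sqint f) (sg : sqint g).
Let mk : measurable_fun setT k. Proof. by have [] := sk. Qed.

Lemma conv_inner y : \int[mu3]_x (g y * (k (x - y)%R * f x))%:E = (g y * conv k f y)%:E.
Proof.
have sky := sqint_shift (- y)%R sk.
by rewrite EFinM /conv (ipE sky sf) -integralZl//; exact: sqint_mul.
Qed.

Lemma conv_integrable : intg (fun y => g y * conv k f y)%R.
Proof.
have -> : (fun y => (g y * conv k f y)%:E) =
    fubini_F mu3 (fun p : R3 * R3 => (g p.1 * (k (p.2 - p.1)%R * f p.2))%:E).
  by apply/funext => y; rewrite /fubini_F conv_inner.
exact: (integrable_fubini_F (kernel_integrable mk k1 sf sg)).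
Qed.

Lemma shift_inner h : \int[mu3]_y (k h * (f (y + h)%R * g y))%:E = (k h * ip (f \o shift3 h) g)%:E.
Proof.
have sfh := sqint_shift h sf.
by rewrite EFinM (ipE sfh sg) -integralZl//; exact: sqint_mul.
Qed.

Lemma shift_form_integrable : intg (fun h => k h * ip (f \o shift3 h) g)%R.
Proof.
have -> : (fun h => (k h * ip (f \o shift3 h) g)%:E) =
    fubini_F mu3 (fun p : R3 * R3 => (k p.1 * (f (p.2 + p.1)%R * g p.2))%:E).
  by apply/funext => h; rewrite /fubini_F shift_inner.
exact: (integrable_fubini_F (shift_kernel_integrable mk k1 sf sg)).
Qed.

(** Fubini and the substitution x = y + h turn an average over shifts into a convolution, whose
    kernel can absorb derivatives. *)
Lemma shift_form_conv :
  (\int[mu3]_h (k h * ip (f \o shift3 h) g) = \int[mu3]_y (g y * conv k f y))%R.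
Proof.
apply: (congr1 fine).
have E1 : \int[mu3]_h (k h * ip (f \o shift3 h) g)%:E =
    \int[mu3]_h \int[mu3]_y (k h * (f (y + h)%R * g y))%:E.
  by apply: eq_integral => h _; rewrite shift_inner.
rewrite E1 (Fubini (shift_kernel_integrable mk k1 sf sg)).
apply: eq_integral => y _; rewrite -conv_inner.
have mm : measurable_fun setT (fun h : R3 => (k h * (f (y + h)%R * g y))%:E).
  apply/measurable_EFinP; apply: measurable_funM => //; apply: measurable_funM => //.
  have [mf _] := sf.
  by apply: (measurableT_comp mf); exact: measurable_add3.
rewrite -(integral_shift (- y)%R mm); apply: eq_integral => x _.
by rewrite [(y + _)%R]addrC subrK mulrA [(_ * g y)%R]mulrC.
Qed.
End kernel.

(** By Fubini, transposing the operator [conv k] reflects its kernel. *)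
Lemma conv_sym (k f g : R3 -> R) (sk : sqint k) (k1 : \int[mu3]_x `|k x|%:E < +oo)
    (sf : sqint f) (sg : sqint g) :
  (\int[mu3]_y (g y * conv k f y) = \int[mu3]_x (f x * conv (k \o @opp3 R) g x))%R.
Proof.
have [mk k2] := sk.
have mo : measurable_fun setT (@opp3 R) by exact: measurable_opp3.
have sk' : sqint (k \o @opp3 R).
  split; first exact: measurableT_comp.
  rewrite /sqnorm (ge0_integral_opp (f := fun x => ((k x) ^+ 2)%:E))//.
    exact: measurable_sqr.
  by move=> x; rewrite lee_fin sqr_ge0.
apply: (congr1 fine).
have E1 : \int[mu3]_y (g y * conv k f y)%:E =
    \int[mu3]_y \int[mu3]_x (g y * (k (x - y)%R * f x))%:E.
  by apply: eq_integral => y _; rewrite conv_inner.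
rewrite E1 (Fubini (kernel_integrable mk k1 sf sg)).
apply: eq_integral => x _; rewrite -(conv_inner f sk' sg).
by apply: eq_integral => y _; rewrite /= /opp3 opprB; congr (_%:E); ring.
Qed.

Lemma partial_opp j (f : R3 -> R) : smooth f ->
  partial j (fun x => f (- x)%R) = (fun x => - partial j f (- x))%R.
Proof.
move=> sf; apply/funext => x.
have df : differentiable f (- x)%R by exact: smooth_differentiable.
have dN : is_diff x (fun x : R3 => - x)%R (fun x : R3 => - x)%R.
  exact: is_diffN.
have dc := is_diff_comp dN (differentiableP df).
rewrite /partial deriveE; last by have [] := dc.
by rewrite (@diff_val _ _ _ _ _ _ _ dc) /= linearN deriveE.
Qed.

Definition weakd (j : 'I_3) (a a' : R3 -> R) := forall phi, test_function phi ->
  ip a (partial j phi) = (- ip a' phi)%R.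

Section test_kernel.
Variable e : R.

Lemma smooth_supp_sqint (f : R3 -> R) r : smooth f ->
  (forall x : R3, (r < `|x|)%R -> f x = 0%R) -> sqint f /\ \int[mu3]_x `|f x|%:E < +oo.
Proof.
move=> sf f0; have mf := smooth_measurable sf.
have [M HM] := smooth_bounded sf r.
have fM x : (`|f x| <= `|M| * \1_(box r) x)%R.
  have [xr|rx] := lerP `|x|%R r.
    rewrite indicE mem_set ?mulr1; last exact/boxP.
    by apply: le_trans (HM x xr) _; exact: ler_norm.
  by rewrite f0// normr0 mulr_ge0.
have mI : measurable_fun setT (\1_(@box R r) : R3 -> R).
  by apply: measurable_indic; exact: measurable_box.
have fin (c : R) : (0 <= c)%R -> \int[mu3]_x (c * \1_(box r) x)%:E < +oo.
  move=> c0; under eq_integral do rewrite EFinM.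
  rewrite ge0_integralZl//; last exact/measurable_EFinP.
  rewrite integral_indic//; last exact: measurable_box.
  rewrite setIT; apply: lte_mul_pinfty => //; exact: mu3_box_lty.
split.
  split => //; apply: le_lt_trans (fin (M ^+ 2)%R (sqr_ge0 _)).
  apply: ge0_le_integral => //.
  - by move=> x _; rewrite lee_fin sqr_ge0.
  - exact: measurable_sqr.
  - by apply/measurable_EFinP; exact: measurable_funM.
  move=> x _; rewrite lee_fin -[(f x ^+ 2)%R]real_normK ?num_real//.
  have -> : (M ^+ 2 * \1_(box r) x = (`|M| * \1_(box r) x) ^+ 2)%R.
    rewrite exprMn real_normK ?num_real//; congr (_ * _)%R.
    by rewrite indicE; case: (_ \in _); rewrite ?expr1n ?expr0n.
  by rewrite ler_pXn2r ?nnegrE// (le_trans _ (fM x)).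
apply: le_lt_trans (fin `|M|%R (normr_ge0 _)); apply: ge0_le_integral => //.
- by apply/measurable_EFinP; exact: measurableT_comp.
- by apply/measurable_EFinP; exact: measurable_funM.
- by move=> x _; rewrite lee_fin.
Qed.

Let eta := @bump R e.
Let eta0 (x : R3) : (e < `|x|)%R -> eta x = 0%R.
Proof. by move=> /ltW; exact: bump_eq0. Qed.

(** The translated bump x -> eta(x - y) is itself a test function, to which the definition of the
    weak derivative applies. *)
Lemma conv_bump_weakd j (a a' : R3 -> R) y : weakd j a a' -> sqint a -> sqint a' ->
  conv eta a' y = (- conv (partial j eta) a y)%R.
Proof.
move=> aw sa sa'.
have seta := smooth_shift (- y)%R (smooth_bump e).
have tf : test_function (eta \o shift3 (- y)%R).
  apply: (test_function_smooth (r := (e + `|y|)%R) seta) => x xr.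
  apply: eta0; rewrite /shift3.
  have : (`|x| <= `|x - y| + `|y|)%R by rewrite -{1}[x](subrK y) ler_normD.
  move: xr; lra.
have P : partial j (eta \o shift3 (- y)%R) = partial j eta \o shift3 (- y)%R.
  exact: (partial_shift j eta (- y)%R).
have E := aw _ tf; rewrite P in E.
by rewrite /conv (ipC (partial j eta \o _)) E opprK ipC.
Qed.

(** Both terms acquire the kernel [partial j eta]: the derivative leaves a' in the first one, and b'
    in the second one after a transposition that is harmless because eta is even. As [partial j eta]
    is odd, transposing the first term once more shows that the two are opposite. *)
Lemma shift_form_bump0 j (a a' b b' : R3 -> R) : weakd j a a' -> weakd j b b' ->
  sqint a -> sqint a' -> sqint b -> sqint b' ->
  (\int[mu3]_h (eta h * (ip (a' \o shift3 h) b + ip (a \o shift3 h) b')) = 0)%R.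
Proof.
move=> wa wb sa sa' sb sb'.
have [seta eta1] := smooth_supp_sqint (smooth_bump e) eta0.
have [sdeta deta1] := smooth_supp_sqint (smooth_partial j (smooth_bump e))
  (partial_eq0 j eta0).
under eq_Rintegral do rewrite mulrDr.
rewrite RintegralD//; [|exact: shift_form_integrable..].
rewrite !shift_form_conv//.
rewrite (conv_sym seta eta1 sa sb').
have -> : (\int[mu3]_y (b y * conv eta a' y) = - \int[mu3]_y (b y * conv (partial j eta) a y))%R.
  rewrite -[RHS]mulN1r -RintegralZl//; last exact: conv_integrable.
  by apply: eq_Rintegral => y _; rewrite (conv_bump_weakd _ wa)// mulrN mulN1r.
rewrite (conv_sym sdeta deta1 sa sb) addrC.
apply/eqP; rewrite subr_eq0; apply/eqP; apply: eq_Rintegral => x _; congr (_ * _)%R.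
have -> : eta \o @opp3 R = eta by apply/funext => z; exact: bumpN.
rewrite (conv_bump_weakd _ wb)//.
have -> : partial j eta \o @opp3 R = (fun z => - partial j eta z)%R.
  have P := partial_opp j (smooth_bump e).
  have E : (fun x : R3 => bump e (- x)%R) = eta by apply/funext => z; exact: bumpN.
  rewrite E in P; apply/funext => z.
  by have := congr1 (fun f => f z) P; rewrite /= => ->; rewrite opprK.
rewrite /conv /ip -[LHS]mulN1r -RintegralZl//; last first.
  exact: (sqint_mul (sqint_shift (- x)%R sdeta) sb).
by apply: eq_Rintegral => z _; rewrite /=; ring.
Qed.
End test_kernel.
End convolution_form.

(** * Integration by parts, from continuity in the shift *)

Section integration_by_parts.
Local Open Scope ereal_scope.
Variable R : realType.
Local Notation R3 :=
  (measurableTypeR R * measurableTypeR R * measurableTypeR R)%type.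
Local Notation mu3 := (@mu3 R).

Lemma sqintB (a b : R3 -> R) : sqint a -> sqint b -> sqint (fun x => a x - b x)%R.
Proof.
move=> [ma a2] [mb b2]; have mB : measurable_fun setT (fun x => a x - b x)%R.
  exact: measurable_funB.
split => //.
have mN : measurable_fun setT (fun x => - b x)%R by apply: measurableT_comp.
have E : (fun x => a x - b x)%R = (fun x => a x + (- b x) + 0)%R.
  by apply/funext => x; rewrite addr0.
rewrite E; apply: le_lt_trans.
  exact: (@sqnorm_le3 _ a (fun x => - b x)%R (fun=> 0%R) ma mN (measurable_cst _)).
have -> : sqnorm (fun=> 0%R : R) = 0 :> \bar R.
  by rewrite /sqnorm; under eq_integral do rewrite expr0n/=; exact: integral0.
have -> : sqnorm (fun x => - b x)%R = sqnorm b.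
  by apply: eq_integral => x _; rewrite sqrrN.
by rewrite adde0; apply: lte_mul_pinfty => //; exact: lte_add_pinfty.
Qed.

Lemma ip_norm_le (f g : R3 -> R) (l : R) : sqint f -> sqint g -> (0 < l)%R ->
  `|ip f g|%:E <= l%:E * sqnorm f + (l^-1)%:E * sqnorm g.
Proof.
move=> sf sg l0; apply: le_trans (integral_mul_le sf sg l0).
rewrite -[leLHS]/(`|(ip f g)%:E|) ipE//; apply: le_abse_integral => //.
by have /measurable_int := sqint_mul sf sg.
Qed.

Lemma ip_shift_cont (a b : R3 -> R) : sqint a -> sqint b -> forall e : R, (0 < e)%R ->
  exists2 d : R, (0 < d)%R & forall h : R3, (`|h| < d)%R ->
    (`|ip (a \o shift3 h) b - ip a b| < e)%R.
Proof.
move=> sa sb e e0.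
have [B0 BE] : (0 <= fine (sqnorm b))%R /\ sqnorm b = (fine (sqnorm b))%:E.
  split; first by rewrite fine_ge0 ?sqnorm_ge0.
  by rewrite fineK// ge0_fin_numE ?sqnorm_ge0//; have [] := sb.
set B := fine (sqnorm b) in B0 BE.
(* This weight makes the term in [b] at most e / 2, and the [+ 1] covers [B = 0]. The other term is
   made small by continuity of translations. *)
pose l := (2 * (B + 1) / e)%R.
have l0 : (0 < l)%R by rewrite divr_gt0// mulr_gt0// ltr_wpDl.
have e'0 : (0 < e / 2 / l)%R by apply: divr_gt0 => //; exact: divr_gt0.
have [d d0 Hd] := sqint_l2_cont sa e'0.
exists d => // h hd; have {}Hd := Hd h hd.
have sah := sqint_shift h sa.
have -> : (ip (a \o shift3 h) b - ip a b = ip (fun x => a (shift3 h x) - a x) b)%R.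
  rewrite /ip -RintegralB//; [|exact: sqint_mul..].
  by apply: eq_Rintegral => x _; rewrite /= mulrBl.
rewrite -lte_fin; apply: le_lt_trans (ip_norm_le (sqintB sah sa) sb l0) _.
have -> : e%:E = l%:E * (e / 2 / l)%:E + (e / 2)%:E.
  rewrite -EFinM -EFinD; congr (_%:E); field; rewrite gt_eqF//=; exact/lt0r_neq0.
rewrite BE -[X in _ + X]EFinM; apply: lte_leD; first by [].
  by rewrite EFinM lte_pmul2l.
rewrite lee_fin /l invf_div mulrAC ler_pdivrMr ?mulr_gt0 ?ltr_wpDl//.
have -> : (e / 2 * (2 * (B + 1)) = e * (B + 1))%R by field.
by rewrite ler_pM2l// lerDl.
Qed.

(* The function [h |-> ip (a' \o shift3 h) b + ip (a \o shift3 h) b'] is continuous and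
   its integral against every [bump d] vanishes, hence so does its value at [0]. *)
Lemma ibp j (a a' b b' : R3 -> R) : weakd j a a' -> weakd j b b' ->
  sqint a -> sqint a' -> sqint b -> sqint b' ->
  ip a' b = (- ip a b')%R.
Proof.
move=> wa wb sa sa' sb sb'; apply/eqP; rewrite -addr_eq0; apply/eqP.
set k0 := (ip a' b + ip a b')%R; apply/eqP/negPn/negP => k0n.
have k00 : (0 < `|k0|)%R by rewrite normr_gt0.
(* Each of the two inner products moves by less than a quarter of |k0|, so [k] keeps the sign of
   [k0] on the ball of radius [d]. *)
have e0 : (0 < `|k0| / 4)%R by rewrite divr_gt0.
have [d1 d10 H1] := ip_shift_cont sa' sb e0.
have [d2 d20 H2] := ip_shift_cont sa sb' e0.
pose d := Num.min d1 d2; have d0 : (0 < d)%R by rewrite lt_min d10.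
pose k h := (ip (a' \o shift3 h) b + ip (a \o shift3 h) b')%R.
have kk h : (`|h| < d)%R -> (0 < Num.sg k0 * k h)%R.
  rewrite lt_min => /andP[/H1 h1 /H2 h2].
  have : (`|k h - k0| <= `|k0| / 2)%R.
    rewrite /k /k0 opprD addrACA; apply: le_trans (ler_normD _ _) _.
    by rewrite -/k0; lra.
  have := normrEsg k0; move: k0n; rewrite neq_lt => /orP[k0l|k0r].
    by rewrite ltr0_sg// => E; rewrite ler_norml => /andP[]; lra.
  by rewrite gtr0_sg// => E; rewrite ler_norml => /andP[]; lra.
have [seta eta1] := smooth_supp_sqint (smooth_bump d)
  (fun x (dx : (d < `|x|)%R) => bump_eq0 (ltW dx)).
have I0 := shift_form_bump0 d wa wb sa sa' sb sb'.
(* The sign of [k0] makes the integrand nonnegative. Its integral being zero, it vanishes almost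
   everywhere, although it is positive on a cube of positive measure. *)
pose F h := (Num.sg k0 * (bump d h * k h))%R.
have F0 h : (0 <= F h)%R.
  have [hd|dh] := ltrP `|h|%R d.
    by rewrite /F mulrCA mulr_ge0 ?bump_ge0// ltW// kk.
  by rewrite /F bump_eq0// mul0r mulr0.
have iF0 : mu3.-integrable setT (EFin \o (fun h => bump d h * k h)%R).
  have -> : EFin \o (fun h => bump d h * k h)%R =
    (fun h => (bump d h * ip (a' \o shift3 h) b)%:E + (bump d h * ip (a \o shift3 h) b')%:E).
    by apply/funext => h /=; rewrite -EFinD -mulrDr.
  by apply: integrableD => //; exact: shift_form_integrable.
have iF : mu3.-integrable setT (EFin \o F).
  have -> : EFin \o F = (fun h => (Num.sg k0)%:E * (EFin \o (fun h => bump d h * k h)%R) h).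
    by [].
  exact: integrableZl.
have IF : \int[mu3]_h `|(F h)%:E| = 0.
  under eq_integral => h _ do rewrite gee0_abs ?lee_fin ?F0//.
  have -> : \int[mu3]_h (F h)%:E = (\int[mu3]_h (F h))%R%:E.
    by rewrite /Rintegral fineK//; exact: integrable_fin_num.
  by rewrite /F RintegralZl// I0 mulr0.
have mF : measurable_fun setT (EFin \o F) by have /measurable_int := iF.
have := (ae_eq_integral_abs mu3 measurableT mF).1 IF.
move=> [N [mN N0 HN]].
have : mu3 (box (d / 2)) <= 0.
  rewrite -N0; apply: le_measure; rewrite ?inE//; first exact: measurable_box.
  move=> h /boxP hd; apply: HN => /(_ I) /= [] /eqP; apply/negP.
  have hd2 : (`|h| < d)%R by apply: le_lt_trans hd _; lra.
  by rewrite gt_eqF// /F mulrCA mulr_gt0 ?bump_gt0// kk.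
apply/negP; rewrite -ltNge /box mu3X; [|exact: measurable_itv..].
rewrite !lebesgue_measure_itv/= lte_fin ifT; last by lra.
by rewrite -!EFinB -!EFinM lte_fin !mulr_gt0//; lra.
Qed.
End integration_by_parts.

Local Open Scope complex_scope.

(** * The bilinear form of time reversal *)

Section complex_integrals.
Variable R : realType.
Local Notation C := R[i].
Local Notation R3 :=
  (measurableTypeR R * measurableTypeR R * measurableTypeR R)%type.
Local Notation mu3 := (@mu3 R).
Local Notation intg f := (mu3.-integrable [set: R3] (EFin \o f)).
Local Notation Re := complex.Re.
Local Notation Im := complex.Im.

Lemma ReM (x y : C) : Re (x * y) = Re x * Re y - Im x * Im y.
Proof. by case: x => a b; case: y. Qed.
Lemma ImM (x y : C) : Im (x * y) = Re x * Im y + Im x * Re y.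
Proof. by case: x => a b; case: y. Qed.
Lemma ReD (x y : C) : Re (x + y) = Re x + Re y. Proof. by case: x; case: y. Qed.
Lemma ImD (x y : C) : Im (x + y) = Im x + Im y. Proof. by case: x; case: y. Qed.

Definition cL2 (f : R3 -> C) := sqint (fun x => Re (f x)) /\ sqint (fun x => Im (f x)).
Definition cint (f : R3 -> C) := intg (fun x => Re (f x)) /\ intg (fun x => Im (f x)).

Lemma integrableDr (f g : R3 -> R) : intg f -> intg g -> intg (fun x => f x + g x).
Proof.
move=> If Ig; rewrite (_ : _ \o _ = (fun x => (f x)%:E + (g x)%:E)%E).
  exact: integrableD.
by apply/funext => x; rewrite /= EFinD.
Qed.

Lemma integrableZr' (c : R) (f : R3 -> R) : intg f -> intg (fun x => c * f x).
Proof.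
move=> If; rewrite (_ : _ \o _ = (fun x => c%:E * (f x)%:E)%E).
  exact: integrableZl.
by apply/funext => x; rewrite /= EFinM.
Qed.

Lemma cintD f g : cint f -> cint g -> cint (fun x => f x + g x).
Proof.
move=> [f1 f2] [g1 g2]; split.
  by under eq_fun do rewrite ReD; exact: integrableDr.
by under eq_fun do rewrite ImD; exact: integrableDr.
Qed.

Lemma cintZ c f : cint f -> cint (fun x => c * f x).
Proof.
move=> [f1 f2]; split.
  under eq_fun do rewrite ReM -mulNr.
  by apply: integrableDr; exact: integrableZr'.
under eq_fun do rewrite ImM.
by apply: integrableDr; exact: integrableZr'.
Qed.

Lemma cint0 : cint (fun=> 0).
Proof. by split; exact: integrable0. Qed.

Lemma cint_sum (I : Type) (s : seq I) (f : I -> R3 -> C) :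
  (forall i, cint (f i)) -> cint (fun x => \sum_(i <- s) f i x).
Proof.
move=> H; elim: s => [|i s IH].
  by under eq_fun do rewrite big_nil; exact: cint0.
by under eq_fun do rewrite big_cons; exact: cintD.
Qed.

Lemma cintegralE f : cintegral f =
  (\int[mu3]_x Re (f x)) +i* (\int[mu3]_x Im (f x)).
Proof. by []. Qed.

Lemma cintegralD f g : cint f -> cint g ->
  cintegral (fun x => f x + g x) = cintegral f + cintegral g.
Proof.
move=> [f1 f2] [g1 g2]; rewrite !cintegralE.
rewrite -[RHS]/((\int[mu3]_x Re (f x) + \int[mu3]_x Re (g x)) +i*
  (\int[mu3]_x Im (f x) + \int[mu3]_x Im (g x))).
rewrite -!RintegralD//; congr (_ +i* _); apply: eq_Rintegral => x _.
  by rewrite ReD.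
by rewrite ImD.
Qed.

Lemma cintegralZ c f : cint f -> cintegral (fun x => c * f x) = c * cintegral f.
Proof.
move=> [f1 f2]; rewrite !cintegralE; case: c => a b.
rewrite -[RHS]/((a * \int[mu3]_x Re (f x) - b * \int[mu3]_x Im (f x)) +i*
  (a * \int[mu3]_x Im (f x) + b * \int[mu3]_x Re (f x))).
rewrite -!RintegralZl// -RintegralB//; try exact: integrableZr'.
rewrite -RintegralD//; try exact: integrableZr'.
congr (_ +i* _); apply: eq_Rintegral => x _.
  by rewrite ReM.
by rewrite ImM.
Qed.

Lemma cintegral0 : cintegral (fun=> 0 : C) = 0 :> C.
Proof.
rewrite -[RHS](mul0r (cintegral (fun=> 0 : C))) -cintegralZ; last exact: cint0.
by congr cintegral; apply/funext => x; rewrite mul0r.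
Qed.

Lemma cintegral_sum (I : Type) (s : seq I) (f : I -> R3 -> C) :
  (forall i, cint (f i)) ->
  cintegral (fun x => \sum_(i <- s) f i x) = \sum_(i <- s) cintegral (f i).
Proof.
move=> H; elim: s => [|i s IH].
  by rewrite big_nil -[RHS]cintegral0; congr cintegral; apply/funext => x; rewrite big_nil.
rewrite big_cons -IH -cintegralD//; last exact: cint_sum.
by congr cintegral; apply/funext => x; rewrite big_cons.
Qed.

Lemma sqint0 : sqint (fun=> 0 : R).
Proof.
split; first exact: measurable_cst.
by rewrite /sqnorm; under eq_integral do rewrite expr0n/=; rewrite integral0.
Qed.

Lemma sqintD (a b : R3 -> R) : sqint a -> sqint b -> sqint (fun x => a x + b x).
Proof.
move=> sa sb.
have := sqintB sa (sqintB sqint0 sb).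
by congr sqint; apply/funext => x; rewrite sub0r opprK.
Qed.

Lemma sqintZ c (a : R3 -> R) : sqint a -> sqint (fun x => c * a x).
Proof.
move=> [ma a2]; split; first exact: measurable_funM.
rewrite /sqnorm; under eq_integral do rewrite exprMn EFinM.
rewrite ge0_integralZl//; last 3 first.
- exact: measurable_sqr.
- by move=> x _; rewrite lee_fin sqr_ge0.
- by rewrite lee_fin sqr_ge0.
by apply: lte_mul_pinfty => //; rewrite lee_fin sqr_ge0.
Qed.

Lemma cL2_mul f g : cL2 f -> cL2 g -> cint (fun x => f x * g x).
Proof.
move=> [f1 f2] [g1 g2]; split.
  under eq_fun do rewrite ReM -mulN1r.
  by apply: integrableDr; [|apply: integrableZr']; exact: sqint_mul.
under eq_fun do rewrite ImM.
by apply: integrableDr; exact: sqint_mul.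
Qed.

Lemma cL2D f g : cL2 f -> cL2 g -> cL2 (fun x => f x + g x).
Proof.
move=> [f1 f2] [g1 g2]; split.
  by under eq_fun do rewrite ReD; exact: sqintD.
by under eq_fun do rewrite ImD; exact: sqintD.
Qed.

Lemma cL2Z c f : cL2 f -> cL2 (fun x => c * f x).
Proof.
move=> [f1 f2]; split.
  under eq_fun do rewrite ReM -mulNr.
  by apply: sqintD; exact: sqintZ.
under eq_fun do rewrite ImM.
by apply: sqintD; exact: sqintZ.
Qed.

Lemma cL2_sum (I : Type) (s : seq I) (f : I -> R3 -> C) :
  (forall i, cL2 (f i)) -> cL2 (fun x => \sum_(i <- s) f i x).
Proof.
move=> H; elim: s => [|i s IH].
  by under eq_fun do rewrite big_nil; split; exact: sqint0.
by under eq_fun do rewrite big_cons; exact: cL2D.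
Qed.

Lemma cintegral_ae f g : cint f -> cint g -> (\forall x \ae leb3 R, f x = g x) ->
  cintegral f = cintegral g.
Proof.
move=> [f1 f2] [g1 g2] fg; rewrite !cintegralE; congr (_ +i* _); apply: (congr1 fine).
  apply: ae_eq_integral => //; [exact: measurable_int f1|exact: measurable_int g1|].
  by apply: filterS fg => x /= -> _.
apply: ae_eq_integral => //; [exact: measurable_int f2|exact: measurable_int g2|].
by apply: filterS fg => x /= -> _.
Qed.

(** Test functions are real-valued, so real and imaginary parts can be differentiated weakly on
    their own. *)
Definition cweakd j (a a' : R3 -> C) :=
  weakd j (fun x => Re (a x)) (fun x => Re (a' x)) /\
  weakd j (fun x => Im (a x)) (fun x => Im (a' x)).

Lemma cibp j a a' b b' : cweakd j a a' -> cweakd j b b' ->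
  cL2 a -> cL2 a' -> cL2 b -> cL2 b' ->
  cintegral (fun x => a' x * b x) = - cintegral (fun x => a x * b' x).
Proof.
move=> [wa1 wa2] [wb1 wb2] [a1 a2] [a1' a2'] [b1 b2] [b1' b2'].
rewrite !cintegralE -[RHS]/((- _) +i* (- _)); congr (_ +i* _).
  under eq_Rintegral do rewrite ReM.
  under [in RHS]eq_Rintegral do rewrite ReM.
  rewrite !RintegralB//; try exact: sqint_mul.
  by rewrite opprB -!/(ip _ _) (ibp wa1 wb1)// (ibp wa2 wb2)// opprK addrC.
under eq_Rintegral do rewrite ImM.
under [in RHS]eq_Rintegral do rewrite ImM.
rewrite !RintegralD//; try exact: sqint_mul.
by rewrite opprD -!/(ip _ _) (ibp wa1 wb2)// (ibp wa2 wb1).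
Qed.
End complex_integrals.

(** * Dirac matrices and the symmetry of their products with K *)

Section dirac_matrices.
Variable R : realType.
Local Notation C := R[i].

Definition jmx : 'M[C]_(2 + 2) := (- 'i) *: (gamma5 R *m alpha R 1).
Definition kmx : 'M[C]_(2 + 2) := (map_mx conjc jmx)^T.

(** This is i times the second Pauli matrix, which is [sigma R 1] since indices start at 0. Both
    [jmx] and [kmx] are block diagonal in it, so the relations reduce to blocks of size 2. *)
Definition eps2 : 'M[C]_(1 + 1) := block_mx 0 1%:M (- 1)%:M 0.

Lemma sigma0E : sigma R 0 = block_mx 0 1%:M 1%:M 0. Proof. by []. Qed.
Lemma sigma1E : sigma R 1 = block_mx 0 ((- 'i)%:M) ('i)%:M 0. Proof. by []. Qed.
Lemma sigma2E : sigma R 2%:R = block_mx 1%:M 0 0 ((- 1)%:M). Proof. by []. Qed.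

Lemma sqri : 'i * 'i = -1 :> C.
Proof. by rewrite -expr2 sqr_i. Qed.

Lemma sigma012 : sigma R 0 *m sigma R 1 *m sigma R 2%:R = ('i)%:M.
Proof.
rewrite sigma0E sigma1E sigma2E !mulmx_block.
rewrite !(mul0mx, mulmx0, mul1mx, addr0, add0r) -!scalar_mxM mulr1 mulrNN mulr1.
by rewrite -scalar_mx_block.
Qed.

Lemma offdiag_mul n (s t : 'M[C]_n) :
  block_mx 0 s s 0 *m block_mx 0 t t 0 = block_mx (s *m t) 0 0 (s *m t).
Proof. by rewrite mulmx_block !(mul0mx, mulmx0, addr0, add0r). Qed.

Lemma diag_offdiag_mul n (d t : 'M[C]_n) :
  block_mx d 0 0 d *m block_mx 0 t t 0 = block_mx 0 (d *m t) (d *m t) 0.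
Proof. by rewrite mulmx_block !(mul0mx, mulmx0, addr0, add0r). Qed.

Lemma sigma1_eps2 : 'i *: sigma R 1 = eps2.
Proof.
rewrite sigma1E /eps2 scale_block_mx !scaler0 !scale_scalar_mx mulrN sqri opprK.
by [].
Qed.

Lemma jmxE : jmx = block_mx (- eps2) 0 0 (- eps2).
Proof.
rewrite /jmx /gamma5 -scalemxAl scalerA mulrNN sqri.
have -> : alpha R 0 *m alpha R 1 *m alpha R 2%:R *m alpha R 1 =
  block_mx eps2 0 0 eps2; last by rewrite scaleN1r opp_block_mx !oppr0.
rewrite [alpha R 0 *m _](offdiag_mul (sigma R 0) (sigma R 1)).
rewrite [X in X *m _](diag_offdiag_mul (sigma R 0 *m sigma R 1) (sigma R 2%:R)).
rewrite sigma012 [LHS](offdiag_mul _ (sigma R 1)).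
by rewrite mul_scalar_mx sigma1_eps2.
Qed.

Lemma kmxE : kmx = block_mx eps2 0 0 eps2.
Proof.
rewrite /kmx jmxE map_block_mx tr_block_mx !map_mx0 !trmx0.
suff -> : (map_mx conjc (- eps2))^T = eps2 by [].
rewrite map_mxN /eps2 map_block_mx !map_mx0 !map_scalar_mx opp_block_mx tr_block_mx.
rewrite !oppr0 !trmx0 rmorphN1 rmorph1 !linearN /= !tr_scalar_mx.
by rewrite !raddfN /= opprK.
Qed.

Lemma eps2T : eps2^T = - eps2.
Proof.
rewrite /eps2 tr_block_mx !trmx0 !tr_scalar_mx opp_block_mx !oppr0.
by rewrite raddfN /= opprK.
Qed.

Lemma kmxT : kmx^T = - kmx.
Proof. by rewrite kmxE tr_block_mx !trmx0 opp_block_mx !oppr0 eps2T. Qed.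

(** Two sign patterns make H symmetric. The matrix K and its product with beta are antisymmetric, so
    terms without derivative cancel when the two spinors are exchanged. The products with the
    alpha_j are symmetric ([alpha_kmxT]), which offsets the sign produced by integration by
    parts. *)
Lemma beta_kmxT : ((beta R)^T *m kmx)^T = - ((beta R)^T *m kmx).
Proof.
rewrite kmxE /beta tr_block_mx !trmx0 mulmx_block !(mul0mx, mulmx0, addr0, add0r).
rewrite linearN /= !trmx1 mulNmx !mul1mx tr_block_mx !trmx0 opp_block_mx !oppr0.
by rewrite linearN /= eps2T.
Qed.

Lemma sigma_eps2T j : ((sigma R j)^T *m eps2)^T = (sigma R j)^T *m eps2.
Proof.
rewrite trmx_mul trmxK eps2T mulNmx.
have : j \in [:: 0; 1; 2%:R] by case: j => [[|[|[|]]]].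
rewrite !inE => /or3P[] /eqP ->.
- rewrite sigma0E /eps2 tr_block_mx !trmx0 !tr_scalar_mx !mulmx_block.
  rewrite !(mul0mx, mulmx0, mul1mx, mulmx1, addr0, add0r) opp_block_mx !oppr0.
  by rewrite raddfN /= opprK.
- rewrite sigma1E /eps2 tr_block_mx !trmx0 !tr_scalar_mx !mulmx_block.
  rewrite !(mul0mx, mulmx0, mul1mx, mulmx1, addr0, add0r) opp_block_mx !oppr0.
  by rewrite -!scalar_mxM !mulN1r !mulrN1 opprK -!(raddfN scalar_mx).
- rewrite sigma2E /eps2 tr_block_mx !trmx0 !tr_scalar_mx !mulmx_block.
  rewrite !(mul0mx, mulmx0, mul1mx, mulmx1, addr0, add0r) opp_block_mx !oppr0.
  by rewrite -!scalar_mxM mulrNN mulr1 !raddfN /= opprK.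
Qed.

Lemma offdiag_diag_sym n (s e : 'M[C]_n) : (s^T *m e)^T = s^T *m e ->
  ((block_mx 0 s s 0)^T *m block_mx e 0 0 e)^T = (block_mx 0 s s 0)^T *m block_mx e 0 0 e.
Proof.
move=> H; rewrite tr_block_mx !trmx0 mulmx_block !(mul0mx, mulmx0, addr0, add0r).
by rewrite tr_block_mx !trmx0 H.
Qed.

Lemma alpha_kmxT j : ((alpha R j)^T *m kmx)^T = (alpha R j)^T *m kmx.
Proof. by rewrite kmxE; exact: (offdiag_diag_sym (sigma_eps2T j)). Qed.
End dirac_matrices.

(** * Bilinear forms on square-integrable spinors *)

Section spinors.
Variable R : realType.
Local Notation C := R[i].
Local Notation R3 :=
  (measurableTypeR R * measurableTypeR R * measurableTypeR R)%type.
Local Notation spinor := (R3 -> 'cV[C]_(2 + 2)).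
Local Notation mu3 := (@mu3 R).
Local Notation Re := complex.Re.
Local Notation Im := complex.Im.

Definition sqn (u : spinor) : \bar R := (\int[mu3]_x ((vnorm (u x)) ^+ 2)%:E)%E.

Lemma vnorm_sq (v : 'cV[C]_(2 + 2)) :
  vnorm v ^+ 2 = \sum_i (Re (v i 0) ^+ 2 + Im (v i 0) ^+ 2).
Proof.
by rewrite sqr_sqrtr//; apply: sumr_ge0 => i _; rewrite addr_ge0// sqr_ge0.
Qed.

Lemma sqn_ge0 u : (0 <= sqn u)%E.
Proof. by apply: integral_ge0 => x _; rewrite lee_fin sqr_ge0. Qed.

Lemma L2norm_sqn (u : spinor) : L2norm u = (sqn u `^ 2^-1)%E.
Proof.
rewrite /L2norm Lnorm.unlock /sqn; congr (_ `^ _)%E.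
apply: eq_integral => x _; rewrite -[`|_|%E]/(`|vnorm (u x)|%:E) poweR_EFin.
by rewrite powR_mulrn// real_normK// num_real.
Qed.

Lemma sqn_L2norm (u : spinor) : sqn u = (L2norm u * L2norm u)%E.
Proof.
have half : 2^-1 + 2^-1 = 1 :> R by field.
rewrite L2norm_sqn -poweRD; last by apply: add_neq0_poweRD_def; rewrite half oner_neq0.
by rewrite half poweRe1// sqn_ge0.
Qed.

Lemma L2norm_lty (u : spinor) : (L2norm u < +oo)%E <-> (sqn u < +oo)%E.
Proof.
split; last by rewrite L2norm_sqn; exact: poweR_lty.
by rewrite sqn_L2norm => u2; apply: lte_mul_pinfty => //;
  rewrite ?ge0_fin_numE// /L2norm Lnorm_ge0.
Qed.

Lemma measurable_vnorm_sq (u : spinor) : L2 u ->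
  measurable_fun setT (fun x : R3 => (vnorm (u x) ^+ 2)%:E).
Proof.
move=> [mu _]; apply/measurable_EFinP; under eq_fun do rewrite vnorm_sq.
apply: measurable_sum => k; have [? ?] := mu k.
by apply: measurable_funD; exact: measurable_funX.
Qed.

Lemma L2P (u : spinor) : L2 u <-> forall i, cL2 (fun x => u x i 0).
Proof.
split.
  move=> Lu i; have mU := measurable_vnorm_sq Lu.
  have [mu /L2norm_lty u2] := Lu; have [m1 m2] := mu i.
  split; split => //; apply: le_lt_trans u2; apply: ge0_le_integral;
    [exact: measurableT|by move=> x _; rewrite lee_fin sqr_ge0|exact: measurable_sqr|exact: mU| |
     exact: measurableT|by move=> x _; rewrite lee_fin sqr_ge0|exact: measurable_sqr|exact: mU| ].
    move=> x _; rewrite lee_fin vnorm_sq (bigD1 i)//= -addrA lerDl addr_ge0 ?sqr_ge0//.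
    by apply: sumr_ge0 => k _; rewrite addr_ge0// sqr_ge0.
  move=> x _; rewrite lee_fin vnorm_sq (bigD1 i)//= addrAC lerDr addr_ge0 ?sqr_ge0//.
  by apply: sumr_ge0 => k _; rewrite addr_ge0// sqr_ge0.
move=> H; split.
  by move=> i; have [[? _] [? _]] := H i.
apply/L2norm_lty; rewrite /sqn; under eq_integral do rewrite vnorm_sq -sumEFin.
rewrite ge0_integral_sum//; first last.
- by move=> i x _; rewrite lee_fin addr_ge0// sqr_ge0.
- move=> i; have [[? _] [? _]] := H i.
  by apply/measurable_EFinP; apply: measurable_funD; exact: measurable_funX.
apply: lte_sum_pinfty => i _; have [[m1 h1] [m2 h2]] := H i.
under eq_integral do rewrite EFinD.
rewrite ge0_integralD//; try exact: measurable_sqr;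
  try (by move=> x _; rewrite lee_fin sqr_ge0).
exact: lte_add_pinfty.
Qed.

Lemma L2D (u v : spinor) : L2 u -> L2 v -> L2 (u + v).
Proof.
move=> /L2P Hu /L2P Hv; apply/L2P => i.
have := cL2D (Hu i) (Hv i); congr cL2; apply/funext => x.
by rewrite mxE.
Qed.

Lemma L2Z c (u : spinor) : L2 u -> L2 (c *: u).
Proof.
move=> /L2P Hu; apply/L2P => i.
have := cL2Z c (Hu i); congr cL2; apply/funext => x.
by rewrite mxE.
Qed.

Definition qf (N : 'M[C]_(2 + 2)) (a b : 'cV[C]_(2 + 2)) : C := (a^T *m N *m b) 0 0.

Lemma qfE N a b : qf N a b = \sum_k \sum_i N i k * (a i 0 * b k 0).
Proof.
rewrite /qf mxE; apply: eq_bigr => k _; rewrite mxE big_distrl/=.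
by apply: eq_bigr => i _; rewrite mxE; ring.
Qed.

Lemma qf_tr N a b : qf N a b = qf N^T b a.
Proof.
rewrite /qf -[in LHS](trmxK (a^T *m N *m b)) [in LHS]mxE !trmx_mul trmxK.
by rewrite mulmxA.
Qed.

Lemma qfDl N a a' b : qf N (a + a') b = qf N a b + qf N a' b.
Proof. by rewrite /qf linearD /= !mulmxDl mxE. Qed.
Lemma qfDr N a b b' : qf N a (b + b') = qf N a b + qf N a b'.
Proof. by rewrite /qf mulmxDr mxE. Qed.
Lemma qfZl N c a b : qf N (c *: a) b = c * qf N a b.
Proof. by rewrite /qf linearZ /= -!scalemxAl mxE. Qed.
Lemma qfZr N c a b : qf N a (c *: b) = c * qf N a b.
Proof. by rewrite /qf -scalemxAr mxE. Qed.
Lemma qfMl N M a b : qf N (M *m a) b = qf (M^T *m N) a b.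
Proof. by rewrite /qf trmx_mul !mulmxA. Qed.
Lemma qfNm N a b : qf (- N) a b = - qf N a b.
Proof. by rewrite /qf mulmxN mulNmx mxE. Qed.
Lemma qf_suml (I : finType) N (F : I -> 'cV[C]_(2 + 2)) b :
  qf N (\sum_j F j) b = \sum_j qf N (F j) b.
Proof. by rewrite /qf linear_sum /= !mulmx_suml summxE. Qed.

Lemma qf_cint N (u v : spinor) : L2 u -> L2 v -> cint (fun x => qf N (u x) (v x)).
Proof.
move=> /L2P Hu /L2P Hv; under eq_fun do rewrite qfE.
apply: cint_sum => k; apply: cint_sum => i; apply: cintZ.
exact: cL2_mul.
Qed.

Definition BM N (u v : spinor) : C := cintegral (fun x => qf N (u x) (v x)).

Lemma BM_E N (u v : spinor) : L2 u -> L2 v ->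
  BM N u v = \sum_k \sum_i N i k * cintegral (fun x => u x i 0 * v x k 0).
Proof.
move=> /L2P Hu /L2P Hv; rewrite /BM.
rewrite (_ : (fun x => _) = (fun x => \sum_k \sum_i N i k * (u x i 0 * v x k 0))); last first.
  by apply/funext => x; rewrite qfE.
have H i k : cint (fun x => u x i 0 * v x k 0) by exact: cL2_mul.
rewrite cintegral_sum; last by move=> k; apply: cint_sum => i; exact: cintZ.
apply: eq_bigr => k _; rewrite cintegral_sum; last by move=> i; exact: cintZ.
by apply: eq_bigr => i _; rewrite cintegralZ.
Qed.

Lemma is_weak_partial_cweakd j (u g : spinor) i : is_weak_partial j u g ->
  cweakd j (fun x => u x i 0) (fun x => g x i 0).
Proof.
move=> ug; split=> phi tphi.
  have := congr1 (@complex.Re R) (ug phi tphi i); rewrite !cintegralE.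
  rewrite -[X in _ = X -> _]/(- (\int[mu3]_x Re (g x i 0 * (phi x)%:C))) /=.
  under eq_Rintegral do rewrite ReM /= mulr0 subr0.
  by under [in X in _ = X -> _]eq_Rintegral do rewrite ReM /= mulr0 subr0.
have := congr1 (@complex.Im R) (ug phi tphi i); rewrite !cintegralE.
rewrite -[X in _ = X -> _]/(- (\int[mu3]_x Im (g x i 0 * (phi x)%:C))) /=.
under eq_Rintegral do rewrite ImM /= mulr0 add0r.
by under [in X in _ = X -> _]eq_Rintegral do rewrite ImM /= mulr0 add0r.
Qed.

Lemma weak_partialP j (u : spinor) : H1 u -> L2 (weak_partial j u) /\ is_weak_partial j u (weak_partial j u).
Proof.
move=> [_ /(_ j) [g Lg ug]].
by have := @xgetPex _ 0 [set g : spinor | L2 g /\ is_weak_partial j u g] (ex_intro _ g (conj Lg ug)).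
Qed.

(** Integration by parts applies entry by entry; the symmetry of [N] matches the entry (i, k) of one
    form with the entry (k, i) of the other. *)
Lemma BM_ibp N j (u v : spinor) : N^T = N -> H1 u -> H1 v ->
  BM N (weak_partial j v) u + BM N (weak_partial j u) v = 0.
Proof.
move=> NT Hu Hv.
have [Lu' wu] := weak_partialP j Hu; have [Lv' wv] := weak_partialP j Hv.
have Lu : L2 u by case: Hu. have Lv : L2 v by case: Hv.
rewrite !BM_E// [X in _ + X]exchange_big /= -big_split /=.
apply: big1 => k _; rewrite -big_split /=; apply: big1 => i _.
move/L2P in Lu; move/L2P in Lv; move/L2P in Lu'; move/L2P in Lv'.
rewrite (cibp (is_weak_partial_cweakd i wv) (is_weak_partial_cweakd k wu))//.
have -> : N k i = N i k by rewrite -[in LHS]NT mxE.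
rewrite mulrN; apply/eqP; rewrite addrC subr_eq0; apply/eqP; congr (_ * _).
by congr cintegral; apply/funext => x; rewrite mulrC.
Qed.
End spinors.

(** * Antisymmetry of the resolvent *)

Section resolvent.
Variable R : realType.
Local Notation C := R[i].
Local Notation R3 :=
  (measurableTypeR R * measurableTypeR R * measurableTypeR R)%type.
Local Notation spinor := (R3 -> 'cV[C]_(2 + 2)).
Local Notation K := (kmx R).

Lemma time_reversalE (psi : spinor) x :
  time_reversal psi x = jmx R *m map_mx conjc (psi x).
Proof. by rewrite /time_reversal /jmx scalemxAl. Qed.

Variable V : R3 -> 'M[C]_(2 + 2).
Hypothesis hTV : forall psi : spinor, L2 psi ->
  time_reversal (mulop V psi) = mulop (adjoint V) (time_reversal psi) %[ae leb3 R].

(* [TV = V^* T] says that [V] is symmetric for the form [qf K]. *)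
Lemma qf_mulop (psi : spinor) : L2 psi ->
  \forall x \ae leb3 R, forall w, qf K (V x *m psi x) w = qf K (psi x) (V x *m w).
Proof.
move=> Lpsi; have := hTV Lpsi; apply: filterS => x /= /(_ I).
rewrite /mulop !time_reversalE /adjoint => H w.
(* Conjugate transposition turns [jmx] into [kmx] and undoes the conjugations of [psi] and [V],
   which leaves a relation linear in [psi]. *)
have := congr1 (fun M => (map_mx conjc M)^T) H.
rewrite !map_mxM /= !trmx_mul -!map_mx_comp.
have cc (m n : nat) (M : 'M[C]_(m, n)) : map_mx (conjc \o conjc) M = M.
  by apply/matrixP => a b; rewrite mxE /= conjcK.
have VT : (map_mx conjc ((map_mx conjc (V x))^T))^T = V x.
  by apply/matrixP => a b; rewrite !mxE conjcK.
rewrite !cc VT => E.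
have {}E : (V x *m psi x)^T *m K = (psi x)^T *m K *m V x.
  by rewrite trmx_mul; exact: E.
by rewrite /qf E !mulmxA.
Qed.

Lemma qf_antisym N (a b : 'cV[C]_(2 + 2)) : N^T = - N -> qf N a b = - qf N b a.
Proof. by move=> NT; rewrite qf_tr NT qfNm. Qed.

(** The pointwise part of the symmetry of H - z, with [W] standing for V(x): the terms in beta, [W]
    and [z] cancel by antisymmetry, and only derivatives are left. *)
Lemma qf_dirac (W : 'M[C]_(2 + 2)) z (a b : 'cV[C]_(2 + 2)) (da db : 'I_3 -> 'cV[C]_(2 + 2)) :
  qf K (W *m b) a = qf K b (W *m a) ->
  qf K (beta R *m b + - 'i *: \sum_j (alpha R j *m db j) + W *m b + - z *: b) a +
  qf K (beta R *m a + - 'i *: \sum_j (alpha R j *m da j) + W *m a + - z *: a) b =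
  - 'i * \sum_j (qf ((alpha R j)^T *m K) (db j) a + qf ((alpha R j)^T *m K) (da j) b).
Proof.
move=> HW; rewrite !qfDl !qfZl HW !qf_suml.
rewrite [qf K (beta R *m b) a]qfMl [qf K (beta R *m a) b]qfMl.
rewrite (qf_antisym b a (beta_kmxT R)) (qf_antisym b a (kmxT R)).
rewrite (qf_antisym b (W *m a) (kmxT R)) big_split /=.
under eq_bigr do rewrite qfMl.
under [in X in _ + (_ + X + _ + _) = _]eq_bigr do rewrite qfMl.
ring.
Qed.

(** With u = S g and v = S f, write f = (H - z) v and g = (H - z) u. By [qf_dirac] the sum of the
    two forms consists of derivative terms, which [BM_ibp] integrates to zero. *)
Lemma resolvent_antisym z S f g : is_resolvent V z S -> L2 f -> L2 g ->
  BM K f (S g) = - BM K g (S f).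
Proof.
move=> [_ HS _] Lf Lg.
have [Hu Eu] := HS g Lg; have [Hv Ev] := HS f Lf.
set u := S g in Hu Eu *; set v := S f in Hv Ev *.
have Lu : L2 u by case: Hu. have Lv : L2 v by case: Hv.
apply/eqP; rewrite -addr_eq0; apply/eqP.
rewrite /BM -cintegralD; [|exact: qf_cint..].
pose G j x := qf ((alpha R j)^T *m K) (weak_partial j v x) (u x) +
              qf ((alpha R j)^T *m K) (weak_partial j u x) (v x).
have cG j : cint (G j).
  have [Lu' _] := weak_partialP j Hu; have [Lv' _] := weak_partialP j Hv.
  by apply: cintD; exact: qf_cint.
rewrite (@cintegral_ae _ _ (fun x => (- 'i) * \sum_j G j x)); first last.
- have Vuv : \forall x \ae leb3 R, (forall w, qf K (V x *m v x) w = qf K (v x) (V x *m w)).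
    exact: qf_mulop.
  move: Eu Ev Vuv; apply: filterS3 => x /(_ I) Eu /(_ I) Ev Vv.
  have DE (w : spinor) : (DiracV V w - z *: w) x =
      beta R *m w x + - 'i *: \sum_j (alpha R j *m weak_partial j w x)
      + V x *m w x + - z *: w x.
    by rewrite !scaleNr.
  by rewrite -Eu -Ev !DE; apply: qf_dirac.
- by apply: cintZ; exact: cint_sum.
- by apply: cintD; exact: qf_cint.
rewrite cintegralZ; last exact: cint_sum.
rewrite cintegral_sum// big1 ?mulr0// => j _.
have [Lu' _] := weak_partialP j Hu; have [Lv' _] := weak_partialP j Hv.
rewrite /G cintegralD; [|exact: qf_cint..].
exact: (BM_ibp j (alpha_kmxT R j) Hu Hv).
Qed.
End resolvent.

(** * Scalar Laurent series *)

Section modulus.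
Variable R : realType.
Local Notation C := R[i].

(** The norm on [R[i]] takes its values in [R[i]]; this is the modulus as a real number. *)
Definition nC (z : C) : R := complex.Re `|z|.

Lemma nCE (z : C) : `|z| = (nC z)%:C.
Proof. by rewrite /nC normc_def. Qed.

Lemma nC_lt (z : C) (r : R) : (`|z| < r%:C) = (nC z < r).
Proof. by rewrite nCE ltcR. Qed.

Lemma nC_ge0 (z : C) : 0 <= nC z.
Proof. by rewrite -lecR -nCE normr_ge0. Qed.

Lemma nCM (x y : C) : nC (x * y) = nC x * nC y.
Proof. by apply: complexI; rewrite -nCE normrM rmorphM /= !nCE. Qed.

Lemma nCD (x y : C) : nC (x + y) <= nC x + nC y.
Proof. by rewrite -lecR rmorphD /= -!nCE ler_normD. Qed.

Lemma nCN (x : C) : nC (- x) = nC x.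
Proof. by rewrite /nC normrN. Qed.

Lemma nC0 : nC 0 = 0. Proof. by rewrite /nC normr0. Qed.
Lemma nC1 : nC 1 = 1. Proof. by rewrite /nC normr1. Qed.

Lemma nC_eq0 (x : C) : (nC x == 0) = (x == 0).
Proof. by rewrite -(inj_eq (@complexI R)) -nCE normr_eq0. Qed.

Lemma nC_gt0 (x : C) : (0 < nC x) = (x != 0).
Proof. by rewrite lt_def nC_eq0 nC_ge0 andbT. Qed.

Lemma nCX (x : C) n : nC (x ^+ n) = nC x ^+ n.
Proof. by elim: n => [|n IH]; rewrite ?expr0 ?nC1// !exprS nCM IH. Qed.

Lemma nCV (x : C) : nC x^-1 = (nC x)^-1.
Proof.
have [->|x0] := eqVneq x 0; first by rewrite invr0 nC0 invr0.
have nx0 : nC x != 0 by rewrite nC_eq0.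
by apply: (mulfI nx0); rewrite -nCM !mulfV ?nC1.
Qed.

Lemma nCB (x y : C) : nC x - nC y <= nC (x - y).
Proof. by rewrite lerBlDr; apply: le_trans (nCD _ _); rewrite subrK. Qed.

Lemma nC_sum (I : Type) (s : seq I) (f : I -> C) :
  nC (\sum_(i <- s) f i) <= \sum_(i <- s) nC (f i).
Proof.
elim: s => [|i s IH]; first by rewrite !big_nil nC0.
by rewrite !big_cons; apply: le_trans (nCD _ _) _; rewrite lerD2l.
Qed.

Lemma nC_sum_nat (m n : nat) (f : nat -> C) :
  nC (\sum_(m <= i < n) f i) <= \sum_(m <= i < n) nC (f i).
Proof. exact: nC_sum. Qed.

Lemma nC_le_ReIm (z : C) : nC z <= `|complex.Re z| + `|complex.Im z|.
Proof.
have E : z = (complex.Re z)%:C + 'i * (complex.Im z)%:C by exact: complexE.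
rewrite {1}E; apply: le_trans (nCD _ _) _; rewrite nCM.
have nr (r : R) : nC (r%:C) = `|r|.
  by rewrite /nC normc_def /= expr0n /= addr0 sqrtr_sqr.
by rewrite !nr /nC normc_def /= expr0n expr1n /= add0r sqrtr1 mul1r.
Qed.

Definition cvgC (u : nat -> C) (l : C) := forall e : R, 0 < e ->
  exists N, forall n, (N <= n)%N -> nC (l - u n) < e.

Lemma cvgC_terms (a : nat -> C) (l : C) : cvgC (fun K => \sum_(k < K) a k) l ->
  exists M, forall k, nC (a k) <= M.
Proof.
move=> /(_ 1 ltr01)[N HN]; exists (2 + \sum_(k < N) nC (a k)) => k.
have [Nk|kN] := leqP N k.
  have -> : a k = (l - \sum_(i < k) a i) - (l - \sum_(i < k.+1) a i).
    by rewrite big_ord_recr /=; ring.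
  apply: le_trans (nCD _ _) _; rewrite nCN.
  have h1 := HN k Nk; have h2 := HN k.+1 (leqW Nk).
  have h3 : 0 <= \sum_(k < N) nC (a k) by apply: sumr_ge0 => i _; exact: nC_ge0.
  lra.
rewrite (bigD1 (Ordinal kN)) //= addrCA lerDl addr_ge0// sumr_ge0// => i _.
exact: nC_ge0.
Qed.

Lemma geo_tail (q : R) m n : 0 <= q -> q <= 1 / 2 ->
  \sum_(m <= i < n) q ^+ i <= 2 * q ^+ m.
Proof.
move=> q0 q2; have H d : \sum_(m <= i < m + d) q ^+ i <= 2 * q ^+ m - 2 * q ^+ (m + d).
  elim: d => [|d IH].
    by rewrite addn0 big_geq// subrr.
  rewrite addnS big_nat_recr ?leq_addr//=.
  have := exprn_ge0 (m + d) q0; rewrite exprS; set x := q ^+ (m + d) in IH *; nra.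
have [mn|nm] := leqP m n.
  rewrite -(subnKC mn); apply: le_trans (H _) _.
  by rewrite gerBl mulr_ge0// exprn_ge0.
by rewrite big_geq ?(ltnW nm)// mulr_ge0// exprn_ge0.
Qed.

Lemma series_tail (c : nat -> C) (rho M : R) (t : C) m n : 0 < rho ->
  (forall k, nC (c k) * rho ^+ k <= M) -> nC t <= rho / 2 ->
  nC (\sum_(m <= k < n) c k * t ^+ k) <= 2 * M * (nC t / rho) ^+ m.
Proof.
move=> rho0 HM tr; apply: le_trans (nC_sum_nat _ _ _) _.
have M0 : 0 <= M by apply: le_trans (HM 0%N); rewrite expr0 mulr1 nC_ge0.
apply: (@le_trans _ _ (\sum_(m <= k < n) M * (nC t / rho) ^+ k)).
  apply: ler_sum => k _; rewrite nCM nCX expr_div_n.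
  have h : nC (c k) <= M / rho ^+ k by rewrite ler_pdivlMr ?exprn_gt0.
  apply: le_trans (ler_wpM2r (exprn_ge0 k (nC_ge0 t)) h) _.
  by rewrite mulrAC mulrA.
rewrite -mulr_sumr [2 * M]mulrC -mulrA ler_wpM2l// geo_tail//.
  by rewrite divr_ge0 ?nC_ge0// ltW.
by rewrite ler_pdivrMr//; lra.
Qed.

(** At the first nonzero coefficient, of index k < N, the sum behaves like c_k t^k, which is too
    large for the bound D |t|^N as t tends to 0. Only points of [T] enter: the case D = 0 applies to
    accumulating zeros, and a general D to removable singularities. *)
Lemma series_coef_eq0 (I : Type) (T : set I) (c : nat -> C) (tt phi : I -> C) (rho M D : R) N :
  0 < rho -> (forall k, nC (c k) * rho ^+ k <= M) ->
  (forall s, T s -> cvgC (fun K => \sum_(k < K) c k * tt s ^+ k) (phi s)) ->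
  (forall s, T s -> nC (phi s) <= D * nC (tt s) ^+ N) -> 0 <= D ->
  (forall d, 0 < d -> exists s, [/\ T s, 0 < nC (tt s) & nC (tt s) < d]) ->
  forall k, (k < N)%N -> c k = 0.
Proof.
move=> rho0 HM Hphi HD D0 HT k; elim/ltn_ind: k => k IH kN.
have M0 : 0 <= M by apply: le_trans (HM 0%N); rewrite expr0 mulr1 nC_ge0.
apply/eqP; rewrite -nC_eq0; apply/negPn/negP => ck0.
have {}ck0 : 0 < nC (c k) by rewrite lt_def ck0 nC_ge0.
(* Divided by |t|^k, the estimate below reads |c_k| <= |t| (B - 1), which fails once |t| < |c_k| /
   B. *)
pose B := D + 2 * M / rho ^+ k.+1 + 1.
have B0 : 0 < B.
  by rewrite /B ltr_wpDl// addr_ge0// divr_ge0 ?mulr_ge0// exprn_ge0// ltW.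
pose d := Num.min (Num.min 1 (rho / 2)) (nC (c k) / B).
have d0 : 0 < d by rewrite !lt_min ltr01 !divr_gt0.
have [s [Ts]] := HT d d0; set t := tt s => t0; rewrite !lt_min => /andP[/andP[t1 tr] tB].
have key : nC (c k * t ^+ k) <= D * nC t ^+ N + 2 * M * (nC t / rho) ^+ k.+1.
  rewrite -lerBlDr; apply/ler_addgt0Pr => e e0.
  have [K0 HK0] := Hphi s Ts e e0.
  pose K := maxn K0 k.+1.
  have {}HK0 := HK0 K (leq_maxl _ _).
  have kK : (k < K)%N by exact: leq_maxr.
  have E : \sum_(i < K) c i * t ^+ i = c k * t ^+ k + \sum_(k.+1 <= i < K) c i * t ^+ i.
    rewrite -(big_mkord xpredT (fun i => c i * t ^+ i)) (big_cat_nat _ (n := k))//=; last exact: ltnW.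
    rewrite big_nat_cond big1 ?add0r; last first.
      by move=> i /andP[/andP[_ ik] _]; rewrite IH ?mul0r// (ltn_trans ik).
    by rewrite big_ltn.
  have tail := @series_tail c rho M t k.+1 K rho0 HM (ltW tr).
  have : nC (c k * t ^+ k) <= nC (phi s) + e + 2 * M * (nC t / rho) ^+ k.+1.
    have -> : c k * t ^+ k = phi s - (phi s - \sum_(i < K) c i * t ^+ i)
              - \sum_(k.+1 <= i < K) c i * t ^+ i by rewrite -/t E; ring.
    apply: le_trans (nCD _ _) _; rewrite nCN; apply: lerD => //.
    by apply: le_trans (nCD _ _) _; rewrite nCN; apply: lerD => //; exact: ltW.
  have := HD s Ts; rewrite -/t; lra.
have tk : 0 < nC t ^+ k by rewrite exprn_gt0.
have : nC (c k) <= nC t * (B - 1).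
  rewrite -(ler_pM2r tk) -nCX -nCM; apply: le_trans key _.
  rewrite expr_div_n nCX.
  have -> : nC t * (B - 1) * nC t ^+ k = D * nC t ^+ k.+1 + 2 * M * (nC t ^+ k.+1 / rho ^+ k.+1).
    by rewrite /B addrK mulrDl mulrDr !exprS; ring.
  rewrite lerD2r ler_wpM2l//.
  by apply: ler_wiXn2l => //; [exact: nC_ge0|exact: ltW].
apply/negP; rewrite -ltNge.
rewrite ltr_pdivlMr// in tB; apply: le_lt_trans tB; rewrite ler_wpM2l ?nC_ge0//.
by rewrite gerBl.
Qed.

Lemma series_bound (c : nat -> C) (l : C) (rho M : R) (t : C) : 0 < rho ->
  (forall k, nC (c k) * rho ^+ k <= M) -> nC t <= rho / 2 ->
  cvgC (fun K => \sum_(k < K) c k * t ^+ k) l -> nC l <= 2 * M.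
Proof.
move=> rho0 HM tr Hl; apply/ler_addgt0Pr => e e0.
have [K HK] := Hl e e0; have {}HK := HK K (leqnn K).
have := @series_tail c rho M t 0 K rho0 HM tr; rewrite expr0 mulr1 big_mkord => h.
have -> : l = (l - \sum_(k < K) c k * t ^+ k) + \sum_(k < K) c k * t ^+ k by ring.
by apply: le_trans (nCD _ _) _; rewrite addrC; apply: lerD => //; exact: ltW.
Qed.
End modulus.

(** * Pairing with operators from L^2_comp to H^1_loc *)

Section pairing.
Variable R : realType.
Local Notation C := R[i].
Local Notation R3 :=
  (measurableTypeR R * measurableTypeR R * measurableTypeR R)%type.
Local Notation spinor := (R3 -> 'cV[C]_(2 + 2)).
Local Notation operator := (spinor -> spinor).
Local Notation Re := complex.Re.
Local Notation Im := complex.Im.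

(** The factor exp(6) compensates the lower bound of [bump_ge]. It suffices that the cutoff be at
    least 1 on the ball, since truncation divides it out. *)
Definition chi (rho : R) (x : R3) : R := expR 6 * bump (rho + 1) x.

Lemma test_chi rho : test_function (chi rho).
Proof.
apply: (test_function_smooth (r := rho + 1)).
  by apply: smooth_mul; [exact: smooth_cst|exact: smooth_bump].
by move=> x /ltW xr; rewrite /chi bump_eq0 ?mulr0.
Qed.

Lemma chi_ge1 rho (x : R3) : `|x| <= rho -> 1 <= chi rho x.
Proof.
move=> xr; have : expR (- 6) <= bump (rho + 1) x by apply: bump_ge; rewrite addrK.
by rewrite expRN -[X in X <= _]mul1r ler_pdivrMr ?expR_gt0// mulrC.
Qed.

Lemma measurable_chi rho : measurable_fun setT (chi rho).
Proof.
by apply: smooth_measurable; apply: smooth_mul; [exact: smooth_cst|exact: smooth_bump].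
Qed.

Lemma cutoff_contract (m : R3 -> R) (u : spinor) : measurable_fun setT m ->
  (forall x, `|m x| <= 1) -> L2 u -> L2 (cutoff m u) /\ (sqn (cutoff m u) <= sqn u)%E.
Proof.
move=> mm m1 Lu; have Hu := (L2P u).1 Lu.
have m2 x : m x ^+ 2 <= 1.
  by rewrite -[m x ^+ 2]real_normK ?num_real// expr_le1.
have sq (a : R3 -> R) : sqint a -> sqint (fun x => m x * a x).
  move=> [ma a2]; have mma : measurable_fun setT (fun x => m x * a x) by exact: measurable_funM.
  split => //; apply: le_lt_trans a2; apply: ge0_le_integral;
    [exact: measurableT|by move=> x _; rewrite lee_fin sqr_ge0|exact: measurable_sqr|exact: measurable_sqr|].
  by move=> x _; rewrite lee_fin exprMn ler_piMl ?sqr_ge0.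
have Lc : L2 (cutoff m u).
  apply/L2P => i; have [h1 h2] := Hu i; split.
    by have := sq _ h1; congr sqint; apply/funext => x; rewrite /cutoff mxE ReM /= mul0r subr0.
  by have := sq _ h2; congr sqint; apply/funext => x; rewrite /cutoff mxE ImM /= mul0r addr0.
split => //.
apply: ge0_le_integral; [exact: measurableT|by move=> x _; rewrite lee_fin sqr_ge0|
  exact: measurable_vnorm_sq|exact: measurable_vnorm_sq|].
move=> x _; rewrite lee_fin !vnorm_sq; apply: ler_sum => i _.
rewrite /cutoff mxE ReM ImM /= !mul0r subr0 addr0 !exprMn -mulrDr.
by rewrite ler_piMl// addr_ge0// sqr_ge0.
Qed.

Definition trunc (rho : R) (h : spinor) : spinor := cutoff (\1_(box rho)) h.

(** Dividing by [chi] on the box, where it is at least 1, makes the sharp truncation a contraction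
    applied to a smooth cutoff. The seminorms [opnorm], which only see smooth cutoffs, therefore
    control it. *)
Lemma trunc_chi rho h : trunc rho h = cutoff (fun x => \1_(box rho) x / chi rho x) (cutoff (chi rho) h).
Proof.
apply/funext => x; rewrite /trunc /cutoff scalerA -rmorphM /=.
rewrite indicE; case: (boolP (x \in box rho)) => [|_]; last by rewrite !mul0r.
rewrite inE => /boxP /chi_ge1 h1; rewrite divfK// gt_eqF//.
exact: lt_le_trans h1.
Qed.

Lemma trunc_L2 rho h : L2 (cutoff (chi rho) h) ->
  L2 (trunc rho h) /\ (sqn (trunc rho h) <= sqn (cutoff (chi rho) h))%E.
Proof.
move=> Lh; rewrite trunc_chi; apply: cutoff_contract => //.
  apply: measurable_funM; first by apply: measurable_indic; exact: measurable_box.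
  have -> : (fun x => (chi rho x)^-1) = (fun x => chi rho x `^ (-1)).
    by apply/funext => x; rewrite powR_inv1// /chi mulr_ge0 ?expR_ge0 ?bump_ge0.
  exact: (measurableT_comp (measurable_powR (-1)) (measurable_chi rho)).
move=> x; rewrite indicE; case: (boolP (x \in box rho)) => [|_]; last by rewrite mul0r normr0.
rewrite inE => /boxP /chi_ge1 h1; rewrite mul1r normfV invf_le1 ?normr_gt0 ?gt_eqF//.
  exact: le_trans (ler_norm _).
exact: lt_le_trans h1.
Qed.

Lemma H1loc_trunc rho h : H1loc h -> L2 (trunc rho h).
Proof.
by move=> /(_ (chi rho) (test_chi rho)) [L _]; have [] := trunc_L2 L.
Qed.

Lemma L2norm_le_H1norm (u : spinor) : (L2norm u <= H1norm u)%E.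
Proof.
have sq0 (v : spinor) : (0 <= L2norm v ^+ 2)%E by rewrite expe2 mule_ge0// /L2norm Lnorm_ge0.
have -> : L2norm u = ((L2norm u ^+ 2) `^ 2^-1)%E.
  by rewrite expe2 -sqn_L2norm -L2norm_sqn.
have S0 : (0 <= \sum_(j < 3) L2norm (weak_partial j u) ^+ 2)%E by rewrite sume_ge0.
rewrite /H1norm; apply: gt0_ler_poweR; rewrite ?invr_ge0//.
- by rewrite in_itv/= leey andbT; exact: sq0.
- by rewrite in_itv/= leey andbT; apply: adde_ge0 => //; exact: sq0.
by rewrite leeDl.
Qed.

Lemma opnorm_bound (rho r : R) (A : operator) g : L2 g -> supported_in_ball r g ->
  (L2norm g <= 1)%E -> (L2norm (cutoff (chi rho) (A g)) <= opnorm (chi rho) r A)%E.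
Proof.
move=> Lg sg g1; apply: le_trans (L2norm_le_H1norm _) _.
by apply: ereal_sup_ubound; exists g.
Qed.

Definition qn (u : spinor) : R := fine (sqn u).

Lemma qnE (u : spinor) : L2 u -> sqn u = (qn u)%:E.
Proof.
by move=> [_ /L2norm_lty u2]; rewrite /qn fineK// ge0_fin_numE ?sqn_ge0.
Qed.

Lemma qn_ge0 u : 0 <= qn u. Proof. by rewrite fine_ge0// sqn_ge0. Qed.

Lemma sqnorm_le_sqn (u : spinor) i : L2 u ->
  (sqnorm (fun x => Re (u x i 0%R)) <= sqn u)%E /\ (sqnorm (fun x => Im (u x i 0%R)) <= sqn u)%E.
Proof.
move=> Lu; have [[m1 _] [m2 _]] := (L2P u).1 Lu i.
have mU := measurable_vnorm_sq Lu.
split; apply: ge0_le_integral;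
    [exact: measurableT|by move=> x _; rewrite lee_fin sqr_ge0|exact: measurable_sqr|exact: mU| |
     exact: measurableT|by move=> x _; rewrite lee_fin sqr_ge0|exact: measurable_sqr|exact: mU| ].
  move=> x _; rewrite lee_fin vnorm_sq (bigD1 i)//= -addrA lerDl addr_ge0 ?sqr_ge0//.
  by apply: sumr_ge0 => k _; rewrite addr_ge0// sqr_ge0.
move=> x _; rewrite lee_fin vnorm_sq (bigD1 i)//= addrAC lerDr addr_ge0 ?sqr_ge0//.
by apply: sumr_ge0 => k _; rewrite addr_ge0// sqr_ge0.
Qed.

Lemma cintegral_mul_le (f h : spinor) i k (l : R) : L2 f -> L2 h -> 0 < l ->
  nC (cintegral (fun x => f x i 0 * h x k 0)) <= 4 * (l * qn f + l^-1 * qn h).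
Proof.
move=> Lf Lh l0; have [f1 f2] := (L2P f).1 Lf i; have [h1 h2] := (L2P h).1 Lh k.
have [nf1 nf2] := sqnorm_le_sqn i Lf; have [nh1 nh2] := sqnorm_le_sqn k Lh.
have B (a b : R3 -> R) : sqint a -> sqint b -> (sqnorm a <= sqn f)%E ->
    (sqnorm b <= sqn h)%E -> `|ip a b| <= l * qn f + l^-1 * qn h.
  move=> sa sb la lb; rewrite -lee_fin; apply: le_trans (ip_norm_le sa sb l0) _.
  rewrite EFinD !EFinM -!qnE//.
  by apply: leeD; rewrite lee_wpmul2l// lee_fin ?invr_ge0 ltW.
apply: le_trans (nC_le_ReIm _) _; rewrite cintegralE /=.
under eq_Rintegral do rewrite ReM.
under [in X in _ + X <= _]eq_Rintegral do rewrite ImM.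
rewrite RintegralB//; try exact: sqint_mul.
rewrite RintegralD//; try exact: sqint_mul.
have b1 := B _ _ f1 h1 nf1 nh1; have b2 := B _ _ f2 h2 nf2 nh2.
have b3 := B _ _ f1 h2 nf1 nh2; have b4 := B _ _ f2 h1 nf2 nh1.
apply: (@le_trans _ _ ((`|ip (fun x => Re (f x i 0)) (fun x => Re (h x k 0))| +
  `|ip (fun x => Im (f x i 0)) (fun x => Im (h x k 0))|) +
  (`|ip (fun x => Re (f x i 0)) (fun x => Im (h x k 0))| +
  `|ip (fun x => Im (f x i 0)) (fun x => Re (h x k 0))|))).
  by apply: lerD; [exact: ler_normB|exact: ler_normD].
lra.
Qed.

Lemma BM_bound N : exists2 kappa, 0 < kappa & forall (f h : spinor) l, L2 f -> L2 h ->
  0 < l -> nC (BM N f h) <= kappa * (l * qn f + l^-1 * qn h).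
Proof.
exists (1 + 4 * \sum_k \sum_i nC (N i k)).
  by rewrite ltr_wpDr// mulr_ge0// sumr_ge0// => k _; rewrite sumr_ge0// => i _; exact: nC_ge0.
move=> f h l Lf Lh l0; rewrite BM_E//.
have Q0 : 0 <= l * qn f + l^-1 * qn h.
  by rewrite addr_ge0// mulr_ge0 ?qn_ge0 ?invr_ge0// ltW.
rewrite mulrDl mul1r -[leLHS]add0r; apply: lerD => //.
rewrite mulrAC mulr_sumr; apply: le_trans (nC_sum _ _) _; apply: ler_sum => k _.
rewrite mulr_sumr; apply: le_trans (nC_sum _ _) _; apply: ler_sum => i _.
by rewrite nCM mulrC ler_wpM2r ?nC_ge0// cintegral_mul_le.
Qed.
End pairing.

(** * From operator expansions to scalar series *)

Section laurent_pairing.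
Variable R : realType.
Local Notation C := R[i].
Local Notation R3 :=
  (measurableTypeR R * measurableTypeR R * measurableTypeR R)%type.
Local Notation spinor := (R3 -> 'cV[C]_(2 + 2)).
Local Notation operator := (spinor -> spinor).
Local Notation K := (kmx R).

Lemma BM_addZ N (f h h' : spinor) c : L2 f -> L2 h -> L2 h' ->
  BM N f (h + c *: h') = BM N f h + c * BM N f h'.
Proof.
move=> Lf Lh Lh'; rewrite /BM -cintegralZ; last exact: qf_cint.
rewrite -cintegralD; [|exact: qf_cint|by apply: cintZ; exact: qf_cint].
by congr cintegral; apply/funext => x; rewrite -qfZr -qfDr.
Qed.

Lemma BM_ae N (f h h' : spinor) : L2 f -> L2 h -> L2 h' -> h = h' %[ae leb3 R] ->
  BM N f h = BM N f h'.
Proof.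
move=> Lf Lh Lh' E; apply: cintegral_ae; [exact: qf_cint..|].
by apply: filterS E => x /(_ I) ->.
Qed.

Lemma cutoffDZ (m : R3 -> R) (h h' : spinor) c :
  cutoff m (h + c *: h') = cutoff m h + c *: cutoff m h'.
Proof.
apply/funext => x; rewrite /cutoff.
rewrite -[RHS]/((m x)%:C *: h x + c *: ((m x)%:C *: h' x)).
by rewrite -[(h + c *: h') x]/(h x + c *: h' x) scalerDr !scalerA mulrC.
Qed.

(* The truncation makes sense of [BM K f h] for [h] in H^1_loc; it is harmless when [f] is
   supported in the ball of radius [rho]. *)
Definition pairing rho (f h : spinor) : C := BM K f (trunc rho h).

Lemma pairing_addZ rho f h h' c : L2 f -> L2 (trunc rho h) -> L2 (trunc rho h') ->
  pairing rho f (h + c *: h') = pairing rho f h + c * pairing rho f h'.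
Proof.
move=> Lf Hh Hh'; rewrite /pairing.
have -> : trunc rho (h + c *: h') = trunc rho h + c *: trunc rho h' by exact: cutoffDZ.
exact: BM_addZ.
Qed.

Lemma pairing_sub_sum rho f (b : spinor) (a : nat -> spinor) (t : nat -> C) n :
  L2 f -> H1loc b -> (forall k, H1loc (a k)) ->
  let e := b - \sum_(k < n) t k *: a k in
  L2 (cutoff (chi rho) e) /\
  pairing rho f e = pairing rho f b - \sum_(k < n) t k * pairing rho f (a k).
Proof.
move=> Lf Hb Ha /=.
have Hc (h : spinor) : H1loc h -> L2 (cutoff (chi rho) h).
  by move=> /(_ _ (test_chi rho)) [].
elim: n => [|n [IH1 IH2]]; first by rewrite !big_ord0 !subr0; split => //; exact: Hc.
rewrite !big_ord_recr /= !opprD !addrA -!scaleNr.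
have LA := Hc _ (Ha n); have tA := H1loc_trunc rho (Ha n); have tE := (trunc_L2 IH1).1.
split.
  rewrite cutoffDZ; apply: L2D; [exact: IH1|exact: L2Z].
rewrite (pairing_addZ (- t n) Lf tE tA) IH2 mulNr.
by rewrite scaleNr.
Qed.

(** The remainder of the expansion, applied to [g], is small in L^2 on the ball, and the form is
    continuous there: convergence in the seminorms becomes convergence of a scalar series. *)
Lemma laurent_pairing rho r (B : operator) (A : nat -> operator) (t : nat -> C) (f g : spinor) :
  L2 f -> L2 g -> supported_in_ball r g -> (L2norm g <= 1)%E ->
  is_op B -> (forall k, is_op (A k)) ->
  opnorm (chi rho) r (B - \sum_(k < n) t k *: A k) @[n --> \oo] --> 0%E ->
  cvgC (fun n => \sum_(k < n) t k * pairing rho f (A k g)) (pairing rho f (B g)).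
Proof.
move=> Lf Lg sg g1 oB oA cv e e0.
have Cg : L2comp g by split => //; exists r.
have HB : H1loc (B g) by have [_ H _ _] := oB; exact: H.
have HA k : H1loc (A k g) by have [_ H _ _] := oA k; exact: H.
have [kappa k0 Hk] := BM_bound K.
(* This weight makes the contribution of [f] at most e / 2. *)
pose l := e / (2 * kappa * (qn f + 1)).
have q1 : 0 < qn f + 1 by apply: ltr_wpDl; [exact: qn_ge0|exact: ltr01].
have kk : 0 < 2 * kappa by rewrite mulr_gt0.
have l0 : 0 < l by apply: divr_gt0 => //; exact: mulr_gt0.
(* A norm below 1 dominates its square; the other bound makes the contribution of the remainder less
   than e / 2. *)
pose d := Num.min 1 (e * l / (2 * kappa)).
have d0 : 0 < d by rewrite lt_min ltr01; apply: divr_gt0 => //; exact: mulr_gt0.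
have [N HN] := cvge0_lt cv d0; exists N => n /HN {}HN.
pose E := B - \sum_(k < n) t k *: A k.
have EE : E g = B g - \sum_(k < n) t k *: A k g by rewrite /E /= fct_sumE.
have [Lc Pe] := @pairing_sub_sum rho f (B g) (fun k => A k g) t n Lf HB HA.
rewrite -Pe -EE; rewrite -EE in Lc.
have [Lt Lts] := trunc_L2 Lc.
have nd : (L2norm (cutoff (chi rho) (E g)) < d%:E)%E.
  by apply: le_lt_trans HN; exact: opnorm_bound.
have qd : qn (trunc rho (E g)) < d.
  rewrite -lte_fin -qnE//; apply: le_lt_trans Lts _; rewrite sqn_L2norm.
  apply: le_lt_trans (nd); rewrite -[leRHS]mule1.
  apply: lee_wpmul2l; first by rewrite /L2norm Lnorm_ge0.
  by apply: ltW; apply: lt_le_trans nd _; rewrite lee_fin /d ge_min lexx.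
apply: le_lt_trans (Hk f (trunc rho (E g)) l Lf Lt l0) _.
have h1 : kappa * (l * qn f) <= e / 2 * (qn f / (qn f + 1)).
  by rewrite le_eqVlt; apply/orP; left; apply/eqP; rewrite /l; field; rewrite !gt_eqF.
have h2 : e / 2 * (qn f / (qn f + 1)) <= e / 2.
  apply: ler_piMr; first by rewrite divr_ge0// ltW.
  by rewrite ler_pdivrMr// mul1r lerDl.
have h3 : kappa * (l^-1 * qn (trunc rho (E g))) < e / 2.
  have : qn (trunc rho (E g)) < e * l / (2 * kappa).
    by apply: lt_le_trans qd _; rewrite /d ge_min lexx orbT.
  rewrite ltr_pdivlMr ?mulr_gt0// => h.
  rewrite mulrCA mulrC ltr_pdivrMr//.
  by move: h; rewrite mulrA; lra.
rewrite mulrDr; lra.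
Qed.
End laurent_pairing.

(** * Analytic continuation on the Riemann surface *)

Section uniformization.
Variable R : realType.
Local Notation C := R[i].

(** On the surface (z + w)(z - w) = 1, so z - w is the inverse of s = z + w; hence these expressions
    for z and w. *)
Definition psurf (s : C) : C * C := ((s + s^-1) / 2, (s - s^-1) / 2).

Lemma psurf_riemann (s : C) : s != 0 -> riemann_surface (psurf s).
Proof. by move=> s0; rewrite /riemann_surface /= /psurf /=; field. Qed.

Lemma psurf_sum (s : C) : (psurf s).1 + (psurf s).2 = s.
Proof. by rewrite /psurf /=; move: s^-1 => u; field. Qed.

Lemma psurf_inj : injective psurf.
Proof. by move=> s t E; have := psurf_sum s; rewrite E psurf_sum. Qed.

Lemma psurf_surj (q : C * C) : riemann_surface q ->
  q.1 + q.2 != 0 /\ psurf (q.1 + q.2) = q.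
Proof.
case: q => z w; rewrite /riemann_surface /= => E.
have H : (z + w) * (z - w) = 1 by rewrite mulrC -subr_sqr E; ring.
have zw : z + w != 0 by apply/eqP => zw0; move: H; rewrite zw0 mul0r => /esym/eqP; rewrite oner_eq0.
split => //; have V : (z + w)^-1 = z - w by apply: (mulfI zw); rewrite mulfV// H.
by rewrite /psurf V; congr pair; field.
Qed.

Lemma nC2 : nC (2 : C) = 2.
Proof. by apply: complexI; rewrite -nCE normr_nat rmorph_nat. Qed.

Lemma psurf_cont (s1 : C) (eta : R) : s1 != 0 -> 0 < eta ->
  exists2 d, 0 < d & forall s, nC (s - s1) < d ->
    [/\ s != 0, nC ((psurf s).1 - (psurf s1).1) < eta &
        nC ((psurf s).2 - (psurf s1).2) < eta].
Proof.
move=> s10 eta0; set m := nC s1; have m0 : 0 < m by rewrite nC_gt0.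
(* For |s| > m / 2 the inverses of s and [s1] differ by at most 2 |s - s1| / m^2, so [q] is a
   Lipschitz constant for both coordinates near [s1]. *)
pose q := 1 + 2 / m ^+ 2.
have q1 : 0 < q by rewrite /q ltr_wpDr// divr_ge0// exprn_ge0// ltW.
pose d := Num.min (m / 2) (eta / q).
have d0 : 0 < d by rewrite lt_min !divr_gt0.
exists d => // s; rewrite lt_min => /andP[sm sq].
have sm2 : m / 2 < nC s.
  by have := nCB s1 (s1 - s); rewrite subKr -[nC (_ - s)]nCN opprB -/m; lra.
have s0 : s != 0 by rewrite -nC_gt0; apply: lt_trans sm2; rewrite divr_gt0.
set e := nC (s - s1) in sm sq *; have e0 : 0 <= e by exact: nC_ge0.
have inv : nC (s^-1 - s1^-1) <= e * (2 / m ^+ 2).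
  have -> : s^-1 - s1^-1 = (s1 - s) * (s^-1 * s1^-1) by field; rewrite s0 s10.
  rewrite !nCM !nCV -nCN opprB -/e ler_wpM2l//.
  have -> : 2 / m ^+ 2 = (m / 2)^-1 * m^-1 by field; rewrite gt_eqF.
  by rewrite ler_pM2r ?invr_gt0// lef_pV2 ?posrE// ?(ltW sm2)// ?divr_gt0// nC_gt0.
have key : (e + nC (s^-1 - s1^-1)) / 2 < eta.
  move: sq; rewrite ltr_pdivlMr// /q mulrDr mulr1 => h.
  rewrite ltr_pdivrMr//; have := nC_ge0 (s^-1 - s1^-1); lra.
have half (a b : C) : nC ((a + b) / 2) <= (nC a + nC b) / 2.
  by rewrite nCM nCV nC2 ler_pM2r ?invr_gt0// nCD.
split => //; apply: le_lt_trans key.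
  have -> : (psurf s).1 - (psurf s1).1 = ((s - s1) + (s^-1 - s1^-1)) / 2.
    by rewrite /psurf /=; ring.
  exact: half.
have -> : (psurf s).2 - (psurf s1).2 = ((s - s1) - (s^-1 - s1^-1)) / 2.
  by rewrite /psurf /=; ring.
by apply: le_trans (half _ _) _; rewrite nCN.
Qed.

Definition tau (s0 s : C) : C := local_coord (psurf s0) (psurf s).

Lemma tau_cont (s0 s1 : C) (eta : R) : s1 != 0 -> 0 < eta ->
  exists2 d, 0 < d & forall s, nC (s - s1) < d ->
    nC (tau s0 s - tau s0 s1) < eta.
Proof.
move=> s10 /(psurf_cont s10)[d d0 H]; exists d => // s /H[_ H1 H2].
by rewrite /tau /local_coord; case: ifP => // _; rewrite opprB addrA subrK.
Qed.

Lemma tau_id (s0 : C) : tau s0 s0 = 0.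
Proof. by rewrite /tau /local_coord; case: ifP => [/eqP//|_]; rewrite subrr. Qed.

(** Besides s0 the coordinate can vanish only at 1/s0 when it is z - z0, and only at -s0 when it is
    w, that is when s0 = 1/s0. The radius keeps s away from that point and from 0. *)
Lemma tau_neq0 (s0 : C) : s0 != 0 -> exists2 d, 0 < d & forall s,
  0 < nC (s - s0) -> nC (s - s0) < d -> s != 0 /\ tau s0 s != 0.
Proof.
move=> n0; have m0 : 0 < nC s0 by rewrite nC_gt0.
pose e := if s0^-1 == s0 then nC s0 else nC (s0^-1 - s0).
have e0 : 0 < e by rewrite /e; case: ifP => // /negbT; rewrite nC_gt0 subr_eq0.
exists (Num.min (nC s0) e); first by rewrite lt_min m0 e0.
move=> s; rewrite nC_gt0 subr_eq0 lt_min => ss0 /andP[h1 h2].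
have sn0 : s != 0.
  by apply/eqP => sE; move: h1; rewrite sE sub0r nCN ltxx.
split => //; rewrite /tau /local_coord /psurf /=.
have two : (2 : C) != 0 by rewrite pnatr_eq0.
rewrite mulf_eq0 invr_eq0 (negPf two) orbF subr_eq0 [s0 == _]eq_sym.
case: ifP => [/eqP E|/negbT E].
  rewrite mulf_neq0 ?invr_eq0// subr_eq0; apply/eqP => E'.
  have : (s - s0) * (s + s0) = 0.
    rewrite -subr_sqr !expr2 {2}E' -{2}E !mulfV ?subrr//.
  move/eqP; rewrite mulf_eq0 subr_eq0 (negPf ss0) /= addr_eq0 => /eqP sE.
  move: h1; rewrite sE -opprD nCN -mulr2n -mulr_natl nCM nC2.
  by apply/negP; rewrite -leNgt; lra.
rewrite subr_eq0; apply/eqP => E'.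
have : (s - s0) * (s - s0^-1) = 0.
  have E2 : s + s^-1 = s0 + s0^-1 by apply: (mulIf (_ : 2^-1 != 0)) E'; rewrite invr_eq0.
  have -> : (s - s0) * (s - s0^-1) = s * ((s + s^-1) - (s0 + s0^-1)) .
    by field; rewrite sn0 n0.
  by rewrite E2 subrr mulr0.
move/eqP; rewrite mulf_eq0 subr_eq0 (negPf ss0) /= subr_eq0 => /eqP sE.
by move: h2; rewrite /e (negPf E) sE ltxx.
Qed.

Lemma disc_point (s0 : C) (d : R) : 0 < d -> exists s, 0 < nC (s - s0) /\ nC (s - s0) < d.
Proof.
move=> d0; exists (s0 + (d / 2)%:C); rewrite addrC addKr.
have -> : nC (d / 2)%:C = d / 2.
  by rewrite /nC normc_def /= expr0n /= addr0 sqrtr_sqr gtr0_norm// divr_gt0.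
by split; lra.
Qed.

Definition slaurent (s0 : C) (d : R) (phi : C -> C) (c : nat -> C) (N : nat) :=
  forall s, 0 < nC (s - s0) -> nC (s - s0) < d ->
    cvgC (fun n => \sum_(k < n) tau s0 s ^ (k%:Z - N%:Z) * c k) (phi s).

Lemma cvgCD (u v : nat -> C) l m : cvgC u l -> cvgC v m -> cvgC (fun n => u n + v n) (l + m).
Proof.
move=> H1 H2 e e0; have e2 : 0 < e / 2 by rewrite divr_gt0.
have [N1 {}H1] := H1 _ e2; have [N2 {}H2] := H2 _ e2.
exists (maxn N1 N2) => n; rewrite geq_max => /andP[/H1 h1 /H2 h2].
by have := nCD (l - u n) (m - v n); rewrite opprD addrACA; lra.
Qed.

Lemma cvgCZ (u : nat -> C) l c : cvgC u l -> cvgC (fun n => c * u n) (c * l).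
Proof.
move=> H e e0; have q : 0 < nC c + 1 by rewrite ltr_wpDl// nC_ge0.
have [N {}H] := H (e / (nC c + 1)) (divr_gt0 e0 q).
exists N => n /H; rewrite ltr_pdivlMr// -mulrBr nCM.
by have := nC_ge0 (l - u n); lra.
Qed.

Lemma slaurentD s0 d phi psi b c N : slaurent s0 d phi b N -> slaurent s0 d psi c N ->
  slaurent s0 d (fun s => phi s + psi s) (fun k => b k + c k) N.
Proof.
move=> H1 H2 s h1 h2; have := cvgCD (H1 s h1 h2) (H2 s h1 h2).
rewrite (_ : (fun n => _) =
  fun n => \sum_(k < n) tau s0 s ^ (k%:Z - N%:Z) * (b k + c k))//.
by apply/funext => n; rewrite -big_split; apply: eq_bigr => k _; rewrite mulrDr.
Qed.

Lemma slaurent_power s0 d phi c N s : slaurent s0 d phi c N ->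
  0 < nC (s - s0) -> nC (s - s0) < d -> tau s0 s != 0 ->
  cvgC (fun n => \sum_(k < n) c k * tau s0 s ^+ k) (tau s0 s ^+ N * phi s).
Proof.
move=> H h1 h2 t0; have := cvgCZ (tau s0 s ^+ N) (H s h1 h2).
rewrite (_ : (fun n => _) = fun n => \sum_(k < n) c k * tau s0 s ^+ k)//.
apply/funext => n; rewrite mulr_sumr; apply: eq_bigr => k _.
by rewrite mulrA exprnP -expfzDr// addrC subrK -exprnP mulrC.
Qed.

(* The radii must not depend on the function expanded. *)
Lemma laurent_radius (s0 : C) (d : R) : s0 != 0 -> 0 < d -> exists rho d1,
  [/\ 0 < rho, 0 < d1, d1 <= d, forall s, 0 < nC (s - s0) -> nC (s - s0) < d1 ->
       [/\ s != 0, tau s0 s != 0 & nC (tau s0 s) <= rho / 2] &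
      forall phi c N, slaurent s0 d phi c N -> exists M, forall k, nC (c k) * rho ^+ k <= M].
Proof.
move=> n0 d0; have [e e0 He] := tau_neq0 n0.
have m0 : 0 < Num.min d e by rewrite lt_min d0 e0.
(* Abel's argument: convergence at the single point [t] bounds the terms there. As [t] is chosen
   before the function, the radius [rho], the modulus of the coordinate at [t], is common to all
   expansions. *)
have [t [t1]] := disc_point s0 m0; rewrite lt_min => /andP[t2 t3].
have [tn0 tt0] := He t t1 t3; pose rho := nC (tau s0 t).
have rho0 : 0 < rho by rewrite nC_gt0.
have r2 : 0 < rho / 2 by rewrite divr_gt0.
have [a a0 Ha] := tau_cont s0 n0 r2.
exists rho, (Num.min (Num.min d e) a); split => //; first by rewrite lt_min m0 a0.
- by rewrite !ge_min lexx.
- move=> s h; rewrite !lt_min => /andP[/andP[h1 h2] h3].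
  by have [? ?] := He s h h2; split => //; have := Ha s h3; rewrite tau_id subr0 => /ltW.
- move=> phi c N H; have := @cvgC_terms _ (fun k => c k * tau s0 t ^+ k) _ (slaurent_power H t1 t2 tt0).
  by move=> [M HM]; exists M => k; have := HM k; rewrite nCM nCX.
Qed.

(** The power series of tau^N phi is bounded by 2M, and near s1 the coordinate stays above half its
    modulus at s1. The radius [d1] is fixed before the function, so it serves all pairings at
    once. *)
Lemma slaurent_locally_bounded (s0 : C) (d : R) : s0 != 0 -> 0 < d ->
  exists2 d1, 0 < d1 & forall s1, 0 < nC (s1 - s0) -> nC (s1 - s0) < d1 ->
   s1 != 0 /\
   forall phi c N, slaurent s0 d phi c N -> exists D e, [/\ 0 <= D, 0 < e &
     forall s, nC (s - s1) < e -> nC (phi s) <= D].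
Proof.
move=> n0 d0; have [rho [d1 [rho0 d10 d1d H HM]]] := laurent_radius n0 d0.
exists d1 => // s1 h1 h2; have [s10 t0 tr] := H s1 h1 h2; split => //.
move=> phi c N sl; have [M {}HM] := HM _ _ _ sl.
set t1 := nC (tau s0 s1); have t10 : 0 < t1 by rewrite nC_gt0.
have [a a0 Ha] := tau_cont s0 s10 (divr_gt0 t10 (ltr0n R 2)).
have M0 : 0 <= M by apply: le_trans (HM 0%N); rewrite expr0 mulr1 nC_ge0.
exists (2 * M / (t1 / 2) ^+ N), (Num.min a (Num.min (nC (s1 - s0)) (d1 - nC (s1 - s0)))).
split.
- by rewrite divr_ge0 ?mulr_ge0// exprn_ge0// divr_ge0// ltW.
- by rewrite !lt_min a0 h1 subr_gt0 h2.
move=> s; rewrite !lt_min => /andP[/Ha hs /andP[g1 g2]].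
have E : s - s0 = (s1 - s0) + (s - s1) by ring.
have k1 : 0 < nC (s - s0).
  have := nCB (s1 - s0) (s1 - s); have -> : s1 - s0 - (s1 - s) = s - s0 by ring.
  by rewrite -[nC (s1 - s)]nCN opprB; lra.
have k2 : nC (s - s0) < d1 by rewrite E; have := nCD (s1 - s0) (s - s1); lra.
have [sn0 st0 str] := H s k1 k2.
have := series_bound rho0 HM str (slaurent_power sl k1 (lt_le_trans k2 d1d) st0).
rewrite nCM nCX => hb.
have tl : t1 / 2 <= nC (tau s0 s).
  have := nCB (tau s0 s1) (tau s0 s1 - tau s0 s); rewrite subKr.
  by rewrite -/t1 -[nC (_ - tau s0 s)]nCN opprB; lra.
rewrite ler_pdivlMr ?exprn_gt0 ?divr_gt0// mulrC; apply: le_trans hb.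
rewrite ler_wpM2r ?nC_ge0// lerXn2r// nnegrE ?nC_ge0// divr_ge0// ltW//.
Qed.

(** Boundedness of phi reads |tau^N phi| <= D |tau|^N, so the power series of tau^N phi has no term
    below order N. *)
Lemma slaurent_removable s1 d phi c N D e : s1 != 0 -> 0 < d ->
  slaurent s1 d phi c N -> 0 <= D -> 0 < e ->
  (forall s, nC (s - s1) < e -> nC (phi s) <= D) -> forall k, (k < N)%N -> c k = 0.
Proof.
move=> n0 d0 sl D0 e0 HD.
have [rho [d1 [rho0 d10 d1d H HM]]] := laurent_radius n0 d0.
have [M {}HM] := HM _ _ _ sl.
pose T := [set s | [/\ 0 < nC (s - s1), nC (s - s1) < d1 & nC (s - s1) < e]].
apply: (@series_coef_eq0 _ _ T c (tau s1) (fun s => tau s1 s ^+ N * phi s) rho M D) => //.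
- move=> s [h1 h2 h3]; have [_ ? _] := H s h1 h2.
  by apply: slaurent_power sl _ _ _ => //; exact: lt_le_trans h2 d1d.
- by move=> s [h1 h2 h3]; rewrite nCM nCX mulrC ler_wpM2r ?exprn_ge0 ?nC_ge0// HD.
- move=> a a0; have [b b0 Hb] := tau_cont s1 n0 a0.
  have m0 : 0 < Num.min b (Num.min d1 e) by rewrite !lt_min b0 d10.
  have [s [h1]] := disc_point s1 m0; rewrite !lt_min => /and3P[h2 h3 h4].
  have [_ t0 _] := H s h1 h3; exists s; split => //; first by rewrite nC_gt0.
  by have := Hb s h2; rewrite tau_id subr0.
Qed.

(** The identity theorem for meromorphic functions: zeros accumulating at the centre annihilate
    every coefficient, by [series_coef_eq0] with D = 0, and then the sum itself on the punctured
    disc. *)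
Lemma slaurent_zeros s0 d phi c N : s0 != 0 -> 0 < d -> slaurent s0 d phi c N ->
  (forall e, 0 < e -> exists s, [/\ 0 < nC (s - s0), nC (s - s0) < e & phi s = 0]) ->
  (forall k, c k = 0) /\
  exists2 e, 0 < e & forall s, 0 < nC (s - s0) -> nC (s - s0) < e -> phi s = 0.
Proof.
move=> n0 d0 sl HZ.
have [rho [d1 [rho0 d10 d1d H HM]]] := laurent_radius n0 d0.
have [M {}HM] := HM _ _ _ sl.
have c0 k : c k = 0.
  pose T := [set s | [/\ 0 < nC (s - s0), nC (s - s0) < d1 & phi s = 0]].
  apply: (@series_coef_eq0 _ _ T c (tau s0) (fun s => tau s0 s ^+ N * phi s) rho M 0 k.+1) => //.
  - move=> s [h1 h2 h3]; have [_ ? _] := H s h1 h2.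
    by apply: slaurent_power sl _ _ _ => //; exact: lt_le_trans h2 d1d.
  - by move=> s [_ _ ->]; rewrite mulr0 nC0 mul0r.
  - move=> a a0; have [b b0 Hb] := tau_cont s0 n0 a0.
    have m0 : 0 < Num.min b d1 by rewrite lt_min b0.
    have [s [h1 h2 h3]] := HZ _ m0; move: h2; rewrite lt_min => /andP[h2 h4].
    have [_ t0 _] := H s h1 h4; exists s; split => //; first by rewrite nC_gt0.
    by have := Hb s h2; rewrite tau_id subr0.
split => //; exists d => // s h1 h2; apply/eqP; rewrite -nC_eq0.
rewrite eq_le nC_ge0 andbT; apply/ler_addgt0Pr => e e0; rewrite add0r.
have [K HK] := sl s h1 h2 e e0; have := HK K (leqnn K).
by rewrite big1 ?subr0 => [/ltW//|k _]; rewrite c0 mulr0.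
Qed.

(** The centre is left out since it may be a pole, where the value of the function is arbitrary. *)
Definition punctured_zero (phi : C -> C) (s0 : C) :=
  exists2 e, 0 < e & forall s, 0 < nC (s - s0) -> nC (s - s0) < e -> phi s = 0.

Lemma nC_imag (y : R) : nC ('i * y%:C) = `|y|.
Proof.
rewrite nCM /nC !normc_def /= !expr0n expr1n /= add0r sqrtr1 mul1r addr0.
by rewrite sqrtr_sqr.
Qed.

(** Let y be the supremum of the heights where vanishing fails. Points above it give zeros
    accumulating at height y, so the identity theorem yields a punctured disc of zeros there. That
    disc contains small punctured neighbourhoods of the points of the line just below, against the
    choice of y. *)
Lemma punctured_zero_continuation (phi : C -> C) (s0 : C) (b : R) : 
  (forall y, 0 <= y -> s0 + 'i * y%:C != 0 /\ exists d c N, 0 < d /\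
     slaurent (s0 + 'i * y%:C) d phi c N) ->
  (forall y, b <= y -> punctured_zero phi (s0 + 'i * y%:C)) ->
  punctured_zero phi s0.
Proof.
set s := fun y : R => s0 + 'i * y%:C; move=> Hs Hb.
apply: contrapT => nZ0.
pose A := [set y : R | 0 <= y /\ ~ punctured_zero phi (s y)].
have A0 : A 0 by split => //; rewrite /s mulr0 addr0.
have uA : ubound A b.
  by move=> y [_ nZ]; rewrite leNgt; apply/negP => /ltW /Hb.
have hA : has_sup A by split; [exists 0|exists b].
pose y := sup A.
have y0 : 0 <= y by apply: ub_le_sup => //; exists b.
have dist (u v : R) : nC (s u - s v) = `|u - v|.
  by rewrite /s opprD addrACA subrr add0r -mulrBr -rmorphB nC_imag.
have Zy u : y < u -> punctured_zero phi (s u).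
  move=> yu; apply: contrapT => nZ; suff : u <= y by rewrite leNgt yu.
  by apply: ub_le_sup => //; [exists b|split => //; apply: ltW; apply: le_lt_trans yu].
have [sy [d [c [N [d0 sl]]]]] := Hs y y0.
have [_ [e e0 He]] : (forall k, c k = 0) /\ punctured_zero phi (s y).
  apply: (slaurent_zeros sy d0 sl) => e e0.
  have e2 : 0 < e / 2 by rewrite divr_gt0.
  have yu : y < y + e / 2 by rewrite ltrDl.
  have [a a0 Ha] := Zy _ yu.
  have m0 : 0 < Num.min a (e / 2) by rewrite lt_min a0.
  have [t [t1]] := disc_point (s (y + e / 2)) m0; rewrite lt_min => /andP[t2 t3].
  exists t; split; last exact: Ha t t1 t2.
  - have := nCB (s (y + e / 2) - s y) (s (y + e / 2) - t).
    have -> : s (y + e / 2) - s y - (s (y + e / 2) - t) = t - s y by ring.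
    by rewrite dist [_ - y]addrC addKr gtr0_norm// -[nC (_ - t)]nCN opprB; lra.
  - have := nCD (t - s (y + e / 2)) (s (y + e / 2) - s y).
    rewrite addrA subrK dist [_ - y]addrC addKr gtr0_norm//.
    by rewrite -/(s y); lra.
have [u Au] := sup_adherent e0 hA; rewrite -/y => yu; have [u0 nZu] := Au.
have uy : u <= y by apply: ub_le_sup => //; exists b.
have [uyE|uny] := eqVneq u y.
  by apply: nZu; rewrite uyE; exists e.
have uly : u < y by rewrite lt_neqAle uny.
apply: nZu.
(* The first bound excludes the centre [s y], the second one keeps the point in its disc. *)
exists (Num.min (y - u) (e - (y - u))).
  by rewrite lt_min; apply/andP; split; lra.
move=> t t1; rewrite lt_min => /andP[t2 t3].
have dd : nC (s u - s y) = y - u by rewrite dist ltr0_norm ?opprB// subr_lt0.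
apply: He.
- have := nCB (s u - s y) (s u - t); have -> : s u - s y - (s u - t) = t - s y by ring.
  by rewrite dd -[nC (_ - t)]nCN opprB; lra.
- by have := nCD (t - s u) (s u - s y); rewrite addrA subrK dd; lra.
Qed.
End uniformization.

(** * Antisymmetry of the residue *)

Section nondegeneracy.
Variable R : realType.
Local Notation C := R[i].
Local Notation R3 :=
  (measurableTypeR R * measurableTypeR R * measurableTypeR R)%type.
Local Notation spinor := (R3 -> 'cV[C]_(2 + 2)).
Local Notation mu3 := (@mu3 R).
Local Notation Re := complex.Re.
Local Notation Im := complex.Im.
Local Notation K := (kmx R).

(* [filterS] does not find the filter instance on the carrier of [leb3] as it is
   elaborated in [supported_in_ball]. *)
Lemma ae_mono (P Q : R3 -> Prop) : (forall x, P x -> Q x) ->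
  (\forall x \ae leb3 R, P x) -> \forall x \ae leb3 R, Q x.
Proof. by move=> PQ; apply: (@filterS _ _ (ae_filter_ringOfSetsType mu3)). Qed.

Lemma ae_mono2 (P Q S : R3 -> Prop) : (forall x, P x -> Q x -> S x) ->
  (\forall x \ae leb3 R, P x) -> (\forall x \ae leb3 R, Q x) -> \forall x \ae leb3 R, S x.
Proof. by move=> PQ; apply: (@filterS2 _ _ (ae_filter_ringOfSetsType mu3)). Qed.

Lemma eps2_sqr : eps2 R *m eps2 R = - 1%:M.
Proof.
rewrite /eps2 mulmx_block !(mul0mx, mulmx0, mul1mx, mulmx1, addr0, add0r).
have -> : (1%:M : 'M[C]_(1 + 1)) = block_mx 1%:M 0 0 1%:M by rewrite -scalar_mx_block.
by rewrite opp_block_mx !oppr0 !raddfN.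
Qed.

Lemma kmx_sqr : K^T *m K = 1%:M.
Proof.
rewrite kmxT mulNmx kmxE mulmx_block !(mul0mx, mulmx0, addr0, add0r) eps2_sqr.
by rewrite opp_block_mx opprK oppr0 -scalar_mx_block.
Qed.

Lemma L2_mulmx (N : 'M[C]_(2 + 2)) (u : spinor) : L2 u -> L2 (fun x => N *m u x).
Proof.
move=> /L2P Hu; apply/L2P => i.
have : cL2 (fun x => \sum_k N i k * u x k 0) by apply: cL2_sum => k; exact: cL2Z.
by congr cL2; apply/funext => x; rewrite mxE.
Qed.

Lemma L2_conj (u : spinor) : L2 u -> L2 (fun x => map_mx conjc (u x)).
Proof.
move=> /L2P Hu; apply/L2P => i; have [h1 h2] := Hu i; split.
  by have := h1; congr sqint; apply/funext => x; rewrite mxE; case: (u x i 0).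
have := sqintZ (-1) h2; congr sqint; apply/funext => x; rewrite mxE mulN1r.
by case: (u x i 0).
Qed.

Lemma sqn_eq0 (u : spinor) : L2 u -> sqn u = 0%E -> u = 0 %[ae leb3 R].
Proof.
move=> Lu; have mU := measurable_vnorm_sq Lu.
move=> u0.
have /(ae_eq_integral_abs mu3 measurableT mU) : (\int[mu3]_x `|(vnorm (u x) ^+ 2)%:E|)%E = 0%E.
  rewrite -[RHS]u0; apply: eq_integral => x _.
  by rewrite gee0_abs// lee_fin sqr_ge0.
apply: filterS => x /(_ I) /= [E] _.
apply/matrixP => i j; rewrite ord1 [RHS]mxE.
move: E; rewrite vnorm_sq => /eqP.
rewrite psumr_eq0; last by move=> k _; rewrite addr_ge0 ?sqr_ge0.
move=> /allP /(_ i (mem_index_enum _)) /=.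
rewrite paddr_eq0 ?sqr_ge0// !sqrf_eq0; case: (u x i 0) => a b /= /andP[/eqP -> /eqP ->].
by [].
Qed.

(** Since K^T K = 1, this first argument turns the bilinear form into the squared L^2 norm of
    [u]. *)
Lemma BM_conj_eq0 (u : spinor) : L2 u ->
  BM K (fun x => K *m map_mx conjc (u x)) u = 0 -> u = 0 %[ae leb3 R].
Proof.
move=> Lu B0; apply: sqn_eq0 => //.
have E x : qf K (K *m map_mx conjc (u x)) (u x) = (vnorm (u x) ^+ 2)%:C.
  rewrite qfMl kmx_sqr /qf mulmx1 mxE vnorm_sq rmorph_sum; apply: eq_bigr => i _.
  rewrite !mxE; case: (u x i 0) => a b.
  by apply/eqP; rewrite eq_complex /= !expr2; apply/andP; split; apply/eqP; ring.
have := congr1 (@complex.Re R) B0; rewrite /BM cintegralE /= /Rintegral.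
under eq_integral do rewrite E /=.
by rewrite -/(qn u) => q0; rewrite qnE// q0.
Qed.

Lemma trunc_supported rho (h : spinor) : supported_in_ball rho (trunc rho h).
Proof.
apply: aeW => x xr; rewrite /trunc /cutoff indicE.
have -> : (x \in box rho) = false.
  by apply: memNset => /boxP; rewrite leNgt xr.
by rewrite scale0r.
Qed.

Lemma supported_mono rho rho' (f : spinor) : rho <= rho' -> supported_in_ball rho f ->
  supported_in_ball rho' f.
Proof.
move=> rr sf; apply: ae_mono sf => x H xr; apply: H; exact: le_lt_trans xr.
Qed.

Lemma supportedDZ rho (f g : spinor) c : supported_in_ball rho f ->
  supported_in_ball rho g -> supported_in_ball rho (c *: f + g).
Proof.
move=> sf sg; apply: ae_mono2 sf sg => x Hf Hg xr.
by rewrite -[LHS]/(c *: f x + g x) Hf// Hg// scaler0 addr0.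
Qed.

Lemma qf_trunc rho (f h : spinor) x : (rho < `|x| -> f x = 0) ->
  qf K (f x) (trunc rho h x) = qf K (f x) (h x).
Proof.
move=> H; rewrite /trunc /cutoff indicE.
case: (boolP (x \in box rho)) => [_|/negP xr]; first by rewrite scale1r.
rewrite H ?/qf ?trmx0 ?mul0mx//.
by rewrite ltNge; apply/negP => /boxP; rewrite -inE.
Qed.

Lemma pairing_supported rho (f h h' : spinor) : L2 f -> supported_in_ball rho f ->
  H1loc h -> L2 h' -> h = h' %[ae leb3 R] -> pairing rho f h = BM K f h'.
Proof.
move=> Lf sf Hh Lh' E; have Lt := H1loc_trunc rho Hh.
apply: cintegral_ae; [exact: qf_cint|exact: qf_cint|].
apply: ae_mono2 sf E => x /(@qf_trunc rho f h) -> /(_ I) E.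
by rewrite E.
Qed.

Lemma pairing_radius rho rho' (f h : spinor) : L2 f -> supported_in_ball rho f ->
  rho <= rho' -> H1loc h -> pairing rho' f h = pairing rho f h.
Proof.
move=> Lf sf rr Hh.
have L1 := H1loc_trunc rho Hh; have L2 := H1loc_trunc rho' Hh.
apply: cintegral_ae; [exact: qf_cint|exact: qf_cint|].
apply: ae_mono sf => x H; rewrite !qf_trunc// => xr.
by apply: H; exact: le_lt_trans xr.
Qed.

(** With u the truncation of h to a ball of integer radius, K conj(u) is an admissible test vector
    and shows that u vanishes. The balls exhaust the space, and countably many null sets form a null
    set. *)
Lemma pairing_nondegenerate (h : spinor) : H1loc h ->
  (forall rho f, L2 f -> supported_in_ball rho f -> pairing rho f h = 0) ->
  h = 0 %[ae leb3 R].
Proof.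
move=> Hh H.
have Hn (n : nat) : trunc n%:R h = 0 %[ae leb3 R].
  have Lt := H1loc_trunc n%:R Hh; apply: BM_conj_eq0 => //; apply: H.
    by apply: L2_mulmx; exact: L2_conj.
  apply: ae_mono (trunc_supported n%:R h) => x Hx /Hx ->.
  by rewrite map_mx0 mulmx0.
have : \forall x \ae leb3 R, forall n : nat, trunc n%:R h x = 0.
  by apply/ae_foralln => n; apply: filterS (Hn n) => x /(_ I).
apply: filterS => x Hx _.
have [n xn] : exists n : nat, `|x| <= n%:R.
  by exists (Num.Def.archi_bound `|x|); apply: ltW; exact: archi_boundP.
have := Hx n; rewrite /trunc /cutoff indicE mem_set; last exact/boxP.
by rewrite scale1r.
Qed.
End nondegeneracy.

(** * Operators on finite sums and their scalar expansions *)

Section operators.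
Variable R : realType.
Local Notation C := R[i].
Local Notation R3 :=
  (measurableTypeR R * measurableTypeR R * measurableTypeR R)%type.
Local Notation spinor := (R3 -> 'cV[C]_(2 + 2)).
Local Notation operator := (spinor -> spinor).

Lemma L2_0 : L2 (0 : spinor).
Proof. by apply/L2P => i; split; under eq_fun do rewrite mxE; exact: sqint0. Qed.

Lemma L2comp0 : L2comp (0 : spinor).
Proof. by split; [exact: L2_0|exists 0; apply: aeW]. Qed.

Lemma L2compDZ (c : C) (f g : spinor) : L2comp f -> L2comp g -> L2comp (c *: f + g).
Proof.
move=> [Lf [r sf]] [Lg [r' sg]]; split; first by apply: L2D => //; exact: L2Z.
exists (Num.max r r'); apply: supportedDZ.
  by apply: supported_mono sf; rewrite le_max lexx.
by apply: supported_mono sg; rewrite le_max lexx orbT.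
Qed.

Lemma op0 (A : operator) : is_op A -> A 0 = 0 %[ae leb3 R].
Proof.
move=> [HA _ _ _]; have := HA 1 0 0 L2comp0 L2comp0.
rewrite scaler0 addr0 => E; apply: ae_mono E => x H _.
have := H I; rewrite scale1r -[X in _ = X]/(A 0 x + A 0 x) => E.
by apply: (addrI (A 0 x)); rewrite -E addr0.
Qed.

Lemma op_sum (I : Type) (s : seq I) (c : I -> C) (f : I -> spinor) (A : operator) : is_op A ->
  (forall k, L2comp (f k)) ->
  L2comp (\sum_(k <- s) c k *: f k) /\
  A (\sum_(k <- s) c k *: f k) = \sum_(k <- s) c k *: A (f k) %[ae leb3 R].
Proof.
move=> oA Hf; elim: s => [|i s [IH1 IH2]].
  by rewrite !big_nil; split; [exact: L2comp0|exact: op0].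
rewrite !big_cons; split; first exact: L2compDZ.
have [HA _ _ _] := oA; apply: ae_mono2 (HA (c i) _ _ (Hf i) IH1) IH2 => x H1 H2 _.
by rewrite (H1 Logic.I) -[LHS]/((c i *: A (f i)) x + A (\sum_(k <- s) c k *: f k) x) (H2 Logic.I).
Qed.

Lemma pairing_sum (I : Type) (s : seq I) (c : I -> C) (h : I -> spinor) rho (f h' : spinor) :
  L2 f -> H1loc h' -> (forall k, H1loc (h k)) ->
  h' = \sum_(k <- s) c k *: h k %[ae leb3 R] ->
  pairing rho f h' = \sum_(k <- s) c k * pairing rho f (h k).
Proof.
move=> Lf Hh' Hh E.
have t0 : trunc rho (0 : spinor) = 0 by apply/funext => x; rewrite /trunc /cutoff scaler0.
have [L P] : L2 (trunc rho (\sum_(k <- s) c k *: h k)) /\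
    pairing rho f (\sum_(k <- s) c k *: h k) = \sum_(k <- s) c k * pairing rho f (h k).
  elim: s {E} => [|i s [IH1 IH2]].
    rewrite !big_nil t0; split; first exact: L2_0.
    rewrite /pairing t0 /BM; under eq_fun do rewrite /qf mulmx0 mxE.
    exact: cintegral0.
  have Li := H1loc_trunc rho (Hh i).
  rewrite !big_cons addrC; split.
    rewrite /trunc cutoffDZ; apply: L2D; [exact: IH1|exact: L2Z].
  by rewrite (pairing_addZ (c i) Lf IH1 Li) IH2 addrC.
rewrite -P; apply: BM_ae => //; first exact: H1loc_trunc.
by apply: ae_mono E => x H _; rewrite /trunc /cutoff H.
Qed.

Lemma pairing_op_sum (I : Type) (s : seq I) (c : I -> C) (g : I -> spinor) rho f (A : operator) :
  is_op A -> L2 f -> (forall k, L2comp (g k)) ->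
  pairing rho f (A (\sum_(k <- s) c k *: g k)) = \sum_(k <- s) c k * pairing rho f (A (g k)).
Proof.
move=> oA Lf Hg; have [L E] := op_sum s c oA Hg; have [_ HA _ _] := oA.
by apply: (pairing_sum (h := fun k => A (g k))) E => // [|k]; exact: HA.
Qed.

Lemma pairing_opZ (c : C) (g : spinor) rho f (A : operator) :
  is_op A -> L2 f -> L2comp g ->
  pairing rho f (A (c *: g)) = c * pairing rho f (A g).
Proof.
move=> oA Lf Hg.
by have := @pairing_op_sum unit [:: tt] (fun=> c) (fun=> g) rho f A oA Lf (fun=> Hg); rewrite !big_seq1.
Qed.

Lemma scaled_L2norm (g : spinor) : L2 g -> exists2 c : R, 0 < c & (L2norm (c%:C *: g) <= 1)%E.
Proof.
move=> Lg; have q1 : 0 < qn g + 1 by rewrite ltr_wpDl// qn_ge0.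
pose c := (qn g + 1)^-1; have c0 : 0 < c by rewrite invr_gt0.
exists c => //; have Lc : L2 (c%:C *: g) by exact: L2Z.
have -> : c%:C *: g = cutoff (fun=> c) g by [].
have Eq : (sqn (cutoff (fun=> c) g) = (c ^+ 2)%:E * sqn g)%E.
  rewrite /sqn -(ge0_integralZl_EFin _ measurableT _ (measurable_vnorm_sq Lg) (sqr_ge0 c)); last first.
    by move=> x _; rewrite lee_fin sqr_ge0.
  apply: eq_integral => x _; rewrite -EFinM !vnorm_sq mulr_sumr; congr (_%:E).
  apply: eq_bigr => i _; rewrite /cutoff mxE ReM ImM /= !mul0r subr0 addr0 !exprMn.
  by rewrite mulrDr.
rewrite L2norm_sqn Eq qnE// -EFinM poweR_EFin lee_fin powR12_sqrt; last first.
  by rewrite mulr_ge0 ?sqr_ge0// qn_ge0.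
rewrite -sqrtr1 ler_wsqrtr// /c expr2 -mulrA.
have h : (qn g + 1)^-1 * qn g <= 1 by rewrite mulrC ler_pdivrMr// mul1r lerDl.
rewrite -[leRHS]mul1r; apply: ler_pM => //; rewrite ?invr_ge0 ?(ltW q1)//.
  by rewrite mulr_ge0 ?qn_ge0// invr_ge0 ltW.
by rewrite invf_le1// lerDr qn_ge0.
Qed.

(** The seminorms [opnorm] test only vectors of norm at most 1; homogeneity removes this
    normalization. *)
Lemma laurent_pairing_comp rho r (B : operator) (A : nat -> operator) (t : nat -> C) (f g : spinor) :
  L2 f -> L2 g -> supported_in_ball r g ->
  is_op B -> (forall k, is_op (A k)) ->
  opnorm (chi rho) r (B - \sum_(k < n) t k *: A k) @[n --> \oo] --> 0%E ->
  cvgC (fun n => \sum_(k < n) t k * pairing rho f (A k g)) (pairing rho f (B g)).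
Proof.
move=> Lf Lg sg oB oA cv; have [c c0 gc] := scaled_L2norm Lg.
have Cg : L2comp g by split => //; exists r.
have cn : c%:C != 0 :> C by rewrite -[0]/((0 : R)%:C) (inj_eq (@complexI R)) gt_eqF.
have scg : supported_in_ball r (c%:C *: g).
  by apply: ae_mono sg => x H /H H0; rewrite -[LHS]/(c%:C *: g x) H0 scaler0.
have := cvgCZ (c%:C)^-1 (laurent_pairing Lf (L2Z c%:C Lg) scg gc oB oA cv).
rewrite (pairing_opZ c%:C rho oB Lf Cg) mulKf//.
rewrite (_ : (fun n => _) = fun n => \sum_(k < n) t k * pairing rho f (A k g))//.
apply/funext => n; rewrite mulr_sumr; apply: eq_bigr => k _.
by rewrite (pairing_opZ c%:C rho (oA k) Lf Cg) mulrCA mulKf.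
Qed.

(** The order [N] and the radius [d] come from the operator expansion, hence are the same for all
    pairings; [pole_isolated] depends on this uniformity. *)
Lemma is_laurent_slaurent (F : C * C -> operator) (s0 : C) (A : int -> operator) :
  s0 != 0 -> is_laurent F (psurf s0) A -> exists (N : nat) (d : R),
  [/\ 0 < d, forall n : int, n < - N%:Z -> op_eq (A n) 0,
    forall s, 0 < nC (s - s0) -> nC (s - s0) < d -> s != 0 /\ is_op (F (psurf s)) &
    forall rho f g, L2 f -> L2comp g ->
      slaurent s0 d (fun s => pairing rho f (F (psurf s) g))
        (fun k => pairing rho f (A (k%:Z - N%:Z) g)) N].
Proof.
move=> n0 [oA [N [r [r0 HA HF]]]]; have [d d0 Hd] := psurf_cont n0 r0.
have near s : 0 < nC (s - s0) -> nC (s - s0) < d ->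
  [/\ s != 0, riemann_surface (psurf s), psurf s <> psurf s0,
   `|(psurf s).1 - (psurf s0).1| < r%:C & `|(psurf s).2 - (psurf s0).2| < r%:C].
  move=> h1 h2; have [sn0 a b] := Hd s h2; rewrite !nC_lt; split => //.
    exact: psurf_riemann.
  by move=> /psurf_inj E; move: h1; rewrite E subrr nC0 ltxx.
exists N, d; split => // [s h1 h2|rho f g Lf [Lg [r' sg]] s h1 h2].
  by have [? a1 a2 a3 a4] := near s h1 h2; have [] := HF _ a1 a2 a3 a4.
have [_ a1 a2 a3 a4] := near s h1 h2; have [oF cv] := HF _ a1 a2 a3 a4.
have := @laurent_pairing_comp rho r' (F (psurf s)) (fun k : nat => A (k%:Z - N%:Z))
  (fun k : nat => tau s0 s ^ (k%:Z - N%:Z)) f g Lf Lg sg oF (fun k => oA _).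
apply; exact: (cv (chi rho) r' (test_chi rho)).
Qed.
End operators.

(** * Isolation of poles and continuation from the upper half-plane *)

Section poles.
Variable R : realType.
Local Notation C := R[i].
Local Notation R3 :=
  (measurableTypeR R * measurableTypeR R * measurableTypeR R)%type.
Local Notation spinor := (R3 -> 'cV[C]_(2 + 2)).
Local Notation operator := (spinor -> spinor).

Lemma pairing_op_neq0 (A : operator) : is_op A -> ~ op_eq A 0 ->
  exists rho f g, [/\ L2 f, L2comp g & pairing rho f (A g) != 0].
Proof.
move=> oA nA; apply: contrapT => H; apply: nA => g Hg.
have [_ HA _ _] := oA; apply: pairing_nondegenerate; first exact: HA.
move=> rho f Lf _; apply/eqP/negPn/negP => P0; apply: H.
by exists rho, f, g.
Qed.

(* Near a pole other than [s0], some pairing would be unbounded, although its Laurent series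
   at [s0] bounds it there. *)
Lemma pole_isolated (F : C * C -> operator) (s0 : C) (A : int -> operator) :
  s0 != 0 -> is_laurent F (psurf s0) A ->
  exists2 d, 0 < d & forall s, 0 < nC (s - s0) -> nC (s - s0) < d ->
    [/\ s != 0, is_op (F (psurf s)) & ~ is_pole F (psurf s)].
Proof.
move=> n0 LA; have [N [d [d0 _ oF sl]]] := is_laurent_slaurent n0 LA.
have [d1 d10 H] := slaurent_locally_bounded n0 d0.
exists (Num.min d d1); first by rewrite lt_min d0.
move=> s1 h1; rewrite lt_min => /andP[h2 h3].
have [s10 oF1] := oF s1 h1 h2; have [_ B] := H s1 h1 h3.
split => // -[A' LA' [n n_lt0 nA']].
have [rho [f [g [Lf Lg P0]]]] := pairing_op_neq0 (LA'.1 n) nA'.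
have [D [e [D0 e0 HD]]] := B _ _ _ (sl rho f g Lf Lg).
have [N' [d' [d'0 A'0 _ sl']]] := is_laurent_slaurent s10 LA'.
(* The pairing is bounded near [s1], so its expansion there has no term of negative order; but it
   was chosen with a nonzero coefficient of order n < 0. *)
have c0 := slaurent_removable s10 d'0 (sl' rho f g Lf Lg) D0 e0 HD.
have [nN|Nn] := ltP n (- N'%:Z); first exact: nA' (A'0 n nN).
have [k kE] : exists k : nat, n + N'%:Z = k%:Z.
  by exists (absz (n + N'%:Z)%R); rewrite gez0_abs// -lerBlDr sub0r.
have kN : (k < N')%N by rewrite -ltz_nat -kE gtrDr.
by move: P0; rewrite -[n](addrK N'%:Z) kE c0 ?eqxx.
Qed.

(** For s = a + ib the imaginary part of -1/s is b / |s|^2, of the same sign as b. *)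
Lemma Im_psurf (s : C) : 0 < complex.Im s -> s != 0 /\ 0 < complex.Im (psurf s).2.
Proof.
have E2 : (psurf s).2 = (s - s^-1) * (2^-1 : R)%:C by rewrite fmorphV rmorph_nat.
rewrite E2 ImM; case: s {E2} => a b /= b0.
have ab : 0 < a ^+ 2 + b ^+ 2 by rewrite ltr_wpDl ?sqr_ge0// exprn_gt0.
split; first by rewrite eq_complex /= [b == 0]gt_eqF// andbF.
rewrite mulr0 add0r mulr_gt0 ?invr_gt0//.
by rewrite opprK addr_gt0// divr_gt0.
Qed.

Lemma Im_le_nC (z : C) : `|complex.Im z| <= nC z.
Proof.
case: z => a b; rewrite /nC normc_def /= -sqrtr_sqr ler_wsqrtr//.
by rewrite lerDr sqr_ge0.
Qed.

Section continuation.
Variable V : R3 -> 'M[C]_(2 + 2).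
Hypothesis hTV : forall psi : spinor, L2 psi ->
  time_reversal (mulop V psi) = mulop (adjoint V) (time_reversal psi) %[ae leb3 R].
Variable F : C * C -> operator.
Hypothesis hF : resolvent_continuation V F.

Lemma resolvent_pairing_antisym z w rho f g : riemann_surface (z, w) ->
  ~ is_pole F (z, w) -> 0 < complex.Im w -> is_op (F (z, w)) ->
  L2 f -> L2 g -> supported_in_ball rho f -> supported_in_ball rho g ->
  pairing rho f (F (z, w) g) + pairing rho g (F (z, w) f) = 0.
Proof.
move=> zw np w0 [_ HF _ _] Lf Lg sf sg.
have [/contrapT [S HS] /(_ _ HS) FS] := hF.2 z w zw np w0.
have Cf : L2comp f by split => //; exists rho.
have Cg : L2comp g by split => //; exists rho.
have [_ S1 _] := HS.
have LS u : L2 u -> L2 (S u) by move=> /S1 [[]].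
rewrite (pairing_supported Lf sf (HF g Cg) (LS g Lg) (FS g Cg)).
rewrite (pairing_supported Lg sg (HF f Cf) (LS f Lf) (FS f Cf)).
by rewrite (resolvent_antisym hTV HS Lf Lg) addNr.
Qed.

Lemma laurent_antisym (s0 : C) (A : int -> operator) rho f g :
  (forall y : R, 0 <= y -> s0 + 'i * y%:C != 0) -> is_laurent F (psurf s0) A ->
  L2 f -> L2 g -> supported_in_ball rho f -> supported_in_ball rho g ->
  pairing rho f (A (-1) g) = - pairing rho g (A (-1) f).
Proof.
move=> hs LA Lf Lg sf sg.
have Cf : L2comp f by split => //; exists rho.
have Cg : L2comp g by split => //; exists rho.
pose phi s := pairing rho f (F (psurf s) g) + pairing rho g (F (psurf s) f).
have phi_slaurent s B : s != 0 -> is_laurent F (psurf s) B -> exists N d,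
    [/\ 0 < d, forall n : int, n < - N%:Z -> op_eq (B n) 0 & slaurent s d phi (fun k =>
     pairing rho f (B (k%:Z - N%:Z) g) + pairing rho g (B (k%:Z - N%:Z) f)) N].
  move=> n0 LB; have [N [d [d0 B0 _ sl]]] := is_laurent_slaurent n0 LB.
  by exists N, d; split => //; apply: slaurentD; exact: sl.
have mero s : s != 0 -> exists B, is_laurent F (psurf s) B.
  by move=> n0; have [B [LB _ _]] := hF.1 _ (psurf_riemann n0); exists B.
have Z0 : punctured_zero phi s0.
  (* From this height on, the path lies in the upper half-plane, where Im w > 0 and [F] is the
     resolvent off its poles. *)
  apply: (@punctured_zero_continuation _ phi s0 (`|complex.Im s0| + 1)) => y hy.
    have n0 := hs y hy; split => //.
    have [B LB] := mero _ n0; have [N [d [d0 _ sl]]] := phi_slaurent _ _ n0 LB.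
    by exists d; do 2 eexists; split; [|exact: sl].
  set s := s0 + 'i * y%:C.
  have Is : 0 < complex.Im s.
    rewrite /s ImD ImM /= mul0r mul1r add0r.
    by have := ler_norm (- complex.Im s0); rewrite normrN; lra.
  have [n0 _] := Im_psurf Is; have [B LB] := mero _ n0.
  (* The half-plane may contain poles, even at the centre; a punctured disc free of them is what the
     resolvent identity needs. *)
  have [d d0 Hd] := pole_isolated n0 LB.
  exists (Num.min d (complex.Im s)); first by rewrite lt_min d0.
  move=> t t1; rewrite lt_min => /andP[t2 t3].
  have [tn0 oF np] := Hd t t1 t2.
  have It : 0 < complex.Im t.
    have := le_lt_trans (Im_le_nC (t - s)) t3; rewrite raddfB /= ltr_norml.
    by move=> /andP[]; lra.
  have [_ w0] := Im_psurf It.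
  have := psurf_riemann tn0; rewrite /phi; move: oF np w0.
  by case: (psurf t) => z w oF np w0 zw; exact: resolvent_pairing_antisym.
have n0 : s0 != 0 by have := hs 0 (lexx _); rewrite mulr0 addr0.
have [N [d [d0 A0 sl]]] := phi_slaurent _ _ n0 LA.
have [e e0 He] := Z0.
have [c0 _] : (forall k, pairing rho f (A (k%:Z - N%:Z) g) +
    pairing rho g (A (k%:Z - N%:Z) f) = 0) /\ punctured_zero phi s0.
  apply: (slaurent_zeros n0 d0 sl) => a a0.
  have m0 : 0 < Num.min a e by rewrite lt_min a0.
  have [t [t1]] := disc_point s0 m0; rewrite lt_min => /andP[t2 t3].
  by exists t; split => //; exact: He.
apply/eqP; rewrite -addr_eq0; apply/eqP.
(* For N = 0 there is no term of negative order and [A (-1)] is zero; otherwise order -1 is the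
   index N - 1. *)
have [N0|N0] := posnP N.
  have oA := LA.1 (-1); have [_ HA _ _] := oA.
  have P0 a b : L2 a -> L2comp b -> pairing rho a (A (-1) b) = 0.
    move=> La Cb; have := @pairing_sum R void [::] (fun=> 0) (fun=> 0) rho a (A (-1) b) La (HA b Cb).
    rewrite !big_nil; apply; first by case.
    by apply: A0 => //; rewrite N0.
  by rewrite !P0// addr0.
have := c0 N.-1; have -> : N.-1%:Z - N%:Z = -1.
  by rewrite -{2}(prednK N0) -addn1 PoszD opprD addrA subrr add0r.
by [].
Qed.
End continuation.
End poles.

(** * Parity of the rank *)

Section rank.
Variable R : realType.
Local Notation C := R[i].
Local Notation R3 :=
  (measurableTypeR R * measurableTypeR R * measurableTypeR R)%type.
Local Notation spinor := (R3 -> 'cV[C]_(2 + 2)).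
Local Notation operator := (spinor -> spinor).

Lemma supported_sum (I : Type) (s : seq I) (c : I -> C) (f : I -> spinor) rho :
  (forall k, supported_in_ball rho (f k)) ->
  supported_in_ball rho (\sum_(k <- s) c k *: f k).
Proof.
move=> H; elim: s => [|i s IH]; first by rewrite big_nil; exact: aeW.
by rewrite big_cons; exact: supportedDZ.
Qed.

(** Invertibility of the matrix: if v M = 0, then h = sum of the v_k f_k satisfies B(f_l, A h) = 0
    for all l. For any g, antisymmetry turns B(g, A h) into -B(h, A g); since A g is a combination
    of the A f_k, this is again a combination of the B(f_k, A h). Nondegeneracy then gives A h = 0,
    and independence of the A f_k gives v = 0. *)
Lemma antisym_rank_even (A : operator) m : is_op A ->
  (forall rho f g, L2 f -> L2 g -> supported_in_ball rho f -> supported_in_ball rho g ->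
     pairing rho f (A g) = - pairing rho g (A f)) ->
  has_rank A m -> ~~ odd m.
Proof.
move=> oA anti [f [Hf free span]]; have [_ HA _ _] := oA.
have [rho sf] : exists rho, forall k, supported_in_ball rho (f k).
  have /choice[r Hr] : forall k, exists r, supported_in_ball r (f k).
    by move=> k; have [] := Hf k.
  exists (\big[Num.max/0]_k r k) => k.
  by apply: supported_mono (Hr k); exact: le_bigmax.
have Lf k : L2 (f k) by case: (Hf k).
pose M := \matrix_(k < m, l < m) pairing rho (f k) (A (f l)).
have MT : M^T = - M.
  by apply/matrixP => k l; rewrite !mxE anti.
have detM : \det M != 0.
  apply/det0P => -[v /rV0Pn[k0 vk0] vM].
  pose h := \sum_k v 0 k *: f k.
  have [Ch Eh] := op_sum (index_enum 'I_m) (fun k => v 0 k) oA Hf.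
  have Lh : L2 h by case: Ch.
  have sh : supported_in_ball rho h by exact: supported_sum.
  have Ph l : pairing rho (f l) (A h) = 0.
    rewrite pairing_op_sum//.
    have E : (v *m M) 0 l = 0 by rewrite vM mxE.
    transitivity (- (v *m M) 0 l); last by rewrite E oppr0.
    rewrite mxE -sumrN; apply: eq_bigr => k _.
    by rewrite mxE -mulrN (anti _ _ _ (Lf l) (Lf k) (sf l) (sf k)).
  have Ah0 : A h = 0 %[ae leb3 R].
    apply: pairing_nondegenerate; first exact: HA.
    (* Antisymmetry is available only for a radius covering both supports; [pairing_radius] allows
       the change of radius. *)
    move=> r g Lg sg; pose r1 := Num.max r rho.
    have sg1 : supported_in_ball r1 g by apply: supported_mono sg; rewrite le_max lexx.
    have rr : rho <= r1 by rewrite le_max lexx orbT.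
    have s1 u : supported_in_ball rho u -> supported_in_ball r1 u by exact: supported_mono.
    rewrite -(pairing_radius Lg sg (_ : r <= r1)); [|by rewrite le_max lexx|exact: HA].
    have Cg : L2comp g by split => //; exists r.
    have [b Eb] := span g Cg.
    rewrite (anti _ _ _ Lg Lh sg1 (s1 _ sh)).
    rewrite (pairing_sum (h := fun k => A (f k)) r1 Lh (HA g Cg) (fun k => HA _ (Hf k)) Eb).
    rewrite big1 ?oppr0// => k _.
    rewrite (anti _ _ _ Lh (Lf k) (s1 _ sh) (s1 _ (sf k))).
    by rewrite (pairing_radius (Lf k) (sf k) rr (HA h Ch)) Ph oppr0 mulr0.
  move/eqP: vk0; apply; apply: free => //.
  apply: ae_mono2 Eh Ah0 => x H1 H2 _.
  by rewrite -(H1 Logic.I) (H2 Logic.I).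
(* Taking determinants, det M = det M^T = (-1)^m det M, which is impossible for odd m. *)
apply/negP => om; have := det_tr M; rewrite MT -scaleN1r detZ -signr_odd om expr1 mulN1r.
move=> /esym/eqP; rewrite -addr_eq0 -mulr2n -mulr_natl mulf_eq0 pnatr_eq0 /=.
exact/negP.
Qed.
End rank.

Theorem corollary3p1 (R : realType) (V : R3 R -> 'M[R[i]]_(2 + 2))
    (hVbounded : Linfty V) (hVcompact : compactly_supported V)
    (hTV : forall psi : spinor R, L2 psi ->
       time_reversal (mulop V psi) = mulop (adjoint V) (time_reversal psi)
         %[ae leb3 R])
    (F : R[i] * R[i] -> operator R) (hF : resolvent_continuation V F)
    (lambda kappa : R[i]) (hres : is_resonance F (lambda, kappa))
    (hkappa : ~ [set 'i * y%:C | y in [set y : R | y <= 0]] kappa) :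
  (exists m, multiplicity F (lambda, kappa) m) /\
  (forall m, multiplicity F (lambda, kappa) m -> ~~ odd m).
Proof.
have [s0n0 Es0] := psurf_surj hres.1; rewrite /= in s0n0 Es0.
set s0 := lambda + kappa in s0n0 Es0.
have path (y : R) : 0 <= y -> s0 + 'i * y%:C != 0.
  move=> y0; apply/eqP => /eqP; rewrite addr_eq0 => /eqP E; apply: hkappa.
  have yn0 : y != 0 by apply/eqP => yE; move: s0n0; rewrite E yE mulr0 oppr0 eqxx.
  have ycn0 : y%:C != 0 :> R[i] by rewrite -[0]/((0 : R)%:C) (inj_eq (@complexI R)).
  (* From s0 = -iy and 1/s0 = i/y, the formula kappa = (s0 - 1/s0) / 2 gives this point of the
     negative imaginary axis. *)
  exists (- (y + y^-1) / 2); first by rewrite /= mulNr oppr_le0 divr_ge0// addr_ge0// invr_ge0.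
  have -> : kappa = (s0 - s0^-1) / 2 by have := congr1 snd Es0.
  have -> : s0^-1 = 'i * (y^-1)%:C.
    apply: (mulfI s0n0); rewrite mulfV// E mulNr mulrACA sqri mulN1r opprK -rmorphM /=.
    by rewrite mulfV.
  rewrite E !rmorphM rmorphN rmorphD !fmorphV rmorph_nat /=.
  ring.
split.
  have [A [LA fr _]] := hF.1 _ hres.1.
  by have [m Hm] := fr (-1) isT; exists m, A.
move=> m [A LA rA]; apply: antisym_rank_even rA; first exact: LA.1.
move=> rho f g Lf Lg sf sg; rewrite -Es0 in LA.
exact: (laurent_antisym hTV hF path LA Lf Lg sf sg).
Qed.
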